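(* Let $\ell,k\ge 5$ be odd integers, and let $\mathcal G=\{G_i\mid i\ge 0\}$ be the family of graphs constructed from $\ell$ and $k$ as described in the context. Then every graph $G\in\mathcal G$ is a nonsolid brick in which every removable edge of $G$ is solitary. Furthermore, $G$ cannot be obtained by splicing a brick and a $K_4$ up to multiple edges; that is, there do not exist a brick $H$ and a graph $K$ whose underlying simple graph is $K_4$ such that $G$ is a splicing of $H$ and $K$.
   Context: Graphs are finite and loopless; multiple edges are allowed unless a graph is called simple. For $\emptyset\ne X\subset V(G)$ put $\overline X=V(G)\setminus X$; the edge cut $\partial(X)$ is the set of edges with one end in $X$ and the other in $\overline X$ (and $\partial(u)=\partial(\{u\})$). It is trivial if $|X|=1$ or $|\overline X|=1$. A matching covered graph is a connected graph with at least one edge in which each edge lies in some perfect matching. $G/X$ is the graph obtained from $G$ by contracting $X$ to a single vertex (deleting resulting loops, keeping multiple edges); $G/X$ and $G/\overline X$ are the two $\partial(X)$-contractions of $G$. An edge cut $\partial(X)$ of a matching covered graph $G$ is separating if both $\partial(X)$-contractions are matching covered, and tight if $|\partial(X)\cap M|=1$ for every perfect matching $M$ of $G$. A brick is a nonbipartite matching covered graph with no nontrivial tight cuts (equivalently, a 3-connected graph $G$ such that $G-u-v$ has a perfect matching for any two distinct vertices $u,v$). A brick is solid if each of its separating cuts is tight, and nonsolid otherwise. An edge $e$ of a matching covered graph $G$ is removable if $G-e$ is matching covered. An edge is solitary if it lies in precisely one perfect matching. For $k\ge 3$, the wheel $W_k$ is obtained from a cycle of length $k$ (the rim) by adding a new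 vertex (the hub) joined to all vertices of the cycle; $W_k$ is odd if $k$ is odd. Splicing: given vertex-disjoint graphs $H,K$, vertices $u\in V(H)$, $v\in V(K)$ with $d_H(u)=d_K(v)$ and a bijection $\theta$ between $\partial_H(u)$ and $\partial_K(v)$, the splicing $(H(u)\odot K(v))_\theta$ is obtained from the union of $H-u$ and $K-v$ by adding, for each edge $e\in\partial_K(v)$, an edge joining the end of $e$ in $K-v$ to the end of $\theta(e)$ in $H-u$. A splicing of $H$ and $K$ is any graph obtained this way. Construction of $\mathcal G$. Let $W'_\ell$ and $W_k$ be (vertex-disjoint, simple) odd wheels with $\ell,k\ge5$, hubs $h'_\ell$ and $h_k$, and rim vertices, in cyclic order, $w'_1,\dots,w'_\ell$ and $w_1,\dots,w_k$ respectively. Let $L=W'_\ell-w'_\ell$ and $R=W_k-w_k$. For each integer $t\ge0$ let $B_t$ be the graph with vertex set $\{v_1^t,v_2^t,v_3^t,v_4^t\}$ and edge set $\{v_1^tv_2^t,\ v_3^tv_4^t\}$. For each $t\ge1$ introduce two additional vertices $w_2^t,w_3^t$. For each integer $i\ge0$ the graph $G_i$ has vertex set $$V(G_i)=V(L)\cup V(R)\cup\Big(\bigcup_{t=0}^{i}V(B_t)\Big)\cup\Big(\bigcup_{t=1}^{i}\{w_2^t,w_3^t\}\Big),$$ all these vertices being distinct. Write $w_3^0=h_k$ and $w_3^{i+1}=h'_\ell$. The edges of $G_i$ are: 1. all edges of $L$ and of $R$; 2. all edges $v_1^tv_2^t$ and $v_3^tv_4^t$ for $0\le t\le i$; 3.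 all edges $w_3^tv_j^t$, $w_3^{t+1}v_j^t$ and $w_3^tw_3^{t+1}$ for $0\le t\le i$, $1\le j\le4$; 4. all edges $w_2^tw_3^t$ for $1\le t\le i$; 5. the edges of the path $w'_1v_1^iv_1^{i-1}\cdots v_1^0w_1$; 6. the edges of the path $w'_{\ell-1}v_4^iw_2^iv_4^{i-1}w_2^{i-1}\cdots w_2^1v_4^0w_{k-1}$ if $i\ge1$, and of the path $w'_{\ell-1}v_4^0w_{k-1}$ if $i=0$. Each $G_i$ is a simple graph. *)

(* Defs.v *)
From HB Require Import structures.
From mathcomp Require Import all_boot.
Set Implicit Arguments.
Unset Strict Implicit.
Unset Printing Implicit Defensive.

(* Finite loopless graphs; distinct elements of [edge] may have the same ends. *)
Record mgraph := MGraph {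
  vertex : finType;
  edge : finType;
  ends : edge -> {set vertex};
  card_ends : forall e, #|ends e| = 2
}.

Arguments ends {G} e : rename.
Arguments card_ends {G} e : rename.

Section Basic.
Variable G : mgraph.
Implicit Types (X : {set vertex G}) (M : {set edge G}) (x y : vertex G).

Definition adj : rel (vertex G) :=
  fun x y => [exists e : edge G, ends e == [set x; y]].

Definition cut X : {set edge G} :=
  [set e | (ends e :&: X != set0) && (ends e :&: ~: X != set0)].

(* The cut operator is only meant for sets X with X and its complement
   nonempty. *)
Definition shore X := (X != set0) && (~: X != set0).

Definition trivial_cut X := (#|X| == 1) || (#|~: X| == 1).

Definition perfect_matching M :=
  [forall x, #|[set e in M | x \in ends e]| == 1].

Definition connected := [forall x, forall y, connect adj x y].

Definition matching_covered :=
  [&& connected, 0 < #|edge G| &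
      [forall e : edge G, exists M, perfect_matching M && (e \in M)]].

Definition bipartite := [exists X, cut X == [set: edge G]].

Definition tight X :=
  shore X && [forall M, perfect_matching M ==> (#|cut X :&: M| == 1)].

Definition brick :=
  [&& ~~ bipartite, matching_covered & [forall X, tight X ==> trivial_cut X]].

Definition solitary (e : edge G) :=
  #|[set M | perfect_matching M && (e \in M)]| == 1.

Lemma endsP (e : edge G) : exists x y, x != y /\ ends e = [set x; y].
Proof.
by apply/cards2P; rewrite card_ends.
Qed.

End Basic.

Section DeleteEdge.
Variables (G : mgraph) (e : edge G).

Definition delete_edge : mgraph :=
  @MGraph (vertex G) {f : edge G | f != e}
    (fun f => ends (val f)) (fun f => card_ends (val f)).

Definition removable := matching_covered delete_edge.

End DeleteEdge.

Section Contraction.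
Variables (G : mgraph) (X : {set vertex G}).

(* The map onto the vertices of G / X: [None] is the vertex that X is
   contracted to, and [insub] sends exactly the members of X to it. *)
Definition contract_vertex (x : vertex G) : option {y | y \notin X} := insub x.

Definition contract_ends (e : {e : edge G | ~~ (ends e \subset X)}) :=
  contract_vertex @: ends (val e).

Lemma card_contract_ends e : #|contract_ends e| = 2.
Proof.
case: e => e he; rewrite /contract_ends /=.
have [x [y [nxy ee]]] := endsP e; rewrite ee in he *.
rewrite imsetU1 imset_set1 cards2.
have -> : contract_vertex x != contract_vertex y => //.
apply/eqP; rewrite /contract_vertex.
case: insubP => [u hu eu|hx]; case: insubP => [v hv ev|hy] //.
  by case=> uv; rewrite -eu -ev uv eqxx in nxy.
move=> _; move/negP: he; apply.
by apply/subsetP => z; rewrite !inE => /orP[]/eqP->; apply: negbNE.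
Qed.

Definition contract : mgraph := MGraph card_contract_ends.

End Contraction.

Section Separating.
Variable G : mgraph.

Definition separating (X : {set vertex G}) :=
  [&& shore X, matching_covered (contract X) &
      matching_covered (contract (~: X))].

Definition solid := [forall X : {set vertex G}, separating X ==> tight X].

Definition nonsolid_brick := brick G && ~~ solid.

End Separating.

Definition iso (G H : mgraph) : Prop :=
  exists (f : vertex G -> vertex H) (g : edge G -> edge H),
    [/\ bijective f, bijective g & forall e, ends (g e) = f @: ends e].

Section SimpleGraph.
Variables (T : finType) (r : rel T).

(* The simple graph on T in which distinct x and y are joined iff r x y or
   r y x. *)
Definition simple_edge (A : {set T}) :=
  [exists x, exists y, [&& x != y, r x y & A == [set x; y]]].

Lemma card_simple_edge (A : {A | simple_edge A}) : #|val A| = 2.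
Proof.
case: A => A /= /existsP[x /existsP[y /and3P[nxy _ /eqP->]]].
by rewrite cards2 nxy.
Qed.

Definition simple_graph : mgraph := MGraph card_simple_edge.

End SimpleGraph.

Definition underlying_simple (G : mgraph) : mgraph := simple_graph (@adj G).

Definition complete_graph (n : nat) : mgraph :=
  simple_graph (fun x y : 'I_n => x != y).

Section Splicing.
Variables (H K : mgraph) (u : vertex H) (v : vertex K).
Variable theta : {e : edge K | v \in ends e} -> {e : edge H | u \in ends e}.

Notation vertexHu := {x : vertex H | x != u}.
Notation vertexKv := {y : vertex K | y != v}.
Notation edgeHu := {e : edge H | u \notin ends e}.
Notation edgeKv := {e : edge K | v \notin ends e}.

(* The members of A other than u (of B other than v), seen in the disjoint
   union of H - u and K - v. *)
Definition splice_inl (A : {set vertex H}) : {set vertexHu + vertexKv} :=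
  [set z | if z is inl x then val x \in A else false].

Definition splice_inr (B : {set vertex K}) : {set vertexHu + vertexKv} :=
  [set z | if z is inr y then val y \in B else false].

Definition splice_ends (e : edgeHu + edgeKv + {e : edge K | v \in ends e}) :=
  match e with
  | inl (inl e) => splice_inl (ends (val e))
  | inl (inr e) => splice_inr (ends (val e))
  | inr e => splice_inl (ends (val (theta e))) :|: splice_inr (ends (val e))
  end.

Lemma card_splice_inl A : #|splice_inl A| = #|A :\ u|.
Proof.
have -> : splice_inl A =
    [set inl x | x : vertexHu in [set x | val x \in A]].
  apply/setP=> -[x|y]; rewrite !inE.
    by rewrite mem_imset ?inE // => a b [].
  by apply/esym/imsetP => -[].
rewrite card_imset; last by move=> a b [].
rewrite -(card_imset _ val_inj); apply: eq_card => x.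
apply/imsetP/idP => [[y + ->]|]; first by rewrite !inE (valP y) => ->.
by rewrite !inE => /andP[hx xA]; exists (Sub x hx); rewrite ?inE.
Qed.

Lemma card_splice_inr B : #|splice_inr B| = #|B :\ v|.
Proof.
have -> : splice_inr B =
    [set inr x | x : vertexKv in [set x | val x \in B]].
  apply/setP=> -[x|y]; rewrite !inE; last by rewrite mem_imset ?inE // => a b [].
  by apply/esym/imsetP => -[].
rewrite card_imset; last by move=> a b [].
rewrite -(card_imset _ val_inj); apply: eq_card => x.
apply/imsetP/idP => [[y + ->]|]; first by rewrite !inE (valP y) => ->.
by rewrite !inE => /andP[hx xB]; exists (Sub x hx); rewrite ?inE.
Qed.

Lemma card_splice_ends e : #|splice_ends e| = 2.
Proof.
case: e => [[[e he]|[e he]]|[e he]] /=.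
- by rewrite card_splice_inl -(card_ends e) [RHS](cardsD1 u) (negbTE he).
- by rewrite card_splice_inr -(card_ends e) [RHS](cardsD1 v) (negbTE he).
rewrite cardsU disjoint_setI0 ?cards0 ?subn0; last first.
  by rewrite -setI_eq0; apply/eqP/setP => -[x|y]; rewrite !inE ?andbF.
rewrite card_splice_inl card_splice_inr; case: (theta _) => f hf /=.
have := card_ends e; have := card_ends f.
by rewrite (cardsD1 u) hf add1n => -[->]; rewrite (cardsD1 v) he add1n => -[->].
Qed.

Definition splice : mgraph := MGraph card_splice_ends.

End Splicing.

(* The equality of the degrees of u and v is implied by the bijectivity of
   theta. *)
Definition is_splicing (G H K : mgraph) : Prop :=
  exists (u : vertex H) (v : vertex K)
         (theta : {e : edge K | v \in ends e} -> {e : edge H | u \in ends e}),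
    bijective theta /\ iso G (splice theta).

(* Vertex names of the graphs G_i:
   [WL j] = w'_j, [HL] = h'_l, [WR j] = w_j, [HR] = h_k,
   [VB t j] = v_j^t, [W2 t] = w_2^t and [W3 t] = w_3^t for 1 <= t <= i. *)
Inductive name :=
  WL of nat | HL | WR of nat | HR | VB of nat & nat | W2 of nat | W3 of nat.

Definition name_code (x : name) : nat * nat * nat :=
  match x with
  | WL j => (0, j, 0)
  | HL => (1, 0, 0)
  | WR j => (2, j, 0)
  | HR => (3, 0, 0)
  | VB t j => (4, t, j)
  | W2 t => (5, t, 0)
  | W3 t => (6, t, 0)
  end.

Definition name_decode (c : nat * nat * nat) : name :=
  match c with
  | (0, j, _) => WL j
  | (1, _, _) => HL
  | (2, j, _) => WR j
  | (3, _, _) => HR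
  | (4, t, j) => VB t j
  | (5, t, _) => W2 t
  | (_, t, _) => W3 t
  end.

Lemma name_codeK : cancel name_code name_decode.
Proof. by case. Qed.

HB.instance Definition _ := Countable.copy name (can_type name_codeK).

Definition path_edges (s : seq name) : seq (name * name) := zip s (behead s).

Section Wheel.
Variables (w : nat -> name) (h : name) (n : nat).

Definition wheel_vertices : seq name := h :: [seq w j | j <- iota 1 n].

Definition wheel_edges : seq (name * name) :=
  path_edges (rcons [seq w j | j <- iota 1 n] (w 1))
    ++ [seq (h, w j) | j <- iota 1 n].

(* The wheel with its last rim vertex w_n deleted. *)
Definition cut_wheel_vertices : seq name :=
  [seq x <- wheel_vertices | x != w n].

Definition cut_wheel_edges : seq (name * name) :=
  [seq e <- wheel_edges | (e.1 != w n) && (e.2 != w n)].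

End Wheel.

Section Family.
Variables l k i : nat.

(* The convention w_3^0 = h_k and w_3^(i+1) = h'_l. *)
Definition w3 (t : nat) : name :=
  if t == 0 then HR else if t == i.+1 then HL else W3 t.

Definition G_vertices : seq name :=
  cut_wheel_vertices WL HL l ++ cut_wheel_vertices WR HR k
    ++ [seq VB t j | t <- iota 0 i.+1, j <- iota 1 4]
    ++ [seq W2 t | t <- iota 1 i] ++ [seq W3 t | t <- iota 1 i].

Definition G_edges : seq (name * name) :=
  cut_wheel_edges WL HL l ++ cut_wheel_edges WR HR k
    ++ [seq (VB t 1, VB t 2) | t <- iota 0 i.+1]
    ++ [seq (VB t 3, VB t 4) | t <- iota 0 i.+1]
    ++ [seq (w3 t, VB t j) | t <- iota 0 i.+1, j <- iota 1 4]
    ++ [seq (w3 t.+1, VB t j) | t <- iota 0 i.+1, j <- iota 1 4]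
    ++ [seq (w3 t, w3 t.+1) | t <- iota 0 i.+1]
    ++ [seq (W2 t, w3 t) | t <- iota 1 i]
    ++ path_edges (WL 1 :: [seq VB t 1 | t <- rev (iota 0 i.+1)] ++ [:: WR 1])
    ++ path_edges (WL l.-1 :: VB i 4 ::
         flatten [seq [:: W2 t; VB t.-1 4] | t <- rev (iota 1 i)]
         ++ [:: WR k.-1]).

Definition G_ : mgraph :=
  simple_graph (fun x y : seq_sub G_vertices => (val x, val y) \in G_edges).

End Family.

(* Main.v *)
From HB Require Import structures.
Require Import Defs.
From mathcomp Require Import all_boot zify.
Set Implicit Arguments.
Unset Strict Implicit.
Unset Printing Implicit Defensive.

(** Write [Hub t] for w_3^t, with h_k = w_3^0 and h'_l = w_3^(i+1).  Removing the
    hubs from G_i leaves a cycle with pendant vertices, cut into levels, and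
    edges join equal or consecutive levels.  The set of vertices below level t
    is odd, and its cut contains, besides edges at [Hub t], only two edges: one
    on the path through the v_1 and one on the path through the v_4.
    Perfect matchings are handled as fixed-point-free involutions.

    Most perfect matchings are thin: they cross each of these cuts once.  Below
    a centre level a canonical thin matching crosses along the v_4 path, above
    it at a v_3; rematching a few vertices near the centre gives, for every edge
    e, a thin perfect matching that contains e ([edge_in_unique_thin]).

    Removable edges.  If a perfect matching joins a hub to a rim vertex, another
    hub, a v_1, a v_4 or a w_2, then the mates of all other vertices are forced,
    going down and up from the level of that edge ([lower_forced],
    [upper_forced]); so these edges are solitary.  Every other edge e lies in
    the unique perfect matching through such an edge f, hence f is in no perfect
    matching of G - e and e is not removable ([removable_solitary]).

    Brick and nonsolid.  Contracting everything below level t and everything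
    above it leaves a graph with a spanning odd wheel around [Hub t].  An odd
    wheel has no nontrivial tight cut: if the rim vertex a and the hub are on
    different sides, each rim edge of the perfect matching through the spoke at a
    has both ends on one side ([wheel_sides]).  Tight sets of G_i are bounded level by
    level by uncrossing them with the levels ([chain_step]); what could go wrong
    is excluded by three disjoint edges in each cut, and by matchings that cross
    it three times.  The top cut is separating because every edge is in a thin
    matching, and not tight because of a matching with three edges in it.

    Splicings.  If G_i were spliced from a brick H and a K_4 up to multiple
    edges, H would be G_i with a triangle T contracted to one vertex.  But for
    every triangle T some vertex w is such that T and w together separate G_i
    ([triangle_separated]), so H would have a 2-separation, and thus a
    nontrivial tight cut ([brick_no_two_separation]). *)

(** * Crossings of vertex sets by a perfect matching *)

Section Crossing.
Variable T : finType.
Implicit Types (m : T -> T) (X Y S : {set T}).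

Definition crossing m X := [set x in X | m x \notin X].

Definition pairing m := forall x, m x != x /\ m (m x) = x.

Lemma pairing_inj m : pairing m -> injective m.
Proof. by move=> hm; apply: (can_inj (g := m)) => x; case: (hm x). Qed.

Lemma crossingC m X : pairing m -> #|crossing m (~: X)| = #|crossing m X|.
Proof.
move=> hm; rewrite -(card_imset _ (pairing_inj hm)); apply: eq_card => y.
rewrite inE; apply/imsetP/idP => [[x + ->]|/andP[yX myX]].
  by rewrite !inE negbK (hm x).2 => /andP[-> ->].
by exists (m y); rewrite ?(hm y).2 // !inE myX (hm y).2 negbK.
Qed.

Lemma closed_even m X : pairing m -> {in X, forall x, m x \in X} -> ~~ odd #|X|.
Proof.
move=> hm; have [n] := ubnP #|X|; elim: n X => // n IH X ltXn mX.
have [->|[x xX]] := set_0Vmem X; first by rewrite cards0.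
have mxX := mX x xX; have [nmx mmx] := hm x.
have mxD : m x \in X :\ x by rewrite !inE nmx.
rewrite (cardsD1 x) xX (cardsD1 (m x)) mxD /= negbK; apply: IH.
  move: ltXn; rewrite (cardsD1 x) xX (cardsD1 (m x) (X :\ x)) mxD /=; lia.
move=> y; rewrite !inE => /and3P[y1 y2 yX]; rewrite mX // andbT.
apply/andP; split; last by apply: contra_neq y1 => <-; rewrite (hm y).2.
by apply: contra_neq y2 => /(pairing_inj hm).
Qed.

Lemma odd_crossing m X : pairing m -> odd #|crossing m X| = odd #|X|.
Proof.
move=> hm; have sub : crossing m X \subset X.
  by apply/subsetP => x; rewrite inE => /andP[].
have /negbTE ev : ~~ odd #|X :\: crossing m X|.
  apply: (closed_even hm) => x; rewrite !inE => /andP[+ xX].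
  rewrite xX /= negbK => mx; by rewrite (hm x).2 mx xX.
have := cardsID (crossing m X) X; rewrite (setIidPr sub) => <-.
by rewrite oddD ev addbF.
Qed.

(** Two sets that are each crossed once uncross: counting ends of matching
    edges shows that the crossings of [S :&: Y] and of [S :|: Y] add up to at
    most two, and neither number can vanish, for parity reasons. *)
Lemma uncross m S Y : pairing m ->
  #|crossing m S| = 1 -> #|crossing m Y| = 1 -> odd #|S :&: Y| ->
  [/\ #|crossing m (S :&: Y)| = 1, #|crossing m (S :|: Y)| = 1 &
      forall x, x \in S :\: Y -> m x \notin Y :\: S].
Proof.
move=> hm dS dY oI.
have oS : odd #|S| by rewrite -(odd_crossing S hm) dS.
have oY : odd #|Y| by rewrite -(odd_crossing Y hm) dY.
have oU : odd #|S :|: Y|.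
  have := cardsUI S Y; move: oI oS oY; lia.
have pI : 0 < #|crossing m (S :&: Y)|.
  by apply: odd_gt0; rewrite odd_crossing.
have pU : 0 < #|crossing m (S :|: Y)|.
  by apply: odd_gt0; rewrite odd_crossing.
pose D := [set x in S :\: Y | m x \in Y :\: S].
pose D' := [set x in Y :\: S | m x \in S :\: Y].
have count : #|crossing m (S :&: Y)| + #|crossing m (S :|: Y)| + #|D| + #|D'|
    = #|crossing m S| + #|crossing m Y|.
  rewrite /crossing /D /D' -!sum1dep_card.
  rewrite !(big_mkcond (fun x => _ && _)) -!big_split; apply: eq_bigr => x _ /=.
  by rewrite !inE; do 4 case: (_ \in _).
have D0 : #|D| = 0 by lia.
split; [lia | lia|].
move=> x xS; apply/negP => mxY.
by move/eqP: D0; rewrite cards_eq0 => /eqP/setP/(_ x); rewrite in_set xS mxY inE.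
Qed.

(** One step of the induction that bounds tight sets along a chain of sets
    [Y \subset Y'].  Here [Ms] is a family of perfect matchings; [thin] selects
    those with a single edge in the cut of [Y].  The first hypothesis about sets
    [S] bounds them in the contraction of the complement of [Y], the other two
    in that of both [Y] and the complement of [Y'].  Where uncrossing a tight
    set [S] with [Y] does not show that [S] is trivial, it leaves either
    [S = Y], which a matching that is not thin excludes, or at most one vertex
    on each side of [Y] through which the edges of thin matchings in the cut of
    [Y] must pass; three disjoint edges prevent this. *)
Lemma chain_step (Ms : (T -> T) -> Prop) Y Y' :
  let thin m := Ms m /\ #|crossing m Y| = 1 in
  (forall m, Ms m -> pairing m) -> Y \subset Y' ->
  (exists2 m, Ms m & #|crossing m Y| != 1) ->
  (forall S, S \subset Y -> (forall m, thin m -> #|crossing m S| = 1) ->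
     #|S| = 1 \/ S = Y) ->
  (forall S, Y \subset S -> S \subset Y' ->
     (forall m, thin m -> #|crossing m S| = 1) -> S = Y \/ S = Y') ->
  (forall S, S \subset Y' :\: Y ->
     (forall m, thin m -> #|crossing m S| = 1) -> #|S| = 1) ->
  (exists a1 a2 a3 b1 b2 b3,
    [/\ uniq [:: a1; a2; a3], uniq [:: b1; b2; b3],
        [/\ a1 \in Y, a2 \in Y & a3 \in Y],
        [/\ b1 \in Y' :\: Y, b2 \in Y' :\: Y & b3 \notin Y] &
        [/\ exists2 m, thin m & m a1 = b1, exists2 m, thin m & m a2 = b2 &
            exists2 m, thin m & m a3 = b3]]) ->
  forall S, S \subset Y' -> (forall m, Ms m -> #|crossing m S| = 1) ->
    #|S| = 1 \/ S = Y'.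
Proof.
move=> thin hMs sYY' [mn Mmn nthin] IH upperU upperD.
move=> [a1 [a2 [a3 [b1 [b2 [b3 [ua ub [a1Y a2Y a3Y] [b1Y b2Y b3Y] []]]]]]]].
move=> [m1 tm1 m1a] [m2 tm2 m2a] [m3 tm3 m3a] S sSY' tS.
have tSt m : thin m -> #|crossing m S| = 1 by case=> /tS.
have hmt m : thin m -> pairing m by case=> /hMs.
(* Uncross [S] with [Y] or with its complement, whichever it meets oddly. *)
have [oI|eI] := boolP (odd #|S :&: Y|).
  have unc m : thin m -> _ := fun tm => uncross (hmt m tm) (tSt m tm) tm.2 oI.
  have nocross m x : thin m -> x \in Y -> x \notin S -> m x \in S -> m x \in Y.
    move=> tm xY xS mxS; apply: contraT => mxY.
    have [_ _ /(_ (m x))] := unc m tm.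
    by rewrite !inE mxS mxY (hmt m tm x).2 xY xS => /(_ isT).
  have hI : #|S :&: Y| = 1 \/ S :&: Y = Y.
    by apply: IH; rewrite ?subsetIr // => m /unc[].
  have hU : S :|: Y = Y \/ S :|: Y = Y'.
    apply: upperU; rewrite ?subsetUr //; first by rewrite subUset sSY'.
    by move=> m /unc[].
  case: hU => [/setUidPr sSY|hU].
    case: hI => hI; first by left; rewrite -hI (setIidPl sSY).
    have eSY : S = Y by rewrite -hI; apply/esym/setIidPl.
    by case/eqP: nthin; rewrite -eSY tS.
  case: hI => [/eqP/cards1P[a hI]|/setIidPr sYS]; last first.
    by right; rewrite -hU; apply/esym/setUidPl.
  have inS b : b \in Y' :\: Y -> b \in S.
    by rewrite inE -hU inE => /andP[/negbTE->]; rewrite orbF.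
  have isa x m b : thin m -> x \in Y -> b \in Y' :\: Y -> m x = b -> x = a.
    move=> tm xY bY mx; apply/eqP; rewrite -in_set1 -hI inE xY andbT.
    apply: contraT => xS; have := nocross m x tm xY xS.
    by rewrite mx inS // => /(_ isT) bY2; move: bY; rewrite inE bY2.
  move: ua; rewrite /= (isa a1 m1 b1) // (isa a2 m2 b2) //.
  by rewrite inE eqxx.
have oY : odd #|Y| by rewrite -(odd_crossing Y (hmt m1 tm1)) tm1.2.
have oS : odd #|S| by rewrite -(odd_crossing S (hmt m1 tm1)) (tSt _ tm1).
have oIC : odd #|S :&: ~: Y|.
  by move: oS; rewrite -(cardsID Y S) setDE oddD (negbTE eI).
have unc m : thin m -> _ := fun tm => uncross (hmt m tm) (tSt m tm)
   (etrans (crossingC Y (hmt m tm)) tm.2) oIC.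
have hD : #|S :\: Y| = 1.
  apply: upperD; first exact: setSD.
  by move=> m /unc[+ _ _]; rewrite setDE.
have hC : #|Y :\: S| = 1 \/ Y :\: S = Y.
  apply: IH; first exact: subsetDl.
  move=> m tm; have [_ + _] := unc m tm; rewrite -crossingC; last exact: hmt.
  by rewrite setCU setCK setIC -setDE.
case/eqP/cards1P: hD => a hD.
case: hC => [/eqP/cards1P[b hC]|hC]; last first.
  left; rewrite -(cardsID Y S) hD cards1 addn1; apply/eqP.
  rewrite eqSS cards_eq0; apply/eqP/setP => x; rewrite !inE.
  by have := in_setD Y S x; rewrite hC; case: (x \in S); case: (x \in Y).
have hit x m y : thin m -> x \in Y -> y \notin Y -> m x = y ->
    (x == b) || (y == a).
  move=> tm xY yY mx; have [_ _ /(_ x)] := unc m tm.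
  have -> : (y == a) = (y \in S) by rewrite -in_set1 -hD inE yY.
  have -> : (x == b) = (x \notin S) by rewrite -in_set1 -hC inE xY andbT.
  rewrite !inE mx xY (negbTE yY) andbT /=.
  by case: (x \in S) => //= /(_ isT); rewrite negbK.
have nY y : y \in Y' :\: Y -> y \notin Y by rewrite inE => /andP[].
have h1 := hit _ _ _ tm1 a1Y (nY _ b1Y) m1a.
have h2 := hit _ _ _ tm2 a2Y (nY _ b2Y) m2a.
have h3 := hit _ _ _ tm3 a3Y b3Y m3a.
move: ua ub; rewrite /= !inE !negb_or => /and3P[/andP[n1 n2] n3 _].
move=> /and3P[/andP[n4 n5] n6 _]; move: n1 n2 n3 n4 n5 n6.
by case/orP: h1 => /eqP->; case/orP: h2 => /eqP->; case/orP: h3 => /eqP->;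
  rewrite ?eqxx.
Qed.

End Crossing.

(** The combinatorial heart of the fact that odd wheels have no nontrivial tight
    cuts.  [z a] tells whether the rim vertex [a] and the hub are on different
    sides.  If they are, then the perfect matching that uses the spoke at [a] has
    its crossing edge there, so each of its rim edges has both ends on one
    side. *)
Lemma wheel_sides (n : nat) (z : nat -> bool) : odd n ->
  (forall j a, j < n -> a < n -> z j -> a != j -> (j < a -> odd (a - j)) ->
     (a < j -> ~~ odd (j - a)) -> z a = z (if a.+1 == n then 0 else a.+1)) ->
  [\/ forall a, a < n -> z a, forall a, a < n -> ~~ z a |
      exists2 j, j < n & forall a, a < n -> z a = (a == j)].
Proof.
move=> on pz; pose next a := if a.+1 == n then 0 else a.+1.
have n_gt0 : 0 < n by case: n on {pz next}.
have next_lt a : a < n -> next a < n by rewrite /next; case: eqP; lia.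
have [/hasP[j + zj]|/hasPn nz] := boolP (has z (iota 0 n)); last first.
  by constructor 2 => a ltan; apply: nz; rewrite mem_iota add0n.
rewrite mem_iota add0n /= => ltjn.
(* Two consecutive rim vertices on the other side drag the whole rim along. *)
have [/hasP[j2]|/hasPn nadj] :=
    boolP (has (fun j => z j && z (next j)) (iota 0 n)).
  rewrite mem_iota add0n /= => lt2 z2; constructor 1.
  have chain c : z (iter c next j2) && z (next (iter c next j2)).
    elim: c => //= c /andP[zc zn]; rewrite zn /=.
    have ltc : iter c next j2 < n by elim: (c) => //= d; exact: next_lt.
    move: (iter c next j2) zc zn ltc => b zb zn ltb.
    have [n1|n1] := eqVneq n 1; first by move: zn; rewrite /next n1 (_ : b = 0) //; lia.
    have nextE : next b = b.+1 /\ b.+1 < n \/ next b = 0 /\ b.+1 = n.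
      by rewrite /next; case: eqP; lia.
    by rewrite -[z _](pz b (next b)) ?next_lt //; lia.
  have iterE c : iter c next j2 = (j2 + c) %% n.
    elim: c => [|c IH] /=; first by rewrite addn0 modn_small.
    rewrite IH /next addnS; move: (j2 + c) => b.
    rewrite -[in RHS]addn1 -modnDml addn1.
    have ltb := ltn_pmod b n_gt0.
    move: (b %% n) ltb => d ltd.
    case: eqP => [->|nd]; first by rewrite modnn.
    by rewrite modn_small //; lia.
  move=> a ltan; have := chain (a + n - j2); rewrite iterE.
  have -> : j2 + (a + n - j2) = a + n by lia.
  by rewrite modnDr modn_small // => /andP[].
constructor 3; exists j => // a ltan; have [->//|naj] := eqVneq a j.
have nadj' b : b < n -> z b -> ~~ z (next b).
  move=> ltbn zb; have := nadj b; rewrite mem_iota add0n zb; exact.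
have far b : b < n -> b != j -> (j < b -> odd (b - j)) ->
    (b < j -> ~~ odd (j - b)) -> z b = false /\ z (next b) = false.
  move=> ltbn nbj o1 o2; have := pz j b ltjn ltbn zj nbj o1 o2.
  rewrite -/(next b) => e; suff: ~~ z b by rewrite -e => /negbTE.
  by apply/negP => zb; have := nadj' b ltbn zb; rewrite -e zb.
have eqF : (a == j) = false by exact/negbTE.
have [odd_a|even_a] :=
    boolP ((a < j) && ~~ odd (j - a) || (j < a) && odd (a - j)).
  by have [||||->] := far a; try lia.
have [a0|a_gt0] := posnP a.
  have [||||_] := far n.-1; rewrite /next; try lia.
  by rewrite (_ : n.-1.+1 == n) ?a0 //; lia.
have [||||_] := far a.-1; rewrite /next; try lia.
by rewrite prednK // (_ : (a == n) = false) //; lia.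
Qed.

(** * Perfect matchings as involutions *)

Section Mates.
Variable G : mgraph.
Implicit Types (X : {set vertex G}) (M : {set edge G}) (m : vertex G -> vertex G).

Lemma adj_sym : symmetric (@adj G).
Proof. by move=> x y; apply: eq_existsb => e; rewrite setUC. Qed.

Lemma adj_neq x y : @adj G x y -> x != y.
Proof.
case/existsP => e /eqP ee; have := card_ends e.
by rewrite ee cards2; case: eqP.
Qed.

Definition perfect_map m := forall x, adj x (m x) /\ m (m x) = x.

Lemma perfect_map_pairing m : perfect_map m -> pairing m.
Proof. by move=> hm x; have [/adj_neq + ->] := hm x; rewrite eq_sym. Qed.

Lemma ends_mem2 (e : edge G) x y : x != y -> x \in ends e -> y \in ends e ->
  ends e = [set x; y].
Proof.
move=> nxy xe ye; apply/esym/eqP.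
by rewrite eqEcard subUset !sub1set xe ye card_ends cards2 nxy.
Qed.

Lemma perfect_matching_uniq M e e' x : perfect_matching M ->
  e \in M -> e' \in M -> x \in ends e -> x \in ends e' -> e = e'.
Proof.
move/forallP/(_ x)/cards1P => [f hf] eM e'M xe xe'.
have -> : e = f by apply/eqP; rewrite -in_set1 -hf inE eM.
by apply/esym/eqP; rewrite -in_set1 -hf inE e'M.
Qed.

Lemma perfect_matching_mate M : perfect_matching M ->
  exists2 m, perfect_map m & forall x, exists2 e, e \in M & ends e = [set x; m x].
Proof.
move=> hM.
have mate x : exists y, [exists e in M, ends e == [set x; y]] && (x != y).
  have /cards1P[e he] := forallP hM x.
  have /setIdP[eM xe] : e \in [set e in M | x \in ends e] by rewrite he set11.
  have /cards2P[y [z [nyz ee]]] := introT eqP (card_ends e).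
  move: xe; rewrite ee !inE => /orP[/eqP->|/eqP->].
    by exists z; rewrite nyz andbT; apply/existsP; exists e; rewrite eM ee eqxx.
  exists y; rewrite eq_sym nyz andbT; apply/existsP; exists e.
  by rewrite eM ee setUC eqxx.
have [m hm] := fin_all_exists mate.
have hM2 x : exists2 e, e \in M & ends e = [set x; m x].
  by have /andP[/existsP[e /andP[eM /eqP ee]] _] := hm x; exists e.
exists m => // x; have [e eM ee] := hM2 x.
split; first by apply/existsP; exists e; rewrite ee.
have [e' e'M ee'] := hM2 (m x).
have eqe : e' = e.
  by apply: (@perfect_matching_uniq M e' e (m x)); rewrite // ?ee ?ee' !inE eqxx ?orbT.
have /andP[_ nx] := hm x; have /andP[_ nmx] := hm (m x).
have := ee'; rewrite eqe ee => /setP/(_ (m (m x))); rewrite !inE eqxx orbT.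
by rewrite eq_sym [_ == m x]eq_sym (negbTE nmx) orbF => /eqP.
Qed.

Lemma perfect_matching_ends M m e x : perfect_matching M ->
  (forall x, exists2 e, e \in M & ends e = [set x; m x]) ->
  e \in M -> x \in ends e -> ends e = [set x; m x].
Proof.
move=> hM hm eM xe; have [e' e'M ee'] := hm x.
by rewrite (perfect_matching_uniq hM eM e'M xe) // ee' set21.
Qed.

Lemma card_cut_mate M m X : perfect_matching M ->
  (forall x, exists2 e, e \in M & ends e = [set x; m x]) ->
  #|cut X :&: M| = #|crossing m X|.
Proof.
move=> hM hm.
have edge_at x : exists e, (e \in M) && (ends e == [set x; m x]).
  by have [e eM ee] := hm x; exists e; rewrite eM ee eqxx.
have [f hf] := fin_all_exists edge_at.
have fM x : f x \in M by case/andP: (hf x).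
have fE x : ends (f x) = [set x; m x] by case/andP: (hf x) => _ /eqP.
have injf : {in crossing m X &, injective f}.
  move=> x y; rewrite !inE => /andP[xX mxX] /andP[yX myX] exy.
  have : x \in ends (f y) by rewrite -exy fE set21.
  by rewrite fE !inE => /orP[/eqP//|/eqP e]; rewrite -e xX in myX.
rewrite -(card_in_imset injf); apply: eq_card => e; rewrite !inE.
apply/idP/imsetP => [/andP[/andP[]]|[x + ->]].
  case/set0Pn => x /setIP[xe xX] /set0Pn[y /setIP[ye]]; rewrite inE => yX eM.
  have ee := perfect_matching_ends hM hm eM xe.
  exists x; last first.
    by apply: (perfect_matching_uniq hM eM (fM x) xe); rewrite fE set21.
  rewrite inE xX; move: ye; rewrite ee !inE => /orP[/eqP ye|/eqP <-//].
  by rewrite ye xX in yX.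
rewrite inE => /andP[xX mxX]; rewrite fM andbT fE.
apply/andP; split; apply/set0Pn; [exists x | exists (m x)].
  by rewrite !inE eqxx.
by rewrite !inE eqxx orbT.
Qed.

(** With parallel edges the mate function does not determine the matching; a
    fixed edge is picked from each class of parallel edges. *)
Lemma perfect_map_matching m : perfect_map m ->
  exists2 M, perfect_matching M &
    forall x, exists2 e, e \in M & ends e = [set x; m x].
Proof.
move=> hm.
pose chosen e := [pick e' : edge G | ends e' == ends e] == Some e.
pose M := [set e : edge G | chosen e && [exists x, ends e == [set x; m x]]].
have hM x : exists2 e, e \in M & ends e = [set x; m x].
  have [/existsP[e0 /eqP ee0] _] := hm x.
  case def_e : [pick e' : edge G | ends e' == ends e0] => [e|]; last first.
    by move: def_e; case: pickP => // /(_ e0); rewrite eqxx.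
  have ee : ends e = ends e0.
    by move: def_e; case: pickP => // e' /eqP ? [<-].
  exists e; last by rewrite ee.
  rewrite inE /chosen ee def_e eqxx /=; apply/existsP; exists x.
  by rewrite ee0.
exists M => //; apply/forallP => x; have [e eM ee] := hM x.
apply/cards1P; exists e; apply/setP => e'; rewrite !inE.
apply/idP/eqP => [/andP[/andP[/eqP ch' /existsP[y /eqP ee']] xe']|->].
  have exy : ends e' = ends e.
    rewrite ee' ee; move: xe'; rewrite ee' !inE => /orP[]/eqP -> //.
    by rewrite (hm y).2 setUC.
  move: eM; rewrite inE => /andP[/eqP + _]; rewrite -exy ch'.
  by case.
by move: eM; rewrite inE => ->; rewrite ee set21.
Qed.

Lemma tightP X :
  reflect (shore X /\ forall m, perfect_map m -> #|crossing m X| = 1) (tight X).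
Proof.
apply: (iffP andP) => [[sX /forallP tX]|[sX tX]]; split => //.
  move=> m hm; have [M hM hMm] := perfect_map_matching hm.
  have := tX M; rewrite hM (card_cut_mate X hM hMm).
  by move/eqP.
apply/forallP => M; apply/implyP => hM.
have [m hm hMm] := perfect_matching_mate hM.
by rewrite (card_cut_mate X hM hMm) tX.
Qed.

End Mates.

(** The tight cut is found by a parity count: if [C] is attached to the rest of
    the graph only through [u] and [y], then [C] together with [u] is tight when
    [C] is even, and both [C] and [C] together with [u] and [y] are tight when
    [C] is odd. *)
Lemma brick_no_two_separation (H : mgraph) (C : {set vertex H}) u y :
  brick H -> u != y -> u \notin C -> y \notin C -> C != set0 ->
  (forall e : edge H, ends e :&: C != set0 -> ends e \subset u |: (y |: C)) ->
  0 < #|~: (u |: (y |: C))| -> 2 <= #|C| \/ 2 <= #|~: (u |: (y |: C))| ->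
  False.
Proof.
case/and3P => _ /and3P[_ /card_gt0P[e0 _] cov] /forallP brickH nuy uC yC C0.
move=> sep D0 big.
have Cpos : 0 < #|C| by rewrite card_gt0.
have /existsP[M0 /andP[/perfect_matching_mate[m0 hm0 _] _]] := forallP cov e0.
have mC m x : perfect_map m -> x \in C -> m x != u -> m x != y -> m x \in C.
  move=> hm xC n1 n2; have [/existsP[e /eqP ee] _] := hm x.
  have /sep/subsetP/(_ (m x)) : ends e :&: C != set0.
    by apply/set0Pn; exists x; rewrite ee !inE eqxx xC.
  by rewrite ee !inE eqxx orbT (negbTE n1) (negbTE n2) => /(_ isT).
have cardC m : perfect_map m -> #|crossing m C| = (m u \in C) + (m y \in C).
  move=> hm; have pm := perfect_map_pairing hm.
  rewrite -crossingC // /crossing.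
  transitivity #|[set x in [set u; y] | m x \in C]|.
    apply: eq_card => x; rewrite !inE negbK; case xC : (m x \in C); rewrite ?andbF //.
    rewrite !andbT; apply/idP/orP => [xnC|[]/eqP-> //].
    apply/orP; apply: contraT; rewrite negb_or => /andP[n1 n2].
    by have := mC m (m x) hm xC; rewrite (hm x).2 (negbTE xnC) => /(_ n1 n2).
  rewrite -sum1dep_card big_mkcondr big_setU1 ?inE //= big_set1.
  by case: (m u \in C); case: (m y \in C).
have evenH : ~~ odd #|vertex H|.
  by rewrite -cardsT; apply: (closed_even (perfect_map_pairing hm0)).
have cardU : #|u |: (y |: C)| = #|C|.+2.
  by rewrite !cardsU1 yC !inE negb_or nuy uC.
have cardD : #|C| + 2 + #|~: (u |: (y |: C))| = #|vertex H|.
  by rewrite -(cardsC (u |: (y |: C))) cardU addn2.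
(* An odd [C] serves as the tight set unless it is a single vertex. *)
have oneC : odd #|C| -> 2 <= #|C| -> False.
  move=> oC bigC; have /(implyP (brickH _)) : tight C.
    apply/tightP; split.
      by rewrite /shore C0 -card_gt0; apply/card_gt0P; exists u; rewrite inE.
    move=> m hm; have := odd_crossing C (perfect_map_pairing hm).
    by rewrite cardC // oC; case: (m u \in C); case: (m y \in C).
  by move: (cardsC C); rewrite /trivial_cut => eqC /orP[] /eqP; lia.
have [oC|eC] := boolP (odd #|C|).
  have /(implyP (brickH _)) : tight (u |: (y |: C)).
    apply/tightP; split.
      by rewrite /shore -!card_gt0 D0 cardU.
    move=> m hm; have pm := perfect_map_pairing hm.
    have : odd ((m u \in C) + (m y \in C)) by rewrite -cardC // odd_crossing.
    have muy : m u \in C -> m y \notin C -> m y \notin u |: (y |: C).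
      move=> muC myC; rewrite !inE (negbTE myC) (negbTE (pm y).1) !orbF.
      by apply: contraNN uC => /eqP e; move: muC; rewrite -e (pm y).2 (negbTE yC).
    have myu : m y \in C -> m u \notin C -> m u \notin u |: (y |: C).
      move=> myC muC; rewrite !inE (negbTE muC) (negbTE (pm u).1) !orbF.
      by apply: contraNN yC => /eqP e; move: myC; rewrite -e (pm u).2 (negbTE uC).
    have inX x : x \in C -> m x \in u |: (y |: C).
      move=> xC; rewrite !inE; case: eqP => //= n1; case: eqP => //= n2.
      by apply: mC => //; apply/eqP.
    case muC : (m u \in C); case myC : (m y \in C) => // _; apply/eqP/cards1P.
      exists y; apply/setP => x; rewrite !inE.
      apply/idP/eqP => [/andP[/or3P[/eqP->|/eqP->//|/inX]]|->].
      - by rewrite muC !orbT.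
      - by rewrite !inE => ->.
      by have := muy muC (negbT myC); rewrite !inE eqxx orbT.
    exists u; apply/setP => x; rewrite !inE.
    apply/idP/eqP => [/andP[/or3P[/eqP->//|/eqP->|/inX]]|->].
    - by rewrite myC !orbT.
    - by rewrite !inE => ->.
    by have := myu myC (negbT muC); rewrite !inE eqxx.
  rewrite /trivial_cut cardU => /orP[|/eqP D1]; first by [].
  by apply: oneC => //; case: big; lia.
have /(implyP (brickH _)) : tight (u |: C).
  apply/tightP; split.
    rewrite /shore -!card_gt0 cardsU1 uC /=; apply/card_gt0P; exists y.
    by rewrite !inE negb_or eq_sym nuy yC.
  move=> m hm; have pm := perfect_map_pairing hm.
  have : ~~ odd ((m u \in C) + (m y \in C)) by rewrite -cardC // odd_crossing.
  case muC : (m u \in C); case myC : (m y \in C) => // _; apply/eqP/cards1P.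
    exists (m y); apply/setP => x; rewrite !inE.
    apply/idP/eqP => [/andP[/orP[/eqP->|xC]]|->]; first by rewrite muC orbT.
      rewrite negb_or => /andP[n1 n2]; apply/esym; rewrite -[RHS](pm x).2; congr m.
      by apply/eqP; rewrite eq_sym; apply: contraT => n3; rewrite mC in n2.
    by rewrite myC orbT (pm y).2 negb_or eq_sym nuy yC.
  exists u; apply/setP => x; rewrite !inE.
  apply/idP/eqP => [/andP[/orP[/eqP->//|xC]]|->].
    rewrite negb_or => /andP[n1 n2]; have [e|n3] := eqVneq (m x) y.
      by move: myC; rewrite -e (pm x).2 xC.
    by rewrite mC in n2.
  by rewrite eqxx muC orbF (pm u).1.
have cardUC : #|u |: C| = #|C|.+1 by rewrite cardsU1 uC.
have := cardsC (u |: C); rewrite /trivial_cut cardUC.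
move: evenH; rewrite -cardD => ev eqC.
by case/orP => /eqP; lia.
Qed.

(** * Contraction, deletion, splicing and simple graphs *)

Section ContractDelete.
Variable G : mgraph.
Implicit Types (X : {set vertex G}) (M : {set edge G}).

Lemma cutC X : cut (~: X) = cut X.
Proof. by apply/setP => e; rewrite !inE setCK andbC. Qed.

Lemma mem_contract_ends X (e : edge (contract X)) (y : vertex (contract X)) :
  (y \in ends e) = if y is Some y' then val y' \in ends (val e)
                   else val e \in cut X.
Proof.
case: e => e he; rewrite /= /contract_ends /=.
apply/imsetP/idP => [[x xe ->]|].
  rewrite /contract_vertex; case: insubP => [u hu -> //|].
  rewrite negbK => xX; rewrite inE; apply/andP; split; apply/set0Pn.
    by exists x; rewrite inE xe.
  by move/subsetPn: he => [z ze zX]; exists z; rewrite !inE ze.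
case: y => [y ye|].
  by exists (val y) => //; rewrite /contract_vertex valK.
rewrite inE => /andP[/set0Pn[x /setIP[xe xX]] _]; exists x => //.
by rewrite /contract_vertex; case: insubP => // u; rewrite xX.
Qed.

Lemma contract_perfect_matching X M : perfect_matching M ->
  #|cut X :&: M| = 1 ->
  perfect_matching [set e : edge (contract X) | val e \in M].
Proof.
move=> /forallP hM hX; apply/forallP => y; apply/eqP.
rewrite -(card_imset _ val_inj).
case: y => [y|].
  rewrite -(eqP (hM (val y))); apply: eq_card => e; rewrite inE.
  apply/imsetP/andP => [[e']|[eM ye]].
    by rewrite !inE mem_contract_ends => /andP[eM ye] ->.
  have he : ~~ (ends e \subset X).
    by apply/subsetPn; exists (val y) => //; exact: (valP y).
  by exists (Sub e he); rewrite // !inE mem_contract_ends /= eM.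
rewrite -hX; apply: eq_card => e; rewrite [RHS]inE.
apply/imsetP/andP => [[e']|[eX eM]].
  by rewrite !inE mem_contract_ends inE => /andP[eM eX] ->.
have he : ~~ (ends e \subset X).
  move: eX; rewrite inE => /andP[_ /set0Pn[y /setIP[ye yX]]].
  by apply/subsetPn; exists y => //; rewrite inE in yX.
by exists (Sub e he); rewrite // inE [X in _ && X]mem_contract_ends inE /= eM.
Qed.

Lemma contract_connected X : shore X -> connected G -> connected (contract X).
Proof.
case/andP => /set0Pn[x0 x0X] _ /forallP cG.
have step x y : @adj G x y ->
    connect (@adj (contract X)) (contract_vertex X x) (contract_vertex X y).
  case/existsP => e /eqP ee.
  have [sub|nsub] := boolP (ends e \subset X).
    have out z : z \in X -> contract_vertex X z = None.
      by rewrite /contract_vertex; case: insubP => // u /negbTE ->.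
    rewrite !out ?connect0 //; apply: (subsetP sub); rewrite ee !inE eqxx ?orbT //.
  apply: connect1; apply/existsP; exists (Sub e nsub).
  by rewrite /= /contract_ends /= ee imsetU1 imset_set1.
have walk x y : connect (@adj G) x y ->
    connect (@adj (contract X)) (contract_vertex X x) (contract_vertex X y).
  case/connectP => p + ->; elim: p x => [|z p IH] x /=; first by rewrite connect0.
  by case/andP => /step xz /IH; exact: connect_trans.
have lift z : exists x, contract_vertex X x = z.
  case: z => [z|]; first by exists (val z); rewrite /contract_vertex valK.
  by exists x0; rewrite /contract_vertex; case: insubP => // u; rewrite x0X.
apply/forallP => y; apply/forallP => z.
have [x <-] := lift y; have [x' <-] := lift z.
exact: walk (forallP (cG x) x').
Qed.

(** A perfect matching that crosses a cut once induces perfect matchings of both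
    contractions. *)
Lemma separating_of_thin X : shore X -> connected G ->
  (forall e : edge G, exists2 M, perfect_matching M & e \in M /\ #|cut X :&: M| = 1) ->
  separating X.
Proof.
move=> sX cG thin.
have sXC : shore (~: X) by rewrite /shore setCK andbC.
have mc Y : shore Y -> cut Y = cut X -> matching_covered (contract Y).
  move=> sY cutE; apply/and3P; split; first exact: contract_connected.
    case/andP: (sY) => /set0Pn[x xY] /set0Pn[y]; rewrite inE => yY.
    have [e0 e0X] : exists e, e \in cut Y.
      have /connectP[p + def_y] := forallP (forallP cG x) y.
      elim: p x xY def_y => [|z p IH] x xY /= def_y; first by rewrite def_y xY in yY.
      case/andP => /existsP[e /eqP ee] pz; have [zY|zY] := boolP (z \in Y).
        exact: (IH z).
      exists e; rewrite inE; apply/andP; split; apply/set0Pn.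
        by exists x; rewrite inE ee set21.
      by exists z; rewrite !inE ee zY !inE eqxx orbT.
    have he : ~~ (ends e0 \subset Y).
      move: e0X; rewrite inE => /andP[_ /set0Pn[z /setIP[ze zY]]].
      by apply/subsetPn; exists z => //; rewrite inE in zY.
    by apply/card_gt0P; exists (Sub e0 he).
  apply/forallP => e; have [M hM [eM XM]] := thin (val e).
  apply/existsP; exists [set e' : edge (contract Y) | val e' \in M].
  by rewrite contract_perfect_matching ?cutE // inE.
by apply/and3P; split => //; apply: mc; rewrite ?cutC.
Qed.

Lemma removable_avoid (e f : edge G) : removable e -> f != e ->
  exists2 M, perfect_matching M & (f \in M) && (e \notin M).
Proof.
case/and3P => _ _ /forallP cov nfe.
have /existsP[M /andP[/forallP hM fM]] := cov (Sub f nfe).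
exists [set val g | g in M]; last first.
  apply/andP; split; first by apply/imsetP; exists (Sub f nfe).
  by apply/imsetP => -[[g ng] _ /= eg]; rewrite eg eqxx in ng.
apply/forallP => x; rewrite -(eqP (hM x)) -(card_imset _ val_inj); apply/eqP.
apply: eq_card => g; rewrite inE; apply/andP/imsetP => [[/imsetP[g' g'M ->] xg]|].
  by exists g' => //; rewrite inE g'M.
by case=> g'; rewrite inE => /andP[g'M xg] ->; split=> //; apply: imset_f.
Qed.

End ContractDelete.

Section Splice.
Variables G H K : mgraph.

(** What such a splicing looks like from inside [G]: the [K_4] leaves the
    triangle on [a], [b] and [c], and [psi] identifies [H] minus its splicing
    vertex [u] with the rest of [G]. *)
Lemma splicing_triangle : iso (underlying_simple K) (complete_graph 4) ->
  is_splicing G H K ->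
  exists a b c (u : vertex H) (psi : vertex H -> vertex G),
    [/\ @adj G a b, @adj G a c, @adj G b c,
        [/\ {in [pred x | x != u] &, injective psi},
            forall x, x != u -> psi x \notin [:: a; b; c] &
            forall z, z \notin [:: a; b; c] -> exists2 x, x != u & psi x = z] &
        forall e : edge H, u \notin ends e ->
          exists e' : edge G, ends e' = psi @: ends e].
Proof.
case=> fK [gK [bfK bgK endsK]] [u [v [theta [_ [f [g [bf bg endsG]]]]]]].
have [f' fK' f'K] := bf; have [g' gK' g'K] := bg; have [h hK Kh] := bfK.
have adjK x y : x != y -> @adj K x y.
  move=> nxy; have nf : fK x != fK y by rewrite (can_eq hK).
  have he : simple_edge (fun x y : 'I_4 => x != y) [set fK x; fK y].
    by apply/existsP; exists (fK x); apply/existsP; exists (fK y); rewrite nf eqxx.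
  have [gi gKi giK] := bgK.
  pose e := gi (Sub [set fK x; fK y] he).
  have ee : ends e = [set x; y].
    have inj : injective fK by exact: can_inj hK.
    apply: (imset_inj inj); rewrite -endsK giK /=.
    by rewrite imsetU1 imset_set1.
  have eE : val e = [set x; y] := ee.
  have := valP e; rewrite eE => /existsP[p /existsP[q]].
  case/and3P => npq /existsP[e' /eqP ee'] /eqP epq.
  by apply/existsP; exists e'; rewrite ee' epq.
have cardK : #|vertex K| = 4.
  by rewrite -(card_ord 4); apply: bij_eq_card bfK.
have [x [y [z [uxyz def_v]]]] : exists x y z, uniq [:: x; y; z] /\
    forall w, (w != v) = (w \in [:: x; y; z]).
  have def_v w : (w != v) = (w \in enum (~: [set v])) by rewrite mem_enum !inE.
  have := cardsC [set v]; rewrite cards1 cardK add1n => -[]; rewrite cardE.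
  have := enum_uniq (~: [set v]).
  case: (enum _) def_v => [|x [|y [|z []]]] //= def_v uxyz _.
  by exists x, y, z.
have [nxy nxz nyz] : [/\ x != y, x != z & y != z].
  by move: uxyz; rewrite /= !inE negb_or => /and3P[/andP[]].
have xv : x != v by rewrite def_v !inE eqxx.
have yv : y != v by rewrite def_v !inE eqxx orbT.
have zv : z != v by rewrite def_v !inE eqxx !orbT.
pose a := f' (inr (Sub x xv)); pose b := f' (inr (Sub y yv)).
pose c := f' (inr (Sub z zv)).
have adjG p q (pv : p != v) (qv : q != v) : p != q ->
    @adj G (f' (inr (Sub p pv))) (f' (inr (Sub q qv))).
  move=> npq; have /existsP[e /eqP ee] := adjK p q npq.
  have ve : v \notin ends e by rewrite ee !inE negb_or ![v == _]eq_sym pv.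
  apply/existsP; exists (g' (inl (inr (Sub e ve)))).
  have inj : injective f by exact: can_inj fK'.
  apply/eqP/(imset_inj inj); rewrite -endsG g'K /= imsetU1 imset_set1 !f'K.
  by apply/setP => -[s|s]; rewrite !inE // ee !inE.
pose psi w := if insub w is Some w' then f' (inl w') else a.
have psiE w (wu : w != u) : psi w = f' (inl (Sub w wu)).
  rewrite /psi; case: insubP => [w' hw' ew|]; last by rewrite wu.
  by congr (f' (inl _)); apply: val_inj.
exists a, b, c, u, psi; split; [exact: adjG | exact: adjG | exact: adjG | |].
  split.
  - move=> w w'; rewrite !inE => wu w'u; rewrite !psiE.
    by move/(can_inj f'K) => -[].
  - move=> w wu; rewrite psiE !inE !(can_eq f'K).
    by [].
  move=> w nw; case def_w : (f w) => [s|s].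
    exists (val s); first exact: (valP s).
    by rewrite (psiE _ (valP s)) -[w]fK' def_w; congr (f' (inl _)); apply: val_inj.
  have : val s \in [:: x; y; z] by rewrite -def_v; exact: (valP s).
  have : w = f' (inr s) by rewrite -def_w fK'.
  move: nw; rewrite !inE; move=> + ew; rewrite ew !(can_eq f'K).
  rewrite !negb_or.
  by case/and3P => n1 n2 n3 /or3P[] /eqP e; [move/eqP: n1 | move/eqP: n2 | move/eqP: n3];
    case; congr inr; apply: val_inj.
move=> e ue; exists (g' (inl (inl (Sub e ue)))).
have inj : injective f by exact: can_inj fK'.
apply: (imset_inj inj); rewrite -endsG g'K /= -imset_comp.
apply/setP => -[s|s]; rewrite inE.
  apply/idP/imsetP => [se|[w we]].
    exists (val s) => //=; rewrite (psiE _ (valP s)) f'K.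
    by congr inl; apply: val_inj.
  have wu : w != u by apply: contraNneq ue => <-.
  by rewrite /= psiE f'K => -[->].
apply/esym/negP => /imsetP[w we]; have wu : w != u by apply: contraNneq ue => <-.
by rewrite /= psiE f'K.
Qed.

End Splice.

Section SimpleGraph.
Variables (T : finType) (r : rel T).
Notation G := (simple_graph r).

Lemma simple_adj x y : @adj G x y = (x != y) && (r x y || r y x).
Proof.
apply/existsP/andP => [[[A hA] /= /eqP def_A]|[nxy rxy]].
  have /existsP[p /existsP[q /and3P[npq rpq /eqP eA]]] := hA.
  have e : [set x; y] = [set p; q] by rewrite -def_A -eA.
  have : x \in [set p; q] by rewrite -e set21.
  have : y \in [set p; q] by rewrite -e set22.
  have : #|[set x; y]| = 2 by rewrite e cards2 npq.
  rewrite cards2 !inE; case nxy : (x != y) => // _.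
  case/orP => /eqP ey; case/orP => /eqP ex; move: nxy; rewrite ex ey ?eqxx //.
    by rewrite rpq orbT.
  by rewrite rpq.
have he : simple_edge r [set x; y].
  case/orP: rxy => rxy; apply/existsP; [exists x | exists y];
    apply/existsP; [exists y | exists x]; rewrite ?nxy ?rxy ?eqxx //.
  by rewrite eq_sym nxy setUC eqxx.
by exists (Sub [set x; y] he).
Qed.

Lemma simple_ends_inj : injective (@ends G).
Proof. exact: val_inj. Qed.

End SimpleGraph.

(** * The graph in coordinates *)

(* Splitting long concatenations at once keeps [mem_cat] from unfolding the
   pieces, some of which are concatenations themselves. *)
Lemma mem_cat5 (T : eqType) (x : T) s1 s2 s3 s4 s5 :
  (x \in s1 ++ s2 ++ s3 ++ s4 ++ s5) =
  [|| x \in s1, x \in s2, x \in s3 | (x \in s4) || (x \in s5)].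
Proof. by rewrite !mem_cat. Qed.

Lemma mem_cat10 (T : eqType) (x : T) s1 s2 s3 s4 s5 s6 s7 s8 s9 s10 :
  (x \in s1 ++ s2 ++ s3 ++ s4 ++ s5 ++ s6 ++ s7 ++ s8 ++ s9 ++ s10) =
  [|| (x \in s1) || (x \in s2), (x \in s3) || (x \in s4),
      (x \in s5) || (x \in s6), (x \in s7) || (x \in s8) |
      (x \in s9) || (x \in s10)].
Proof. by rewrite !mem_cat -!orbA. Qed.

Lemma iota_rcons a n : iota a n.+1 = rcons (iota a n) (a + n).
Proof. by rewrite -{1}[n.+1]addn1 iotaD -cats1. Qed.

Lemma path_edges_cons (x y : name) s :
  path_edges (x :: y :: s) = (x, y) :: path_edges (y :: s).
Proof. by []. Qed.

Lemma path_edges_map (g : nat -> name) a n :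
  path_edges [seq g j | j <- iota a n.+1] = [seq (g j, g j.+1) | j <- iota a n].
Proof. by elim: n a => //= n IH a; rewrite path_edges_cons IH. Qed.

Lemma cut_wheel_verticesE w h n x : injective w -> (forall j, h != w j) -> 0 < n ->
  (x \in cut_wheel_vertices w h n) = (x == h) || (x \in [seq w j | j <- iota 1 n.-1]).
Proof.
move=> w_inj hw n_gt0.
rewrite mem_filter inE andb_orr; congr (_ || _).
  by have [->|] := eqVneq x h; rewrite ?hw ?andbF.
apply/andP/mapP => [[nx /mapP[j hj def_x]]|[j hj ->]].
  move: hj nx; rewrite def_x (inj_eq w_inj) mem_iota => hj nj.
  by exists j; rewrite // mem_iota; lia.
rewrite (inj_eq w_inj); move: hj; rewrite mem_iota => hj.
by split; [lia | apply: map_f; rewrite mem_iota; lia].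
Qed.

Lemma cut_wheel_edgesE w h n p : injective w -> (forall j, h != w j) -> 1 < n ->
  (p \in cut_wheel_edges w h n) =
  (p \in [seq (w j, w j.+1) | j <- iota 1 n.-2]) ||
  (p \in [seq (h, w j) | j <- iota 1 n.-1]).
Proof.
move=> w_inj hw n_gt1; rewrite mem_filter mem_cat andb_orr; congr (_ || _).
  pose g j := if j == n.+1 then w 1 else w j.
  have -> : rcons [seq w j | j <- iota 1 n] (w 1) = [seq g j | j <- iota 1 n.+1].
    have -> : iota 1 n.+1 = rcons (iota 1 n) n.+1.
      by rewrite -{1}[n.+1]addn1 iotaD -cats1 add1n.
    rewrite map_rcons /g eqxx; congr rcons.
    by apply/eq_in_map => j; rewrite mem_iota /= => hj; case: eqP => //; lia.
  rewrite path_edges_map; apply/andP/mapP => [[+ /mapP[j + def_p]]|[j + ->]].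
    rewrite def_p mem_iota /= /g => + hj.
    have [?|jn] := eqVneq j n.+1; first by lia.
    have [[jn1]|jn1] := eqVneq j.+1 n.+1; first by rewrite jn1 eqxx.
    have [jn2|jn2] := eqVneq j.+1 n; first by rewrite jn2 eqxx andbF.
    by exists j => //; rewrite mem_iota; lia.
  rewrite mem_iota => hj; rewrite !(inj_eq w_inj); split; first by lia.
  apply/mapP; exists j; first by rewrite mem_iota; lia.
  by rewrite /g; do 2 (case: eqP => [?|_]; first by lia).
apply/andP/mapP => [[+ /mapP[j + def_p]]|[j + ->]].
  rewrite def_p /= hw (inj_eq w_inj) mem_iota => nj hj.
  by exists j; rewrite // mem_iota; lia.
rewrite mem_iota /= hw (inj_eq w_inj) => hj; split; first by lia.
by apply: map_f; rewrite mem_iota; lia.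
Qed.

(** Coordinates in which all hubs w_3^t, including h_k and h'_l, have the same
    form; [V1] to [V4], [Mid], [RimL] and [RimR] stand for v_1 to v_4, w_2, w'
    and w. *)
Inductive vtx :=
  | Hub of nat | V1 of nat | V2 of nat | V3 of nat | V4 of nat | Mid of nat
  | RimL of nat | RimR of nat.

Definition vtx_eqb (x y : vtx) : bool :=
  match x, y with
  | Hub s, Hub t | V1 s, V1 t | V2 s, V2 t | V3 s, V3 t | V4 s, V4 t
  | Mid s, Mid t | RimL s, RimL t | RimR s, RimR t => s == t
  | _, _ => false
  end.

Lemma vtx_eqP : Equality.axiom vtx_eqb.
Proof.
by case=> s [] t /=; try (by constructor); apply: (iffP eqP) => [->|[]].
Qed.

HB.instance Definition _ := hasDecEq.Build vtx vtx_eqP.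

Lemma vtx_eqE (x y : vtx) : (x == y) = vtx_eqb x y. Proof. by []. Qed.

Ltac split_ifs :=
  repeat first
    [ match goal with |- context [if ?b then _ else _] =>
        lazymatch b with context [if _ then _ else _] => fail | _ =>
          let e := fresh "e" in case e : b end end
    | progress simpl ].

Section Family.
Variables l k i : nat.
Hypotheses (hl : 5 <= l) (hk : 5 <= k) (odd_l : odd l) (odd_k : odd k).
Notation G := (G_ l k i).

Definition valid (x : vtx) : bool :=
  match x with
  | Hub t => t <= i.+1
  | V1 t | V2 t | V3 t | V4 t => t <= i
  | Mid t => 0 < t <= i
  | RimL j => 0 < j < l
  | RimR j => 0 < j < k
  end.

(** One orientation of each edge. *)
Definition varc (x y : vtx) : bool :=
  match x, y with
  | Hub s, Hub t => t == s.+1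
  | Hub s, (V1 t | V2 t | V3 t | V4 t) => (s == t) || (s == t.+1)
  | Hub s, Mid t => s == t
  | Hub s, RimL _ => s == i.+1
  | Hub s, RimR _ => s == 0
  | V1 s, V2 t => s == t
  | V3 s, V4 t => s == t
  | V1 s, V1 t => t == s.+1
  | V4 s, Mid t => (t == s) || (t == s.+1)
  | RimL a, RimL b => b == a.+1
  | RimR a, RimR b => b == a.+1
  | RimL a, V1 t => (a == 1) && (t == i)
  | RimL a, V4 t => (a.+1 == l) && (t == i)
  | RimR a, V1 t => (a == 1) && (t == 0)
  | RimR a, V4 t => (a.+1 == k) && (t == 0)
  | _, _ => false
  end.

Definition vadj x y := [&& valid x, valid y & varc x y || varc y x].

Lemma vadjC x y : vadj x y = vadj y x.
Proof. by rewrite /vadj andbCA orbC. Qed.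

Definition name_of (x : vtx) : name :=
  match x with
  | Hub t => w3 i t
  | V1 t => VB t 1 | V2 t => VB t 2 | V3 t => VB t 3 | V4 t => VB t 4
  | Mid t => W2 t
  | RimL j => WL j
  | RimR j => WR j
  end.

Definition vtx_of (x : name) : vtx :=
  match x with
  | WL j => RimL j
  | WR j => RimR j
  | HL => Hub i.+1
  | HR => Hub 0
  | W3 t => Hub t
  | W2 t => Mid t
  | VB t 1 => V1 t | VB t 2 => V2 t | VB t 3 => V3 t | VB t _ => V4 t
  end.

Lemma name_ofK : cancel name_of vtx_of.
Proof.
by case=> //= t; rewrite /w3; case: eqP => [->//|_]; case: eqP => [->|].
Qed.

Lemma name_of_inj : injective name_of. Proof. exact: can_inj name_ofK. Qed.

Lemma w30 : HR = w3 i 0. Proof. by []. Qed.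
Lemma w3S : HL = w3 i i.+1. Proof. by rewrite /w3 /= eqxx. Qed.
Lemma w3_mid t : 0 < t <= i -> W3 t = w3 i t.
Proof. by rewrite /w3 => ht; do 2 (case: eqP => [?|_]; first by lia). Qed.

Lemma mem_vertices (x : name) :
  (x \in G_vertices l k i) <-> exists2 y, valid y & name_of y = x.
Proof.
have WLi : injective WL by move=> ? ? [].
have WRi : injective WR by move=> ? ? [].
rewrite /G_vertices mem_cat5 !cut_wheel_verticesE //; try lia.
split.
  case/or4P => [/orP[/eqP->|/mapP[j + ->]]|/orP[/eqP->|/mapP[j + ->]]||].
  - by exists (Hub i.+1); rewrite /= ?w3S.
  - by rewrite mem_iota => hj; exists (RimL j) => //=; lia.
  - by exists (Hub 0).
  - by rewrite mem_iota => hj; exists (RimR j) => //=; lia.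
  - case/allpairsPdep => t [j []]; rewrite !mem_iota => ht hj ->.
    case: j hj => [|[|[|[|[|j]]]]] //= _;
      [exists (V1 t) | exists (V2 t) | exists (V3 t) | exists (V4 t)] => //=; lia.
  case/orP => /mapP[t]; rewrite mem_iota => ht ->.
    by exists (Mid t) => //=; lia.
  by exists (Hub t); rewrite /= ?(w3_mid _) //; lia.
case=> y + <-; case: y => [t|t|t|t|t|t|j|j]; rewrite [valid _]/= [name_of _]/= => hy.
- have [->|t0] := eqVneq t 0; first by rewrite -w30 eqxx !orbT.
  have [->|ti] := eqVneq t i.+1; first by rewrite -w3S eqxx.
  rewrite -w3_mid; last by lia.
  by apply/or4P/Or44/orP; right; rewrite map_f // mem_iota; lia.
- by apply/or4P/Or43/allpairsPdep; exists t, 1; rewrite !mem_iota /=; split=> //; lia.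
- by apply/or4P/Or43/allpairsPdep; exists t, 2; rewrite !mem_iota /=; split=> //; lia.
- by apply/or4P/Or43/allpairsPdep; exists t, 3; rewrite !mem_iota /=; split=> //; lia.
- by apply/or4P/Or43/allpairsPdep; exists t, 4; rewrite !mem_iota /=; split=> //; lia.
- by apply/or4P/Or44/orP; left; rewrite map_f // mem_iota; lia.
- by apply/or4P/Or41/orP; right; rewrite map_f // mem_iota; lia.
- by apply/or4P/Or42/orP; right; rewrite map_f // mem_iota; lia.
Qed.

Lemma left_path_edges p :
  (p \in path_edges (WL 1 :: [seq VB t 1 | t <- rev (iota 0 i.+1)] ++ [:: WR 1])) =
  [|| p == (WL 1, VB i 1), p == (VB 0 1, WR 1) |
      p \in [seq (VB t.+1 1, VB t 1) | t <- iota 0 i]].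
Proof.
rewrite iota_rcons rev_rcons add0n map_cons cat_cons path_edges_cons inE.
congr (_ || _); elim: (i) => [|n IH]; first by rewrite /path_edges /= !inE ?orbF.
rewrite iota_rcons rev_rcons add0n map_cons cat_cons path_edges_cons inE IH.
by rewrite map_rcons mem_rcons inE orbCA.
Qed.

Lemma right_path_edges p :
  (p \in path_edges (WL l.-1 :: VB i 4 ::
     flatten [seq [:: W2 t; VB t.-1 4] | t <- rev (iota 1 i)] ++ [:: WR k.-1])) =
  [|| p == (WL l.-1, VB i 4), p == (VB 0 4, WR k.-1),
      p \in [seq (VB t 4, W2 t) | t <- iota 1 i] |
      p \in [seq (W2 t, VB t.-1 4) | t <- iota 1 i]].
Proof.
rewrite path_edges_cons inE; congr (_ || _).
elim: (i) => [|n IH]; first by rewrite /path_edges /= !inE !orbF.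
rewrite iota_rcons rev_rcons add1n map_cons [flatten _]/= !cat_cons.
rewrite !path_edges_cons !inE IH !map_rcons !mem_rcons !inE.
by do 3 case: (p == _); rewrite /= ?orbT.
Qed.

Lemma mem_G_edges p : (p \in G_edges l k i) =
  [|| (p \in [seq (WL j, WL j.+1) | j <- iota 1 l.-2])
        || (p \in [seq (HL, WL j) | j <- iota 1 l.-1])
        || ((p \in [seq (WR j, WR j.+1) | j <- iota 1 k.-2])
        || (p \in [seq (HR, WR j) | j <- iota 1 k.-1])),
      (p \in [seq (VB t 1, VB t 2) | t <- iota 0 i.+1])
        || (p \in [seq (VB t 3, VB t 4) | t <- iota 0 i.+1]),
      (p \in [seq (w3 i t, VB t j) | t <- iota 0 i.+1, j <- iota 1 4])
        || (p \in [seq (w3 i t.+1, VB t j) | t <- iota 0 i.+1, j <- iota 1 4]),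
      (p \in [seq (w3 i t, w3 i t.+1) | t <- iota 0 i.+1])
        || (p \in [seq (W2 t, w3 i t) | t <- iota 1 i]) |
      [|| p == (WL 1, VB i 1), p == (VB 0 1, WR 1) |
        p \in [seq (VB t.+1 1, VB t 1) | t <- iota 0 i]]
      || [|| p == (WL l.-1, VB i 4), p == (VB 0 4, WR k.-1),
        p \in [seq (VB t 4, W2 t) | t <- iota 1 i] |
        p \in [seq (W2 t, VB t.-1 4) | t <- iota 1 i]]].
Proof.
rewrite mem_cat10 left_path_edges right_path_edges.
rewrite (@cut_wheel_edgesE WL) ?(@cut_wheel_edgesE WR) //.
- by move=> ? ? [].
- by move: hk; lia.
- by move=> ? ? [].
- by move: hl; lia.
Qed.

Lemma edge_coordinates p : p \in G_edges l k i ->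
  exists x y, vadj x y /\ p = (name_of x, name_of y).
Proof.
rewrite mem_G_edges.
case/or4P => [/orP[/orP[]|/orP[]]|/orP[]|/orP[]|/orP[/orP[]|/orP[/or3P[]|/or4P[]]]].
- case/mapP => j; rewrite mem_iota => hj ->; exists (RimL j), (RimL j.+1).
  by rewrite /vadj /=; split=> //; lia.
- case/mapP => j; rewrite mem_iota => hj ->; exists (Hub i.+1), (RimL j).
  by rewrite /= -w3S /vadj /=; split=> //; lia.
- case/mapP => j; rewrite mem_iota => hj ->; exists (RimR j), (RimR j.+1).
  by rewrite /vadj /=; split=> //; lia.
- case/mapP => j; rewrite mem_iota => hj ->; exists (Hub 0), (RimR j).
  by rewrite /vadj /=; split=> //; lia.
- case/mapP => t; rewrite mem_iota => ht ->; exists (V1 t), (V2 t).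
  by rewrite /vadj /=; split=> //; lia.
- case/mapP => t; rewrite mem_iota => ht ->; exists (V3 t), (V4 t).
  by rewrite /vadj /=; split=> //; lia.
- case/allpairsPdep => t [j []]; rewrite !mem_iota => ht hj ->.
  case: j hj => [|[|[|[|[|j]]]]] //= _;
    [exists (Hub t), (V1 t) | exists (Hub t), (V2 t) |
     exists (Hub t), (V3 t) | exists (Hub t), (V4 t)];
    by rewrite /vadj /=; split=> //; lia.
- case/allpairsPdep => t [j []]; rewrite !mem_iota => ht hj ->.
  case: j hj => [|[|[|[|[|j]]]]] //= _;
    [exists (Hub t.+1), (V1 t) | exists (Hub t.+1), (V2 t) |
     exists (Hub t.+1), (V3 t) | exists (Hub t.+1), (V4 t)];
    by rewrite /vadj /=; split=> //; lia.
- case/mapP => t; rewrite mem_iota => ht ->; exists (Hub t), (Hub t.+1).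
  by rewrite /vadj /=; split=> //; lia.
- case/mapP => t; rewrite mem_iota => ht ->; exists (Mid t), (Hub t).
  by rewrite /vadj /=; split=> //; lia.
- move/eqP->; exists (RimL 1), (V1 i); by rewrite /vadj /=; split=> //; lia.
- move/eqP->; exists (V1 0), (RimR 1); by rewrite /vadj /=; split=> //; lia.
- case/mapP => t; rewrite mem_iota => ht ->; exists (V1 t.+1), (V1 t).
  by rewrite /vadj /=; split=> //; lia.
- move/eqP->; exists (RimL l.-1), (V4 i); by rewrite /vadj /=; split=> //; lia.
- move/eqP->; exists (V4 0), (RimR k.-1); by rewrite /vadj /=; split=> //; lia.
- case/mapP => t; rewrite mem_iota => ht ->; exists (V4 t), (Mid t).
  by rewrite /vadj /=; split=> //; lia.
- case/mapP => t; rewrite mem_iota => ht ->; exists (Mid t), (V4 t.-1).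
  by rewrite /vadj /=; split=> //; lia.
Qed.

Lemma arc_mem_edges x y : valid x -> valid y -> varc x y ->
  ((name_of x, name_of y) \in G_edges l k i) ||
  ((name_of y, name_of x) \in G_edges l k i).
Proof.
case: x y => [s|s|s|s|s|s|a|a] [t|t|t|t|t|t|b|b] // hs ht e; rewrite /= in hs ht e.
- rewrite (eqP e); apply/orP; left; rewrite mem_G_edges; apply/or4P/Or44/orP; left; apply/orP; left.
  by apply: map_f; rewrite mem_iota; lia.
- case/orP: e => /eqP->; apply/orP; left; rewrite mem_G_edges; apply/or4P/Or43/orP.
    by left; apply/allpairsPdep; exists t, 1; rewrite !mem_iota; split=> //; lia.
  by right; apply/allpairsPdep; exists t, 1; rewrite !mem_iota; split=> //; lia.
- case/orP: e => /eqP->; apply/orP; left; rewrite mem_G_edges; apply/or4P/Or43/orP.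
    by left; apply/allpairsPdep; exists t, 2; rewrite !mem_iota; split=> //; lia.
  by right; apply/allpairsPdep; exists t, 2; rewrite !mem_iota; split=> //; lia.
- case/orP: e => /eqP->; apply/orP; left; rewrite mem_G_edges; apply/or4P/Or43/orP.
    by left; apply/allpairsPdep; exists t, 3; rewrite !mem_iota; split=> //; lia.
  by right; apply/allpairsPdep; exists t, 3; rewrite !mem_iota; split=> //; lia.
- case/orP: e => /eqP->; apply/orP; left; rewrite mem_G_edges; apply/or4P/Or43/orP.
    by left; apply/allpairsPdep; exists t, 4; rewrite !mem_iota; split=> //; lia.
  by right; apply/allpairsPdep; exists t, 4; rewrite !mem_iota; split=> //; lia.
- rewrite (eqP e); apply/orP; right; rewrite mem_G_edges; apply/or4P/Or44/orP; left; apply/orP; right.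
  by apply: map_f; rewrite mem_iota; lia.
- rewrite (eqP e) [name_of (Hub _)]/= -w3S; apply/orP; left; rewrite mem_G_edges; apply/or4P/Or41/orP; left; apply/orP; right.
  by apply: map_f; rewrite mem_iota; lia.
- rewrite (eqP e); apply/orP; left; rewrite mem_G_edges; apply/or4P/Or41/orP; right; apply/orP; right.
  by apply: map_f; rewrite mem_iota; lia.
- rewrite (eqP e); apply/orP; right; rewrite mem_G_edges; apply/or4P/Or44/orP; right; apply/orP; left; apply/or3P/Or33.
  by apply: map_f; rewrite mem_iota; lia.
- rewrite (eqP e); apply/orP; left; rewrite mem_G_edges; apply/or4P/Or42/orP; left.
  by apply: map_f; rewrite mem_iota; lia.
- rewrite (eqP e); apply/orP; left; rewrite mem_G_edges; apply/or4P/Or42/orP; right.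
  by apply: map_f; rewrite mem_iota; lia.
- case/orP: e => /eqP et; apply/orP.
    left; rewrite et mem_G_edges; apply/or4P/Or44/orP; right; apply/orP; right.
    by apply/or4P/Or43/map_f; rewrite mem_iota; lia.
  right; rewrite mem_G_edges; apply/or4P/Or44/orP; right; apply/orP; right.
  by apply/or4P/Or44/mapP; exists t; rewrite ?et // mem_iota; lia.
- case/andP: e => /eqP-> /eqP->; apply/orP; left; rewrite mem_G_edges.
  by rewrite [_ == (WL 1, VB i 1)]eqxx !orbT.
- case/andP: e => /eqP ea /eqP->; apply/orP; left; rewrite mem_G_edges -ea.
  by rewrite [_ == (WL _, VB i 4)]eqxx !orbT.
- rewrite (eqP e); apply/orP; left; rewrite mem_G_edges; apply/or4P/Or41/orP; left; apply/orP; left.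
  by apply: map_f; rewrite mem_iota; lia.
- case/andP: e => /eqP-> /eqP->; apply/orP; right; rewrite mem_G_edges.
  by rewrite [_ == (VB 0 1, WR 1)]eqxx !orbT.
- case/andP: e => /eqP ea /eqP->; apply/orP; right; rewrite mem_G_edges -ea.
  by rewrite [_ == (VB 0 4, WR _)]eqxx !orbT.
- rewrite (eqP e); apply/orP; left; rewrite mem_G_edges; apply/or4P/Or41/orP; right; apply/orP; left.
  by apply: map_f; rewrite mem_iota; lia.
Qed.

(** From here on adjacency is computed by [vadj], without the edge lists. *)
Lemma mem_edges x y :
  ((name_of x, name_of y) \in G_edges l k i) || ((name_of y, name_of x) \in G_edges l k i)
  = vadj x y.
Proof.
apply/idP/idP => [|/and3P[hx hy /orP[]]]; last 2 first.
- exact: arc_mem_edges.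
- by rewrite orbC; exact: arc_mem_edges.
by case/orP => /edge_coordinates[x' [y' [adj' [/name_of_inj-> /name_of_inj->]]]];
  rewrite // vadjC.
Qed.

(** * Explicit perfect matchings *)

Definition vmatching m := forall x, valid x ->
  vadj x (m x) /\ m (m x) = x.

(** [lev] sorts the vertices so that every edge joins equal or consecutive
    levels. *)
Definition lev (x : vtx) : nat :=
  match x with
  | Hub t | V1 t | V2 t | V3 t | V4 t | Mid t => t
  | RimL _ => i.+1
  | RimR _ => 0
  end.

(** A rim path has an even number of vertices, numbered from 1: pairing [2j-1]
    with [2j] matches it completely.  The other pairing, used where [b] holds,
    leaves an end of the path to be matched outside. *)
Definition rim_mate (b : nat -> bool) (j : nat) : nat :=
  if odd j then if b j then j.-1 else j.+1 else if b j then j.+1 else j.-1.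

(** The matching with centre [s].  Below level [s] the odd set under each level
    sends up its edge from [V4], above it the edge from [V3]; at level [s] the
    vertices [Hub s], [Hub s.+1] and [V1 s] to [V4 s] remain to be matched among
    themselves. *)
Definition base (s : nat) (bL bR : nat -> bool) (x : vtx) : vtx :=
  match x with
  | Hub t => if t < s then V3 t else if t == s then Hub s.+1
             else if t == s.+1 then Hub s else V3 t.-1
  | V1 t => V2 t
  | V2 t => V1 t
  | V3 t => if t < s then Hub t else if t == s then V4 t else Hub t.+1
  | V4 t => if t < s then Mid t.+1 else if t == s then V3 t else Mid t
  | Mid t => if t <= s then V4 t.-1 else V4 t
  | RimL j => RimL (rim_mate bL j)
  | RimR j => RimR (rim_mate bR j)
  end.

(** Rematching along [es]: this gives a perfect matching when [covered es] is
    closed under the old one. *)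
Fixpoint override (es : seq (vtx * vtx)) m (x : vtx) : vtx :=
  if es is (a, b) :: es' then
    if x == a then b else if x == b then a else override es' m x
  else m x.

Fixpoint covered (es : seq (vtx * vtx)) : seq vtx :=
  if es is (a, b) :: es' then [:: a, b & covered es'] else [::].

Lemma override_out es m x : x \notin covered es -> override es m x = m x.
Proof.
elim: es => //= -[a b] es IH; rewrite !inE !negb_or.
by case/and3P => /negbTE-> /negbTE-> /IH.
Qed.

Lemma override_in es m a b : uniq (covered es) -> (a, b) \in es ->
  override es m a = b /\ override es m b = a.
Proof.
have cov es' : (a, b) \in es' -> (a \in covered es') && (b \in covered es').
  elim: es' => //= -[c d] es' IH; rewrite inE => /orP[/eqP[-> ->]|/IH/andP[aes bes]].
    by rewrite !inE !eqxx !orbT.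
  by rewrite !inE aes bes !orbT.
elim: es => //= -[c d] es IH; rewrite inE /= inE negb_or -!andbA.
case/and4P => ncd ces des ues /orP[/eqP[-> ->]|abes].
  by rewrite !eqxx eq_sym (negbTE ncd).
have /andP[aes bes] := cov es abes.
have neq x y : x \in covered es -> y \notin covered es -> (x == y) = false.
  by move=> xes; apply: contraNF => /eqP <-.
by rewrite !neq //; exact: IH.
Qed.

Lemma coveredP es x : x \in covered es ->
  exists a b, (a, b) \in es /\ (x = a \/ x = b).
Proof.
elim: es => //= -[a b] es IH; rewrite !inE orbA => /orP[xab|/IH].
  by exists a, b; rewrite inE eqxx; split=> //; case/orP: xab => /eqP; [left|right].
by case=> c [d [cd xcd]]; exists c, d; rewrite inE cd orbT.
Qed.

Lemma override_vmatching es m : uniq (covered es) ->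
  all (fun p => vadj p.1 p.2) es ->
  (forall x, valid x -> x \notin covered es ->
     [&& vadj x (m x), m x \notin covered es & m (m x) == x]) ->
  vmatching (override es m).
Proof.
move=> ues /allP hes hm x vx; have [xes|xes] := boolP (x \in covered es).
  have [a [b [abes xab]]] := coveredP xes.
  have [ma mb] := override_in m ues abes; have /= adj_ab := hes _ abes.
  by case: xab => ->; rewrite ?ma ?mb // vadjC.
have /and3P[adjx mx /eqP mmx] := hm x vx xes.
by rewrite (override_out _ xes) (override_out _ mx).
Qed.

Lemma base_vmatching s : s <= i -> vmatching (base s xpred0 xpred0).
Proof.
move=> si x; case: x => t; rewrite /vadj /= /rim_mate => vx; (split; [|apply/eqP]);
  split_ifs; rewrite ?vtx_eqE; split_ifs; try lia.
Qed.

(** The names tell the edge at a hub that a matching is made for.  The matchings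
    [triple] and [triple_top] have three edges in one cut between levels; at the
    bottom the rim path plays the part of [Mid]. *)
Definition hub_hub s := base s xpred0 xpred0.

Definition hub_V1 s := override
  [:: (Hub s, V1 s); (V2 s, Hub s.+1); (V3 s, V4 s)]
  (base s xpred0 xpred0).

Definition hub_V4 s := override
  [:: (Hub s, V4 s); (V3 s, Hub s.+1); (V1 s, V2 s)]
  (base s xpred0 xpred0).

Definition V1_hub s := override
  [:: (V1 s, Hub s.+1); (V2 s, Hub s); (V3 s, V4 s)]
  (base s xpred0 xpred0).

Definition V4_hub s := override
  [:: (V4 s, Hub s.+1); (V3 s, Hub s); (V1 s, V2 s)]
  (base s xpred0 xpred0).

Definition hub_Mid s := override
  [:: (Hub s, Mid s); (V1 s.-1, V1 s); (V2 s.-1, Hub s.-1); (V3 s.-1, V4 s.-1);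
      (V2 s, Hub s.+1); (V3 s, V4 s)]
  (base s xpred0 xpred0).

Definition hub_V2 s := override
  [:: (Hub s, V2 s); (V1 s.-1, V1 s); (V2 s.-1, Hub s.-1); (V3 s.-1, V4 s.-1);
      (Mid s, V4 s); (V3 s, Hub s.+1)]
  (base s xpred0 xpred0).

Definition hub_V3 s := override
  [:: (Hub s, V3 s); (V1 s.-1, V1 s); (V2 s.-1, Hub s.-1); (V3 s.-1, V4 s.-1);
      (Mid s, V4 s); (V2 s, Hub s.+1)]
  (base s xpred0 xpred0).

Definition triple s := override
  [:: (V1 s.-1, V1 s); (V4 s.-1, Mid s); (V2 s.-1, Hub s);
      (V3 s.-1, Hub s.-1); (V2 s, Hub s.+1); (V3 s, V4 s)]
  (base s xpred0 xpred0).

Definition hub_V2_bottom := override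
  [:: (Hub 0, V2 0); (V1 0, RimR 1); (V4 0, RimR k.-1); (V3 0, Hub 1)]
  (base 0 xpred0 xpredT).

Definition hub_V3_bottom := override
  [:: (Hub 0, V3 0); (V1 0, RimR 1); (V4 0, RimR k.-1); (V2 0, Hub 1)]
  (base 0 xpred0 xpredT).

Definition triple_top := override
  [:: (V1 i, RimL 1); (V4 i, RimL l.-1); (V2 i, Hub i.+1); (V3 i, Hub i)]
  (base i xpredT xpred0).

Definition hub_RimR_odd j := override
  [:: (Hub 0, RimR j); (V4 0, RimR k.-1); (V3 0, Hub 1); (V1 0, V2 0)]
  (base 0 xpred0 (fun a => j < a)).

Definition hub_RimR_even j := override
  [:: (Hub 0, RimR j); (V1 0, RimR 1); (V2 0, Hub 1); (V3 0, V4 0)]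
  (base 0 xpred0 (fun a => a < j)).

Definition hub_RimL_odd j := override
  [:: (Hub i.+1, RimL j); (V4 i, RimL l.-1); (V3 i, Hub i); (V1 i, V2 i)]
  (base i (fun a => j < a) xpred0).

Definition hub_RimL_even j := override
  [:: (Hub i.+1, RimL j); (V1 i, RimL 1); (V2 i, Hub i); (V3 i, V4 i)]
  (base i (fun a => a < j) xpred0).

Ltac check_override :=
  apply: override_vmatching;
  [ by rewrite /= !inE !vtx_eqE /=; lia | by rewrite /= /vadj /=; lia |
    case=> t; rewrite !inE !vtx_eqE /vadj /= /rim_mate => vx nt;
    split_ifs; rewrite ?vtx_eqE; split_ifs; lia ].

Lemma hub_V1_vmatching s : s <= i -> vmatching (hub_V1 s).
Proof. by move=> hs; check_override. Qed.

Lemma hub_V4_vmatching s : s <= i -> vmatching (hub_V4 s).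
Proof. by move=> hs; check_override. Qed.

Lemma V1_hub_vmatching s : s <= i -> vmatching (V1_hub s).
Proof. by move=> hs; check_override. Qed.

Lemma V4_hub_vmatching s : s <= i -> vmatching (V4_hub s).
Proof. by move=> hs; check_override. Qed.

Lemma hub_Mid_vmatching s : 0 < s <= i -> vmatching (hub_Mid s).
Proof. by move=> hs; check_override. Qed.

Lemma hub_V2_vmatching s : 0 < s <= i -> vmatching (hub_V2 s).
Proof. by move=> hs; check_override. Qed.

Lemma hub_V3_vmatching s : 0 < s <= i -> vmatching (hub_V3 s).
Proof. by move=> hs; check_override. Qed.

Lemma triple_vmatching s : 0 < s <= i -> vmatching (triple s).
Proof. by move=> hs; check_override. Qed.

Lemma hub_V2_bottom_vmatching : vmatching hub_V2_bottom.
Proof. by check_override. Qed.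

Lemma hub_V3_bottom_vmatching : vmatching hub_V3_bottom.
Proof. by check_override. Qed.

Lemma triple_top_vmatching : vmatching triple_top.
Proof. by check_override. Qed.

Lemma hub_RimR_odd_vmatching j : odd j -> 0 < j < k -> vmatching (hub_RimR_odd j).
Proof. by move=> oj hj; check_override. Qed.

Lemma hub_RimR_even_vmatching j : ~~ odd j -> 0 < j < k -> vmatching (hub_RimR_even j).
Proof. by move=> oj hj; check_override. Qed.

Lemma hub_RimL_odd_vmatching j : odd j -> 0 < j < l -> vmatching (hub_RimL_odd j).
Proof. by move=> oj hj; check_override. Qed.

Lemma hub_RimL_even_vmatching j : ~~ odd j -> 0 < j < l -> vmatching (hub_RimL_even j).
Proof. by move=> oj hj; check_override. Qed.

(** The only edges from level [r.-1] to level [r] that avoid [Hub r] leave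
    [V1 r.-1] and [V4 r.-1]. *)
Definition vthin_at m r :=
  (lev (m (V1 r.-1)) < r) || (lev (m (V4 r.-1)) < r).
Definition vthin m := forall r, 0 < r <= i.+1 -> vthin_at m r.

Ltac check_thin := rewrite /vthin_at; cbn; rewrite ?vtx_eqE; split_ifs; cbn; lia.

Lemma hub_hub_vthin s : s <= i -> vthin (hub_hub s).
Proof. by move=> hs r hr; check_thin. Qed.

Lemma hub_V1_vthin s : s <= i -> vthin (hub_V1 s).
Proof. by move=> hs r hr; check_thin. Qed.

Lemma hub_V4_vthin s : s <= i -> vthin (hub_V4 s).
Proof. by move=> hs r hr; check_thin. Qed.

Lemma V1_hub_vthin s : s <= i -> vthin (V1_hub s).
Proof. by move=> hs r hr; check_thin. Qed.

Lemma V4_hub_vthin s : s <= i -> vthin (V4_hub s).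
Proof. by move=> hs r hr; check_thin. Qed.

Lemma hub_Mid_vthin s : 0 < s <= i -> vthin (hub_Mid s).
Proof. by move=> hs r hr; check_thin. Qed.

Lemma hub_V2_vthin s : 0 < s <= i -> vthin (hub_V2 s).
Proof. by move=> hs r hr; check_thin. Qed.

Lemma hub_V3_vthin s : 0 < s <= i -> vthin (hub_V3 s).
Proof. by move=> hs r hr; check_thin. Qed.

Lemma hub_V2_bottom_vthin : vthin hub_V2_bottom.
Proof. by move=> r hr; check_thin. Qed.

Lemma hub_V3_bottom_vthin : vthin hub_V3_bottom.
Proof. by move=> r hr; check_thin. Qed.

Lemma hub_RimR_odd_vthin j : vthin (hub_RimR_odd j).
Proof. by move=> r hr; check_thin. Qed.

Lemma hub_RimR_even_vthin j : vthin (hub_RimR_even j).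
Proof. by move=> r hr; check_thin. Qed.

Lemma hub_RimL_odd_vthin j : vthin (hub_RimL_odd j).
Proof. by move=> r hr; check_thin. Qed.

Lemma hub_RimL_even_vthin j : vthin (hub_RimL_even j).
Proof. by move=> r hr; check_thin. Qed.

Lemma triple_vthin s r : 0 < s <= i -> s < r <= i.+1 -> vthin_at (triple s) r.
Proof. by move=> hs hr; check_thin. Qed.

(** * Perfect matchings of the graph and of its coordinates *)

Lemma hub0_vertex : name_of (Hub 0) \in G_vertices l k i.
Proof. by apply/mem_vertices; exists (Hub 0). Qed.

(** The default value is used for coordinates outside the graph only. *)
Definition vin (x : vtx) : vertex G :=
  insubd (SeqSub hub0_vertex : vertex G) (name_of x).
Definition vout (y : vertex G) : vtx := vtx_of (val y).

Lemma val_vin x : valid x -> val (vin x) = name_of x.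
Proof.
move=> vx; rewrite /vin insubdK //.
by apply/mem_vertices; exists x.
Qed.

Lemma vinK x : valid x -> vout (vin x) = x.
Proof. by move=> vx; rewrite /vout val_vin // name_ofK. Qed.

Lemma vout_name y : valid (vout y) /\ name_of (vout y) = val y.
Proof.
have /mem_vertices[x vx ex] := valP y.
by rewrite /vout -ex name_ofK.
Qed.

Lemma vout_valid y : valid (vout y). Proof. by case: (vout_name y). Qed.

Lemma voutK : cancel vout vin.
Proof.
move=> y; apply: val_inj; rewrite val_vin ?vout_valid //.
by case: (vout_name y).
Qed.

Lemma vin_inj x y : valid x -> valid y -> vin x = vin y -> x = y.
Proof. by move=> vx vy e; rewrite -(vinK vx) e vinK. Qed.

Lemma vertexP y : exists2 x, valid x & y = vin x.
Proof. by exists (vout y); rewrite ?vout_valid ?voutK. Qed.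

Lemma adj_vin x y : valid x -> valid y -> @adj G (vin x) (vin y) = vadj x y.
Proof.
move=> vx vy; rewrite simple_adj !val_vin // mem_edges //.
have [e|] := eqVneq (vin x) (vin y); last by [].
rewrite (vin_inj vx vy e) /vadj /=; apply/esym/negbTE.
by case: (y) => t /=; lia.
Qed.

Definition to_map (m : vtx -> vtx) (y : vertex G) := vin (m (vout y)).
Definition of_map (m : vertex G -> vertex G) (x : vtx) := vout (m (vin x)).

Lemma to_mapE m x : valid x -> to_map m (vin x) = vin (m x).
Proof. by move=> vx; rewrite /to_map vinK. Qed.

Lemma vmatching_valid m x : vmatching m -> valid x -> valid (m x).
Proof. by move=> hm /hm[/and3P[]]. Qed.

Lemma to_map_perfect m : vmatching m -> perfect_map (to_map m).
Proof.
move=> hm y; have [x vx ->] := vertexP y; have [adjx mmx] := hm x vx.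
by rewrite !to_mapE ?(vmatching_valid hm) // adj_vin ?(vmatching_valid hm) // mmx.
Qed.

Lemma of_map_vmatching m : perfect_map m -> vmatching (of_map m).
Proof.
move=> hm x vx; have [adjx mmx] := hm (vin x).
rewrite /of_map -adj_vin ?vout_valid // !voutK adjx mmx vinK //.
Qed.

Lemma one_crossing m (S : {set vertex G}) a b : vmatching m ->
  #|crossing (to_map m) S| = 1 -> valid a -> valid b ->
  (vin a \in S) != (vin (m a) \in S) -> b != a -> b != m a ->
  (vin b \in S) = (vin (m b) \in S).
Proof.
move=> hm /eqP/cards1P[y cS] va vb aS nba nbma.
apply/eqP; apply: contraT => bS.
have vm x : valid x -> valid (m x) by exact: vmatching_valid.
have end_in x : valid x -> (vin x \in S) != (vin (m x) \in S) ->
    exists x', [/\ valid x', vin x' = y & x' = x \/ x' = m x].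
  move=> vx xS; have [xin|xout] := boolP (vin x \in S).
    exists x; split; [by [] | | by left].
    apply/eqP; rewrite -in_set1 -cS inE xin to_mapE //.
    by move: xS; rewrite xin; case: (_ \in _).
  exists (m x); split; [exact: vm | | by right].
  apply/eqP; rewrite -in_set1 -cS inE to_mapE ?vm // (hm x vx).2 (negbTE xout).
  by move: xS; rewrite (negbTE xout); case: (_ \in _).
have [a' [va' ya' ea']] := end_in a va aS.
have [b' [vb' yb' eb']] := end_in b vb bS.
have eab : a' = b' by apply: vin_inj; rewrite ?yb'.
have inj : forall x x', valid x -> valid x' -> m x = m x' -> x = x'.
  by move=> x x' vx vx' e; rewrite -(hm x vx).2 e (hm x' vx').2.
case: ea' eb' eab => -> [] -> e.
- by rewrite e eqxx in nba.
- by move: nbma; rewrite e (hm b vb).2 eqxx.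
- by rewrite e eqxx in nbma.
- by rewrite (inj b a) // ?eqxx in nba.
Qed.

Definition below r : {set vertex G} := [set y | lev (vout y) < r].

Lemma in_below r x : valid x -> (vin x \in below r) = (lev x < r).
Proof. by move=> vx; rewrite inE vinK. Qed.

Lemma level_edges m r x : vmatching m -> valid x -> 0 < r -> lev x < r <= lev (m x) ->
  [\/ x = V1 r.-1, x = V4 r.-1 | m x = Hub r].
Proof.
move=> hm vx r0 hr; have [adjx _] := hm x vx.
have h3 (a b c : bool) : [|| a, b | c] -> [\/ a, b | c] by move/or3P.
suff: [|| x == V1 r.-1, x == V4 r.-1 | m x == Hub r].
  by case/or3P => /eqP; [constructor 1 | constructor 2 | constructor 3].
move: adjx vx hr; rewrite /vadj !vtx_eqE.
by case: x => t; case: (m _) => u /=; lia.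
Qed.

Lemma crossing_base r : 0 < r <= i.+1 ->
  #|crossing (to_map (hub_hub 0)) (below r)| = 1.
Proof.
move=> hr; pose c := if r == 1 then Hub 0 else V3 r.-1.
have vc : valid c by rewrite /c; case: ifP => /=; lia.
have hm : vmatching (hub_hub 0) by exact: base_vmatching.
apply/eqP/cards1P; exists (vin c); apply/setP => y; have [x vx ->] := vertexP y.
rewrite !inE to_mapE // !vinK ?(vmatching_valid hm) //.
have -> : (vin x == vin c) = (x == c).
  by apply/eqP/eqP => [/(vin_inj vx vc)|->].
move: vx; rewrite /c /hub_hub; case: x => t /=; rewrite !vtx_eqE; split_ifs; lia.
Qed.

(* The parity is read off from a matching that crosses the set once. *)
Lemma odd_below r : 0 < r <= i.+1 -> odd #|below r|.
Proof.
move=> hr; rewrite -(odd_crossing (m := to_map (hub_hub 0))) ?crossing_base //.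
by apply/perfect_map_pairing/to_map_perfect/base_vmatching.
Qed.

Lemma below_exit m r : vmatching m -> 0 < r <= i.+1 ->
  exists2 x, valid x & lev x < r <= lev (m x).
Proof.
move=> hm hr; have pm := perfect_map_pairing (to_map_perfect hm).
have : odd #|crossing (to_map m) (below r)| by rewrite odd_crossing // odd_below.
move/odd_gt0/card_gt0P => [y]; have [x vx ->] := vertexP y.
rewrite inE to_mapE // !in_below ?(vmatching_valid hm) // -leqNgt => hx.
by exists x.
Qed.

(** Besides the edge at [Hub r] at most one edge can cross, and the number of
    crossing edges is odd. *)
Lemma crossing_thin m r : vmatching m -> 0 < r <= i.+1 -> vthin_at m r ->
  #|crossing (to_map m) (below r)| = 1.
Proof.
move=> hm hr thin; have pm := perfect_map_pairing (to_map_perfect hm).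
have oc : odd #|crossing (to_map m) (below r)| by rewrite odd_crossing // odd_below.
have vm x : valid x -> valid (m x) by exact: vmatching_valid.
have vH : valid (Hub r) by rewrite /=; lia.
pose v := if lev (m (V1 r.-1)) < r then V4 r.-1 else V1 r.-1.
have sub : crossing (to_map m) (below r) \subset [set vin v; vin (m (Hub r))].
  apply/subsetP => y; have [x vx ->] := vertexP y.
  rewrite inE to_mapE // !in_below ?vm // -leqNgt => hx.
  have r0 : 0 < r by lia.
  have [e|e|e] := level_edges hm vx r0 hx.
  - by rewrite !inE /v -e ltnNge (andP hx).2 eqxx.
  - rewrite !inE /v; move: thin; rewrite /vthin_at -e ltnNge => /orP[->|]; rewrite ?eqxx //.
    by rewrite ltnNge (andP hx).2.
  by rewrite -e (hm x vx).2 !inE eqxx orbT.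
have := subset_leq_card sub; rewrite cards2; move: oc.
by case: #|_| => [|[|[|n]]] //=; lia.
Qed.

(** * Matchings determined by one edge *)

(** The rim paths, extended at both ends by the vertices they are attached to. *)
Definition rimL j := if j == 0 then V1 i else if j == l then V4 i else RimL j.
Definition rimR j := if j == 0 then V1 0 else if j == k then V4 0 else RimR j.

Section OneMatching.
Variable m : vtx -> vtx.
Hypothesis hm : vmatching m.

Lemma mateK x : valid x -> m (m x) = x.
Proof. by case/hm. Qed.

Lemma mate_of_V2 t : t <= i ->
  [\/ m (V2 t) = V1 t, m (V2 t) = Hub t | m (V2 t) = Hub t.+1].
Proof.
move=> ht; have [] := hm (x := V2 t) ht; case: (m _) => u; rewrite /vadj //= => h _; try lia.
  have [->|?] := eqVneq u t; first by constructor 2.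
  by constructor 3; congr Hub; lia.
by constructor 1; congr V1; lia.
Qed.

Lemma mate_of_V3 t : t <= i ->
  [\/ m (V3 t) = V4 t, m (V3 t) = Hub t | m (V3 t) = Hub t.+1].
Proof.
move=> ht; have [] := hm (x := V3 t) ht; case: (m _) => u; rewrite /vadj //= => h _; try lia.
  have [->|?] := eqVneq u t; first by constructor 2.
  by constructor 3; congr Hub; lia.
by constructor 1; congr V4; lia.
Qed.

Lemma mate_of_Mid t : 0 < t <= i ->
  [\/ m (Mid t) = Hub t, m (Mid t) = V4 t | m (Mid t) = V4 t.-1].
Proof.
move=> ht; have [] := hm (x := Mid t) ht; case: (m _) => u; rewrite /vadj //= => h _; try lia.
  by constructor 1; congr Hub; lia.
have [->|?] := eqVneq u t; first by constructor 2.
by constructor 3; congr V4; lia.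
Qed.

Lemma mate_of_RimR j : 0 < j < k ->
  [\/ m (RimR j) = Hub 0, m (RimR j) = rimR j.-1 | m (RimR j) = rimR j.+1].
Proof.
move=> hj; have [] := hm (x := RimR j) hj; rewrite /rimR.
case: (m _) => u; rewrite /vadj //= => h _; try lia.
- by constructor 1; congr Hub; lia.
- by constructor 2; split_ifs; try lia; congr V1; lia.
- by constructor 3; split_ifs; try lia; congr V4; lia.
have [?|?] := eqVneq u j.+1.
  by constructor 3; split_ifs; try lia; congr RimR; lia.
by constructor 2; split_ifs; try lia; congr RimR; lia.
Qed.

Lemma mate_of_RimL j : 0 < j < l ->
  [\/ m (RimL j) = Hub i.+1, m (RimL j) = rimL j.-1 | m (RimL j) = rimL j.+1].
Proof.
move=> hj; have [] := hm (x := RimL j) hj; rewrite /rimL.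
case: (m _) => u; rewrite /vadj //= => h _; try lia.
- by constructor 1; congr Hub; lia.
- by constructor 2; split_ifs; try lia; congr V1; lia.
- by constructor 3; split_ifs; try lia; congr V4; lia.
have [?|?] := eqVneq u j.+1.
  by constructor 3; split_ifs; try lia; congr RimL; lia.
by constructor 2; split_ifs; try lia; congr RimL; lia.
Qed.

End OneMatching.

(** At each inner vertex one of the two choices is taken up by the vertices
    before it. *)
Lemma path_forced (m : vtx -> vtx) (w : nat -> vtx) a n :
  (forall x, a < x < n -> m (w x) = w x.-1 \/ m (w x) = w x.+1) ->
  (forall x, a < x < n -> m (m (w x)) = w x) ->
  (forall x, a < x < n -> w x <> w x.+2) ->
  (a.+1 < n -> m (w a.+1) <> w a) ->
  forall x, a < x < n -> odd (x - a) -> m (w x) = w x.+1.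
Proof.
move=> hm mK w_inj start; elim/ltn_ind => x IH hx ox.
have [def_x|nx] := eqVneq x a.+1.
  case: (hm x hx) => //; rewrite def_x /= => e; case: start => //.
  by rewrite -def_x; case/andP: hx.
have e : m (w x.-2) = w x.-1.
  have -> : m (w x.-2) = w x.-2.+1 by apply: IH; lia.
  by congr w; lia.
have [mx|//] := hm x hx.
have hx2 : a < x.-2 < n by lia.
have := mK _ hx2; rewrite e -mx mK // => ew.
by case: (w_inj _ hx2); rewrite -ew; congr w; lia.
Qed.

Lemma path_forced_rev (m : vtx -> vtx) (w : nat -> vtx) a :
  (forall x, 0 < x < a -> m (w x) = w x.-1 \/ m (w x) = w x.+1) ->
  (forall x, 0 < x < a -> m (m (w x)) = w x) ->
  (forall x, 0 < x < a -> w x <> w x.-2) ->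
  (0 < a.-1 -> m (w a.-1) <> w a) ->
  forall x, 0 < x < a -> odd (a - x) -> m (w x) = w x.-1.
Proof.
move=> hm mK w_inj start x hx ox; pose w' x := w (a - x).
have -> : w x = w' (a - x) by rewrite /w'; congr w; lia.
have -> : w x.-1 = w' (a - x).+1 by rewrite /w'; congr w; lia.
apply: (@path_forced m w' 0 a); rewrite /w' ?subn0 //; try lia.
- move=> y hy; have [|->|->] := hm (a - y); first (by lia); [right|left]; congr w; lia.
- by move=> y hy; apply: mK; lia.
- move=> y hy; have -> : a - y.+2 = (a - y).-2 by lia.
  by apply: w_inj; lia.
by rewrite subn1 => lt; apply: start; lia.
Qed.

Lemma rimRE j : 0 < j < k -> rimR j = RimR j.
Proof. by rewrite /rimR => hj; do 2 (case: eqP => [?|_]; first by lia). Qed.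

Lemma rimLE j : 0 < j < l -> rimL j = RimL j.
Proof. by rewrite /rimL => hj; do 2 (case: eqP => [?|_]; first by lia). Qed.

Lemma rimR_neq j : 0 < j < k -> rimR j <> rimR j.+2 /\ rimR j <> rimR j.-2.
Proof. by move=> hj; rewrite rimRE // /rimR; split; split_ifs => //; case; lia. Qed.

Lemma rimL_neq j : 0 < j < l -> rimL j <> rimL j.+2 /\ rimL j <> rimL j.-2.
Proof. by move=> hj; rewrite rimLE // /rimL; split; split_ifs => //; case; lia. Qed.

Section Propagate.
Variable m : vtx -> vtx.
Hypothesis hm : vmatching m.

Lemma rimR_step j : 0 < j < k -> m (RimR j) <> Hub 0 ->
  m (rimR j) = rimR j.-1 \/ m (rimR j) = rimR j.+1.
Proof.
by move=> hj nh; rewrite rimRE //; case: (mate_of_RimR hm hj) => //; [left|right].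
Qed.

Lemma rimL_step j : 0 < j < l -> m (RimL j) <> Hub i.+1 ->
  m (rimL j) = rimL j.-1 \/ m (rimL j) = rimL j.+1.
Proof.
by move=> hj nh; rewrite rimLE //; case: (mate_of_RimL hm hj) => //; [left|right].
Qed.

Lemma rimR_up a b : b <= k -> (forall j, a < j < b -> m (RimR j) <> Hub 0) ->
  (a.+1 < b -> m (rimR a.+1) <> rimR a) ->
  forall j, a < j < b -> odd (j - a) -> m (RimR j) = rimR j.+1.
Proof.
move=> bk nh start j hj oj; rewrite -rimRE; last by lia.
apply: (@path_forced m rimR a b) => // x hx.
- by apply: rimR_step; [lia | exact: nh].
- by rewrite rimRE ?mateK //=; lia.
by apply: (rimR_neq _).1; lia.
Qed.

Lemma rimR_down a : a <= k -> (forall j, 0 < j < a -> m (RimR j) <> Hub 0) ->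
  (0 < a.-1 -> m (rimR a.-1) <> rimR a) ->
  forall j, 0 < j < a -> odd (a - j) -> m (RimR j) = rimR j.-1.
Proof.
move=> bk nh start j hj oj; rewrite -rimRE; last by lia.
apply: (@path_forced_rev m rimR a) => // x hx.
- by apply: rimR_step; [lia | exact: nh].
- by rewrite rimRE ?mateK //=; lia.
by apply: (rimR_neq _).2; lia.
Qed.

Lemma rimL_up a b : b <= l -> (forall j, a < j < b -> m (RimL j) <> Hub i.+1) ->
  (a.+1 < b -> m (rimL a.+1) <> rimL a) ->
  forall j, a < j < b -> odd (j - a) -> m (RimL j) = rimL j.+1.
Proof.
move=> bk nh start j hj oj; rewrite -rimLE; last by lia.
apply: (@path_forced m rimL a b) => // x hx.
- by apply: rimL_step; [lia | exact: nh].
- by rewrite rimLE ?mateK //=; lia.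
by apply: (rimL_neq _).1; lia.
Qed.

Lemma rimL_down a : a <= l -> (forall j, 0 < j < a -> m (RimL j) <> Hub i.+1) ->
  (0 < a.-1 -> m (rimL a.-1) <> rimL a) ->
  forall j, 0 < j < a -> odd (a - j) -> m (RimL j) = rimL j.-1.
Proof.
move=> bk nh start j hj oj; rewrite -rimLE; last by lia.
apply: (@path_forced_rev m rimL a) => // x hx.
- by apply: rimL_step; [lia | exact: nh].
- by rewrite rimLE ?mateK //=; lia.
by apply: (rimL_neq _).2; lia.
Qed.

(** The part of a matching below level [s], and above it, when these parts are
    those of [base]. *)
Definition lower s :=
  (forall r, r < s -> [/\ m (V4 r) = Mid r.+1, m (V3 r) = Hub r & m (V2 r) = V1 r])
  /\ (forall j, 0 < j < k -> odd j -> m (RimR j) = RimR j.+1).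

Definition upper s :=
  (forall r, s < r <= i -> [/\ m (Mid r) = V4 r, m (V3 r) = Hub r.+1 & m (V2 r) = V1 r])
  /\ (forall j, 0 < j < l -> odd j -> m (RimL j) = RimL j.+1).

Lemma lower_forced0 : (forall j, m (Hub 0) <> RimR j) -> m (V1 0) <> RimR 1 -> lower 0.
Proof.
move=> nh n1; split=> // j hj oj; rewrite -(@rimRE j.+1); last by lia.
apply: (@rimR_up 0 k) => //; last by rewrite subn0.
  move=> x hx e; case: (nh x); rewrite -e mateK //; lia.
move=> _; rewrite rimRE; last by lia.
by move=> e; case: n1; rewrite -[V1 0]e mateK //=; lia.
Qed.

(** Once [V4 s] is matched to [Mid s.+1] and [Hub s.+1] is not matched downwards,
    each level in turn has a single choice. *)
Lemma lower_forced s : s < i -> m (Mid s.+1) = V4 s ->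
  m (V2 s) <> Hub s.+1 -> m (V3 s) <> Hub s.+1 -> lower s.+1.
Proof.
elim: s => [|s IH] si mid n2 n3.
  have m4 : m (V4 0) = Mid 1 by rewrite -mid mateK //=; lia.
  have m3 : m (V3 0) = Hub 0.
    case: (mate_of_V3 hm (leq0n i)) => // e.
    by have := mateK hm (x := V3 0) isT; rewrite e m4.
  have h0 : m (Hub 0) = V3 0 by rewrite -m3 mateK.
  have m2 : m (V2 0) = V1 0.
    case: (mate_of_V2 hm (leq0n i)) => // e.
    by have := mateK hm (x := V2 0) isT; rewrite e h0.
  have m1 : m (V1 0) = V2 0 by rewrite -m2 mateK.
  have [_ rim] : lower 0 by apply: lower_forced0; rewrite ?h0 ?m1.
  by split=> // -[].
have hs : s.+1 <= i by lia.
have m4 : m (V4 s.+1) = Mid s.+2 by rewrite -mid mateK //=; lia.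
have m3 : m (V3 s.+1) = Hub s.+1.
  case: (mate_of_V3 hm hs) => // e.
  have : m (m (V3 s.+1)) = V3 s.+1 by rewrite mateK.
  by rewrite e m4.
have h0 : m (Hub s.+1) = V3 s.+1 by rewrite -m3 mateK.
have m2 : m (V2 s.+1) = V1 s.+1.
  case: (mate_of_V2 hm hs) => // e.
  have : m (m (V2 s.+1)) = V2 s.+1 by rewrite mateK.
  by rewrite e h0.
have mid' : m (Mid s.+1) = V4 s.
  have mm : m (m (Mid s.+1)) = Mid s.+1 by rewrite mateK.
  case: (mate_of_Mid hm (t := s.+1) hs) => // e; move: mm; rewrite e ?h0 ?m4 //.
  by case; lia.
have [low rim] : lower s.+1.
  apply: IH => // e.
    have : m (m (V2 s)) = V2 s by rewrite mateK //=; lia.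
    by rewrite e h0.
  have : m (m (V3 s)) = V3 s by rewrite mateK //=; lia.
  by rewrite e h0 => -[]; lia.
by split=> // r; rewrite ltnS leq_eqVlt => /orP[/eqP->|/low].
Qed.

(** The mirror image, going up from a level whose [Hub s.+1] is matched
    downwards. *)
Lemma upper_forced s : s <= i -> lev (m (Hub s.+1)) <= s ->
  m (V1 s) <> RimL 1 -> m (V4 s) <> Mid s.+1 -> upper s.
Proof.
have [n] := ubnP (i - s); elim: n s => // n IH s ltn si lh l1 l4.
have [def_s|ns] := eqVneq s i.
  rewrite def_s in lh l1 l4 *; split=> [r|j hj oj]; first by lia.
  rewrite -(@rimLE j.+1); last by lia.
  apply: (@rimL_up 0 l) => //; last by rewrite subn0.
    move=> x hx e; have mm : m (m (RimL x)) = RimL x by rewrite mateK //=; lia.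
    by move: lh; rewrite -e mm /=; lia.
  move=> _; rewrite rimLE; last by lia.
  move=> e; have mm : m (m (RimL 1)) = RimL 1 by rewrite mateK //=; lia.
  by case: l1; rewrite -[V1 i]e mm.
have hs : s.+1 <= i by lia.
have mid : m (Mid s.+1) = V4 s.+1.
  have mm : m (m (Mid s.+1)) = Mid s.+1 by rewrite mateK.
  case: (mate_of_Mid hm (t := s.+1) hs) => // e; move: mm; rewrite e => mm.
    by move: lh; rewrite mm /=; lia.
  by case: l4.
have m4 : m (V4 s.+1) = Mid s.+1 by rewrite -mid mateK.
have m3 : m (V3 s.+1) = Hub s.+2.
  have mm : m (m (V3 s.+1)) = V3 s.+1 by rewrite mateK.
  case: (mate_of_V3 hm hs) => // e; move: mm; rewrite e ?m4 // => mm.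
  by move: lh; rewrite mm /=; lia.
have h2 : m (Hub s.+2) = V3 s.+1 by rewrite -m3 mateK.
have m2 : m (V2 s.+1) = V1 s.+1.
  have mm : m (m (V2 s.+1)) = V2 s.+1 by rewrite mateK.
  case: (mate_of_V2 hm hs) => // e; move: mm; rewrite e ?h2 // => mm.
  by move: lh; rewrite mm /=; lia.
have m1 : m (V1 s.+1) = V2 s.+1 by rewrite -m2 mateK.
have [up rim] : upper s.+1.
  apply: IH; rewrite ?h2 ?m1 ?m4 //=; first by lia.
  by case; lia.
split=> // r hr; have [->//|nr] := eqVneq r s.+1.
by apply: up; lia.
Qed.

End Propagate.

(** The vertices whose mates [lower s] and [upper s] prescribe. *)
Definition low s (x : vtx) : bool :=
  match x with
  | RimR _ => true
  | V1 r | V2 r | V3 r | V4 r | Hub r => r < s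
  | Mid r => r <= s
  | RimL _ => false
  end.

Definition high s (x : vtx) : bool :=
  match x with
  | RimL _ => true
  | V1 r | V2 r | V3 r | V4 r | Mid r => s < r
  | Hub r => s.+1 < r
  | RimR _ => false
  end.

Lemma agree_low m m' s x : vmatching m -> vmatching m' -> s <= i.+1 ->
  lower m s -> lower m' s -> valid x -> low s x -> m x = m' x.
Proof.
move=> hm hm' si [lo rim] [lo' rim'].
have swap y z : valid y -> m y = z -> m' y = z -> m z = m' z.
  move=> vy e e'; rewrite -{1}e -e' !mateK //.
case: x => [r|r|r|r|r|r|j|j] //= vx hr; try by
  have [a b c] := lo r hr; have [a' b' c'] := lo' r hr; rewrite ?a ?b ?c.
- have [a b c] := lo r hr; have [a' b' c'] := lo' r hr.
  by apply: (swap (V3 r)) => //=; lia.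
- have [a b c] := lo r hr; have [a' b' c'] := lo' r hr.
  by apply: (swap (V2 r)) => //=; lia.
- have hr1 : r.-1 < s by lia.
  have [a _ _] := lo _ hr1; have [a' _ _] := lo' _ hr1.
  have -> : r = r.-1.+1 by lia.
  by apply: (swap (V4 r.-1)) => //=; lia.
have [oj|ej] := boolP (odd j); first by rewrite rim ?rim'.
have -> : j = j.-1.+1 by lia.
by apply: (swap (RimR j.-1)); rewrite ?rim ?rim' //=; lia.
Qed.

Lemma agree_high m m' s x : vmatching m -> vmatching m' ->
  upper m s -> upper m' s -> valid x -> high s x -> m x = m' x.
Proof.
move=> hm hm' [up rim] [up' rim'].
have swap y z : valid y -> m y = z -> m' y = z -> m z = m' z.
  move=> vy e e'; rewrite -{1}e -e' !mateK //.
case: x => [r|r|r|r|r|r|j|j] //= vx hr.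
- have hr1 : s < r.-1 <= i by lia.
  have [a b c] := up _ hr1; have [a' b' c'] := up' _ hr1.
  have -> : r = r.-1.+1 by lia.
  by apply: (swap (V3 r.-1)) => //=; lia.
all: try (have hr2 : s < r <= i by lia).
all: try (have [a b c] := up _ hr2; have [a' b' c'] := up' _ hr2).
- by apply: (swap (V2 r)).
- by rewrite c.
- by rewrite b.
- by apply: (swap (Mid r)) => //=; lia.
- by rewrite a.
have [oj|ej] := boolP (odd j); first by rewrite rim ?rim'.
have -> : j = j.-1.+1 by lia.
by apply: (swap (RimL j.-1)); rewrite ?rim ?rim' //=; lia.
Qed.

Definition contains (m : vtx -> vtx) (es : seq (vtx * vtx)) := forall a b, (a, b) \in es -> m a = b.

Lemma agree_covered m m' es x : vmatching m -> vmatching m' -> all valid (covered es) ->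
  contains m es -> contains m' es -> x \in covered es -> m x = m' x.
Proof.
move=> hm hm' ves ces ces' /coveredP[a [b [abes]]].
have ma := ces _ _ abes; have ma' := ces' _ _ abes.
have va : valid a.
  apply: (allP ves); elim: (es) abes => //= -[c d] es' IH.
  by rewrite inE => /orP[/eqP[-> _]|/IH]; rewrite !inE ?eqxx // => ->; rewrite !orbT.
by case=> ->; rewrite ?ma ?ma' // -{1}ma -ma' !(mateK _ va).
Qed.

Section Center.
Variable m : vtx -> vtx.
Hypothesis hm : vmatching m.

Lemma lower_center s : s <= i -> s <= lev (m (Hub s)) ->
  (forall j, m (Hub s) <> RimR j) -> m (Hub s) <> Mid s -> m (V4 s) <> Mid s ->
  m (V1 s) <> RimR 1 -> lower m s.
Proof.
case: s => [|s] hs lh nr nm n4 n1; first exact: (lower_forced0 hm).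
have used x : valid x -> lev x <= s -> m x <> Hub s.+1.
  by move=> vx lx e; have := mateK hm vx; rewrite e => ex; move: lh; rewrite ex; lia.
apply: (lower_forced hm) => //; last first.
- by apply: used; rewrite /=; lia.
- by apply: used; rewrite /=; lia.
have mm : m (m (Mid s.+1)) = Mid s.+1 by rewrite (mateK hm).
by case: (mate_of_Mid hm (t := s.+1) hs) => // e; move: mm; rewrite e.
Qed.

Lemma upper_center s : s <= i -> lev (m (Hub s.+1)) <= s ->
  m (V1 s) <> RimL 1 -> m (V4 s) <> Mid s.+1 -> upper m s.
Proof. exact: (upper_forced hm). Qed.

Ltac mate_facts t ht :=
  have := mateK hm (x := V1 t) ht; have := mateK hm (x := V2 t) ht;
  have := mateK hm (x := V3 t) ht; have := mateK hm (x := V4 t) ht;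
  have := mateK hm (x := Hub t) (leqW ht); have := mateK hm (x := Hub t.+1) ht.
Ltac force_V2 ht := case: (mate_of_V2 hm ht) => // ?; exfalso; congruence.
Ltac force_V3 ht := case: (mate_of_V3 hm ht) => // ?; exfalso; congruence.

Ltac list_facts := move=> ? ?; rewrite !inE;
  repeat (case/orP); move/eqP => [-> ->]; try congruence.

Lemma hub_hub_forced s : s <= i -> m (Hub s) = Hub s.+1 ->
  [/\ contains m [:: (Hub s, Hub s.+1); (V1 s, V2 s); (V3 s, V4 s)], lower m s & upper m s].
Proof.
move=> hs e0; mate_facts s hs => h' h h4 h3 h2 h1.
have e2 : m (V2 s) = V1 s by force_V2 hs.
have e3 : m (V3 s) = V4 s by force_V3 hs.
have e1 : m (V1 s) = V2 s by congruence.
have e4 : m (V4 s) = V3 s by congruence.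
have e0' : m (Hub s.+1) = Hub s by congruence.
split; [list_facts | apply: lower_center | apply: upper_center];
  rewrite ?e0 ?e0' ?e1 ?e4 //=.
Qed.

Lemma hub_V1_forced s : s <= i -> m (Hub s) = V1 s ->
  [/\ contains m [:: (Hub s, V1 s); (V2 s, Hub s.+1); (V3 s, V4 s)], lower m s & upper m s].
Proof.
move=> hs e0; mate_facts s hs => h' h h4 h3 h2 h1.
have e2 : m (V2 s) = Hub s.+1 by force_V2 hs.
have e3 : m (V3 s) = V4 s by force_V3 hs.
have e1 : m (V1 s) = Hub s by congruence.
have e4 : m (V4 s) = V3 s by congruence.
have e0' : m (Hub s.+1) = V2 s by congruence.
split; [list_facts | apply: lower_center | apply: upper_center];
  rewrite ?e0 ?e0' ?e1 ?e4 //=.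
Qed.

Lemma hub_V4_forced s : s <= i -> m (Hub s) = V4 s ->
  [/\ contains m [:: (Hub s, V4 s); (V3 s, Hub s.+1); (V1 s, V2 s)], lower m s & upper m s].
Proof.
move=> hs e0; mate_facts s hs => h' h h4 h3 h2 h1.
have e3 : m (V3 s) = Hub s.+1 by force_V3 hs.
have e2 : m (V2 s) = V1 s by force_V2 hs.
have e1 : m (V1 s) = V2 s by congruence.
have e4 : m (V4 s) = Hub s by congruence.
have e0' : m (Hub s.+1) = V3 s by congruence.
split; [list_facts | apply: lower_center | apply: upper_center];
  rewrite ?e0 ?e0' ?e1 ?e4 //=.
Qed.

Lemma V1_hub_forced s : s <= i -> m (V1 s) = Hub s.+1 ->
  [/\ contains m [:: (V1 s, Hub s.+1); (V2 s, Hub s); (V3 s, V4 s)], lower m s & upper m s].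
Proof.
move=> hs e1; mate_facts s hs => h' h h4 h3 h2 h1.
have e2 : m (V2 s) = Hub s by force_V2 hs.
have e3 : m (V3 s) = V4 s by force_V3 hs.
have e0 : m (Hub s) = V2 s by congruence.
have e4 : m (V4 s) = V3 s by congruence.
have e0' : m (Hub s.+1) = V1 s by congruence.
split; [list_facts | apply: lower_center | apply: upper_center];
  rewrite ?e0 ?e0' ?e1 ?e4 //=.
Qed.

Lemma V4_hub_forced s : s <= i -> m (V4 s) = Hub s.+1 ->
  [/\ contains m [:: (V4 s, Hub s.+1); (V3 s, Hub s); (V1 s, V2 s)], lower m s & upper m s].
Proof.
move=> hs e4; mate_facts s hs => h' h h4 h3 h2 h1.
have e3 : m (V3 s) = Hub s by force_V3 hs.
have e2 : m (V2 s) = V1 s by force_V2 hs.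
have e1 : m (V1 s) = V2 s by congruence.
have e0 : m (Hub s) = V3 s by congruence.
have e0' : m (Hub s.+1) = V4 s by congruence.
split; [list_facts | apply: lower_center | apply: upper_center];
  rewrite ?e0 ?e0' ?e1 ?e4 //=.
Qed.

(** Here the odd number of vertices below level [s.+1] leaves [V1 s] as the only
    vertex that can be matched upwards. *)
Lemma hub_Mid_forced s : s < i -> m (Hub s.+1) = Mid s.+1 ->
  [/\ contains m [:: (Hub s.+1, Mid s.+1); (V1 s, V1 s.+1); (V2 s, Hub s); (V3 s, V4 s);
                     (V2 s.+1, Hub s.+2); (V3 s.+1, V4 s.+1)],
      lower m s & upper m s.+1].
Proof.
move=> hs e0; have hs' : s <= i by lia.
mate_facts s hs' => h0 h h4 h3 h2 h1; mate_facts s.+1 hs => h0' _ k4 k3 k2 k1.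
have mm := mateK hm (x := Mid s.+1) hs.
have em : m (Mid s.+1) = Hub s.+1 by congruence.
have e1 : m (V1 s) = V1 s.+1.
  have [|x vx hx] := below_exit hm (r := s.+1); first by lia.
  have [|ex|ex|ex] := level_edges hm vx _ hx => //; move: hx; rewrite ex /=.
  - have [] := hm (x := V1 s) hs'; rewrite ex in vx *.
    case def_u : (m (V1 s)) => [u|u|u|u|u|u|u|u]; rewrite /vadj /= => a b c; try lia.
      by have eu : u = s.+1 by [lia]; congruence.
    by congr V1; lia.
  - have [] := hm (x := V4 s) hs'.
    case def_u : (m (V4 s)) => [u|u|u|u|u|u|u|u]; rewrite /vadj /= => a b c; try lia.
      by have eu : u = s.+1 by [lia]; congruence.
    by have eu : u = s.+1 by [lia]; congruence.
  by have := mateK hm vx; rewrite ex e0 => <- /=; lia.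
have e2 : m (V2 s) = Hub s by force_V2 hs'.
have e3 : m (V3 s) = V4 s by force_V3 hs'.
have f2 : m (V2 s.+1) = Hub s.+2 by force_V2 hs.
have f3 : m (V3 s.+1) = V4 s.+1 by force_V3 hs.
have f1 : m (V1 s.+1) = V1 s by congruence.
have f4 : m (V4 s.+1) = V3 s.+1 by congruence.
have e4 : m (V4 s) = V3 s by congruence.
have f0 : m (Hub s) = V2 s by congruence.
have f0' : m (Hub s.+2) = V2 s.+1 by congruence.
split; [list_facts | apply: lower_center | apply: upper_center];
  rewrite ?f0 ?f0' ?e1 ?e4 ?f1 ?f4 //=.
Qed.

(** A spoke leaves two subpaths of the rim, and exactly one of them is odd: its
    far end must be matched outside the rim. *)
Lemma rimR_from_hub j : 0 < j < k -> m (Hub 0) = RimR j ->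
  (forall x, 0 < x < j -> odd (j - x) -> m (RimR x) = rimR x.-1) /\
  (forall x, j < x < k -> odd (x - j) -> m (RimR x) = rimR x.+1).
Proof.
move=> hj e0; have ej : m (RimR j) = Hub 0 by rewrite -e0 (mateK hm).
have nh x : 0 < x < k -> x != j -> m (RimR x) <> Hub 0.
  move=> hx nxj e; have := mateK hm (x := RimR x) hx; rewrite e e0 => -[exj].
  by rewrite exj eqxx in nxj.
have nj x : 0 < x < k -> m (RimR x) <> RimR j.
  by move=> hx e; have := mateK hm (x := RimR x) hx; rewrite e ej.
split.
  apply: (rimR_down hm); first by lia.
    by move=> x hx; apply: nh; lia.
  by move=> lt; rewrite !rimRE; [apply: nj|..]; lia.
apply: (rimR_up hm) => //.
  by move=> x hx; apply: nh; lia.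
by move=> lt; rewrite !rimRE; [apply: nj|..]; lia.
Qed.

Lemma rimL_from_hub j : 0 < j < l -> m (Hub i.+1) = RimL j ->
  (forall x, 0 < x < j -> odd (j - x) -> m (RimL x) = rimL x.-1) /\
  (forall x, j < x < l -> odd (x - j) -> m (RimL x) = rimL x.+1).
Proof.
move=> hj e0; have ej : m (RimL j) = Hub i.+1 by rewrite -e0 (mateK hm) //=.
have nh x : 0 < x < l -> x != j -> m (RimL x) <> Hub i.+1.
  move=> hx nxj e; have := mateK hm (x := RimL x) hx; rewrite e e0 => -[exj].
  by rewrite exj eqxx in nxj.
have nj x : 0 < x < l -> m (RimL x) <> RimL j.
  by move=> hx e; have := mateK hm (x := RimL x) hx; rewrite e ej.
split.
  apply: (rimL_down hm); first by lia.
    by move=> x hx; apply: nh; lia.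
  by move=> lt; rewrite !rimLE; [apply: nj|..]; lia.
apply: (rimL_up hm) => //.
  by move=> x hx; apply: nh; lia.
by move=> lt; rewrite !rimLE; [apply: nj|..]; lia.
Qed.

Lemma hub_RimR_forced j : 0 < j < k -> m (Hub 0) = RimR j ->
  contains m (if odd j then [:: (Hub 0, RimR j); (V3 0, Hub 1); (V1 0, V2 0); (V4 0, RimR k.-1)]
              else [:: (Hub 0, RimR j); (V2 0, Hub 1); (V3 0, V4 0); (V1 0, RimR 1)])
  /\ upper m 0.
Proof.
move=> hj e0; have [down up] := rimR_from_hub hj e0.
have h : 0 <= i by []; mate_facts 0 h => h0' h0 h4 h3 h2 h1.
have [oj|ej] := boolP (odd j).
  have hk1 : j < k.-1 < k by lia.
  have e4 : m (V4 0) = RimR k.-1.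
    have vk : valid (RimR k.-1) by rewrite /=; lia.
    rewrite -[RHS](mateK hm vk) up //; last by lia.
    by rewrite /rimR prednK ?eqxx //; [case: eqP => //|]; lia.
  have e3 : m (V3 0) = Hub 1 by force_V3 h.
  have e2 : m (V2 0) = V1 0 by force_V2 h.
  have e1 : m (V1 0) = V2 0 by congruence.
  have e0' : m (Hub 1) = V3 0 by congruence.
  split; [list_facts | apply: upper_center]; rewrite ?e0' ?e1 ?e4 //.
have e1 : m (V1 0) = RimR 1.
  have v1 : valid (RimR 1) by rewrite /=; lia.
  by rewrite -[RHS](mateK hm v1) down //; lia.
have e2 : m (V2 0) = Hub 1 by force_V2 h.
have e3 : m (V3 0) = V4 0 by force_V3 h.
have e4 : m (V4 0) = V3 0 by congruence.
have e0' : m (Hub 1) = V2 0 by congruence.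
by split; [list_facts | apply: upper_center]; rewrite ?e0' ?e1 ?e4.
Qed.

Lemma hub_RimL_forced j : 0 < j < l -> m (Hub i.+1) = RimL j ->
  contains m (if odd j then [:: (Hub i.+1, RimL j); (V3 i, Hub i); (V1 i, V2 i); (V4 i, RimL l.-1)]
              else [:: (Hub i.+1, RimL j); (V2 i, Hub i); (V3 i, V4 i); (V1 i, RimL 1)])
  /\ lower m i.
Proof.
move=> hj e0; have [down up] := rimL_from_hub hj e0.
have h : i <= i by []; mate_facts i h => h0' h0 h4 h3 h2 h1.
have [oj|ej] := boolP (odd j).
  have hk1 : j < l.-1 < l by lia.
  have e4 : m (V4 i) = RimL l.-1.
    have vk : valid (RimL l.-1) by rewrite /=; lia.
    rewrite -[RHS](mateK hm vk) up //; last by lia.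
    by rewrite /rimL prednK ?eqxx //; [case: eqP => //|]; lia.
  have e3 : m (V3 i) = Hub i by force_V3 h.
  have e2 : m (V2 i) = V1 i by force_V2 h.
  have e1 : m (V1 i) = V2 i by congruence.
  have e0' : m (Hub i) = V3 i by congruence.
  split; [list_facts | apply: lower_center]; rewrite ?e0' ?e1 ?e4 //=.
have e1 : m (V1 i) = RimL 1.
  have v1 : valid (RimL 1) by rewrite /=; lia.
  by rewrite -[RHS](mateK hm v1) down //; lia.
have e2 : m (V2 i) = Hub i by force_V2 h.
have e3 : m (V3 i) = V4 i by force_V3 h.
have e4 : m (V4 i) = V3 i by congruence.
have e0' : m (Hub i) = V2 i by congruence.
by split; [list_facts | apply: lower_center]; rewrite ?e0' ?e1 ?e4 //=.
Qed.

End Center.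

Definition unique_edge a b := forall m m', vmatching m -> vmatching m' ->
  m a = b -> m' a = b -> forall x, valid x -> m x = m' x.

Lemma swap_agree m m' y z : vmatching m -> vmatching m' -> valid y ->
  m y = z -> m' y = z -> m z = m' z.
Proof. by move=> hm hm' vy e e'; rewrite -{1}e -e' (mateK hm) // (mateK hm'). Qed.

Lemma unique_center a b s es : s <= i ->
  (forall m, vmatching m -> m a = b -> [/\ contains m es, lower m s & upper m s]) ->
  all valid (covered es) ->
  (forall x, valid x -> [|| high s x, low s x | x \in covered es]) ->
  unique_edge a b.
Proof.
move=> hs forced ves cov m m' hm hm' ma ma' x vx.
have [c lo up] := forced m hm ma; have [c' lo' up'] := forced m' hm' ma'.
case/or3P: (cov x vx) => hx.
- exact: agree_high up up' vx hx.
- by apply: agree_low lo lo' vx hx => //; lia.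
exact: (agree_covered hm hm' ves c c' hx).
Qed.

Ltac check_cover :=
  let t := fresh "t" in let vt := fresh "vt" in
  case=> t vt; rewrite /= ?inE ?vtx_eqE /=; move: vt => /=; lia.

Lemma hub_hub_unique s : s <= i -> unique_edge (Hub s) (Hub s.+1).
Proof.
move=> hs; apply: (@unique_center _ _ s) => //.
- by move=> m hm; exact: (hub_hub_forced hm hs).
- by rewrite /=; lia.
by check_cover.
Qed.

Lemma hub_V1_unique s : s <= i -> unique_edge (Hub s) (V1 s).
Proof.
move=> hs; apply: (@unique_center _ _ s) => //.
- by move=> m hm; exact: (hub_V1_forced hm hs).
- by rewrite /=; lia.
by check_cover.
Qed.

Lemma hub_V4_unique s : s <= i -> unique_edge (Hub s) (V4 s).
Proof.
move=> hs; apply: (@unique_center _ _ s) => //.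
- by move=> m hm; exact: (hub_V4_forced hm hs).
- by rewrite /=; lia.
by check_cover.
Qed.

Lemma V1_hub_unique s : s <= i -> unique_edge (V1 s) (Hub s.+1).
Proof.
move=> hs; apply: (@unique_center _ _ s) => //.
- by move=> m hm; exact: (V1_hub_forced hm hs).
- by rewrite /=; lia.
by check_cover.
Qed.

Lemma V4_hub_unique s : s <= i -> unique_edge (V4 s) (Hub s.+1).
Proof.
move=> hs; apply: (@unique_center _ _ s) => //.
- by move=> m hm; exact: (V4_hub_forced hm hs).
- by rewrite /=; lia.
by check_cover.
Qed.

Lemma hub_Mid_unique s : 0 < s <= i -> unique_edge (Hub s) (Mid s).
Proof.
case: s => // s hs m m' hm hm' ma ma' x vx.
have [c lo up] := hub_Mid_forced hm hs ma; have [c' lo' up'] := hub_Mid_forced hm' hs ma'.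
have : [|| high s.+1 x, low s x |
    x \in covered [:: (Hub s.+1, Mid s.+1); (V1 s, V1 s.+1); (V2 s, Hub s); (V3 s, V4 s);
                     (V2 s.+1, Hub s.+2); (V3 s.+1, V4 s.+1)]].
  by move: vx; case: x => t vt; rewrite /= ?inE ?vtx_eqE /=; move: vt => /=; lia.
case/or3P => hx.
- exact: agree_high up up' vx hx.
- by apply: agree_low lo lo' vx hx => //; lia.
by apply: (agree_covered hm hm' _ c c' hx); rewrite /=; lia.
Qed.

Lemma hub_RimR_unique j : 0 < j < k -> unique_edge (Hub 0) (RimR j).
Proof.
move=> hj m m' hm hm' ma ma' x vx.
have [c up] := hub_RimR_forced hm hj ma; have [c' up'] := hub_RimR_forced hm' hj ma'.
have [down rise] := rimR_from_hub hm hj ma.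
have [down' rise'] := rimR_from_hub hm' hj ma'.
set es := (if odd j then _ else _) in c c'.
have : high 0 x || (x \in covered es) || (if x is RimR _ then true else false).
  rewrite /es; move: vx; case: x => t vt //; case: ifP => _;
    rewrite /= ?inE ?vtx_eqE /=; move: vt => /=; lia.
case/orP => [/orP[hx|hx]|].
- exact: agree_high up up' vx hx.
- by apply: (agree_covered hm hm' _ c c' hx); rewrite /es; case: ifP; rewrite /=; lia.
case: x vx => // x hx _; rewrite /= in hx.
have [->|nxj] := eqVneq x j; first by apply: swap_agree hm hm' _ ma ma'.
have [oxj|exj] := boolP (odd (x - j) || odd (j - x)).
  have [ltxj|ltjx] := ltnP x j; first by rewrite down ?down' //; lia.
  by rewrite rise ?rise' //; lia.
have [ltxj|ltjx] := ltnP x j.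
  have v1 : valid (RimR x.+1) by rewrite /=; lia.
  by apply: (swap_agree hm hm' v1); rewrite ?down ?down' ?rimRE //; lia.
have v1 : valid (RimR x.-1) by rewrite /=; lia.
by apply: (swap_agree hm hm' v1); rewrite ?rise ?rise' ?prednK ?rimRE //; lia.
Qed.

Lemma hub_RimL_unique j : 0 < j < l -> unique_edge (Hub i.+1) (RimL j).
Proof.
move=> hj m m' hm hm' ma ma' x vx.
have [c lo] := hub_RimL_forced hm hj ma; have [c' lo'] := hub_RimL_forced hm' hj ma'.
have [down rise] := rimL_from_hub hm hj ma.
have [down' rise'] := rimL_from_hub hm' hj ma'.
set es := (if odd j then _ else _) in c c'.
have : low i x || (x \in covered es) || (if x is RimL _ then true else false).
  rewrite /es; move: vx; case: x => t vt //; case: ifP => _;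
    rewrite /= ?inE ?vtx_eqE /=; move: vt => /=; lia.
case/orP => [/orP[hx|hx]|].
- by apply: agree_low lo lo' vx hx => //; lia.
- by apply: (agree_covered hm hm' _ c c' hx); rewrite /es; case: ifP; rewrite /=; lia.
case: x vx => // x hx _; rewrite /= in hx.
have [->|nxj] := eqVneq x j; first by apply: swap_agree hm hm' _ ma ma' => /=.
have [oxj|exj] := boolP (odd (x - j) || odd (j - x)).
  have [ltxj|ltjx] := ltnP x j; first by rewrite down ?down' //; lia.
  by rewrite rise ?rise' //; lia.
have [ltxj|ltjx] := ltnP x j.
  have v1 : valid (RimL x.+1) by rewrite /=; lia.
  by apply: (swap_agree hm hm' v1); rewrite ?down ?down' ?rimLE //; lia.
have v1 : valid (RimL x.-1) by rewrite /=; lia.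
by apply: (swap_agree hm hm' v1); rewrite ?rise ?rise' ?prednK ?rimLE //; lia.
Qed.

(** * Removable edges are solitary *)

Definition unique_thin a b m :=
  [/\ vmatching m, vthin m, valid a, m a = b & unique_edge a b].

Ltac eval_override := rewrite /= ?vtx_eqE /=; split_ifs; unfold rim_mate; split_ifs;
  try done; try lia; f_equal; lia.
Ltac eval_matching :=
  unfold hub_hub, hub_V1, hub_V4, hub_Mid, hub_V2, hub_V3; eval_override.

Lemma hub_hub_good s : s <= i -> unique_thin (Hub s) (Hub s.+1) (hub_hub s).
Proof.
move=> hs; split; [exact: base_vmatching | exact: hub_hub_vthin | by rewrite /=; lia | |
  exact: hub_hub_unique].
by rewrite /hub_hub; eval_override.
Qed.

Lemma hub_V1_good s : s <= i -> unique_thin (Hub s) (V1 s) (hub_V1 s).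
Proof.
move=> hs; split; [exact: hub_V1_vmatching | exact: hub_V1_vthin | by rewrite /=; lia | |
  exact: hub_V1_unique].
by rewrite /hub_V1; eval_override.
Qed.

Lemma hub_V4_good s : s <= i -> unique_thin (Hub s) (V4 s) (hub_V4 s).
Proof.
move=> hs; split; [exact: hub_V4_vmatching | exact: hub_V4_vthin | by rewrite /=; lia | |
  exact: hub_V4_unique].
by rewrite /hub_V4; eval_override.
Qed.

Lemma V1_hub_good s : s <= i -> unique_thin (V1 s) (Hub s.+1) (V1_hub s).
Proof.
move=> hs; split; [exact: V1_hub_vmatching | exact: V1_hub_vthin | by rewrite /=; lia | |
  exact: V1_hub_unique].
by rewrite /V1_hub; eval_override.
Qed.

Lemma V4_hub_good s : s <= i -> unique_thin (V4 s) (Hub s.+1) (V4_hub s).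
Proof.
move=> hs; split; [exact: V4_hub_vmatching | exact: V4_hub_vthin | by rewrite /=; lia | |
  exact: V4_hub_unique].
by rewrite /V4_hub; eval_override.
Qed.

Lemma hub_Mid_good s : 0 < s <= i -> unique_thin (Hub s) (Mid s) (hub_Mid s).
Proof.
move=> hs; split; [exact: hub_Mid_vmatching | exact: hub_Mid_vthin | by rewrite /=; lia | |
  exact: hub_Mid_unique].
by rewrite /hub_Mid; eval_override.
Qed.

Definition hub_RimR j := if odd j then hub_RimR_odd j else hub_RimR_even j.
Definition hub_RimL j := if odd j then hub_RimL_odd j else hub_RimL_even j.

Lemma hub_RimR_good j : 0 < j < k -> unique_thin (Hub 0) (RimR j) (hub_RimR j).
Proof.
move=> hj; split; [| | by [] | | exact: hub_RimR_unique]; rewrite /hub_RimR; case: ifP => oj.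
- exact: hub_RimR_odd_vmatching.
- by apply: hub_RimR_even_vmatching; rewrite ?oj.
- exact: hub_RimR_odd_vthin.
- exact: hub_RimR_even_vthin.
- by rewrite /hub_RimR_odd; eval_override.
by rewrite /hub_RimR_even; eval_override.
Qed.

Lemma hub_RimL_good j : 0 < j < l -> unique_thin (Hub i.+1) (RimL j) (hub_RimL j).
Proof.
move=> hj; split; [| | by rewrite /= | | exact: hub_RimL_unique]; rewrite /hub_RimL; case: ifP => oj.
- exact: hub_RimL_odd_vmatching.
- by apply: hub_RimL_even_vmatching; rewrite ?oj.
- exact: hub_RimL_odd_vthin.
- exact: hub_RimL_even_vthin.
- by rewrite /hub_RimL_odd; eval_override.
by rewrite /hub_RimL_even; eval_override.
Qed.

(** These matchings serve three purposes: they show that the graph is matching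
    covered, that the cuts between levels are separating, and that an edge is
    not removable unless it determines its matching. *)
Lemma arc_in_unique_thin x y : valid x -> valid y -> varc x y ->
  exists a b m, unique_thin a b m /\ m x = y.
Proof.
case: x y => [s|s|s|s|s|s|a|a] [t|t|t|t|t|t|b|b] // hx hy e; rewrite /= in hx hy e.
- have hs : s <= i by lia.
  exists (Hub s), (Hub s.+1), (hub_hub s); split; first exact: hub_hub_good.
  by rewrite (eqP e) /hub_hub; eval_override.
- case/orP: e => /eqP->.
    exists (Hub t), (V1 t), (hub_V1 t); split; first exact: hub_V1_good.
    by rewrite /hub_V1; eval_override.
  exists (V1 t), (Hub t.+1), (V1_hub t); split; first exact: V1_hub_good.
  by rewrite /V1_hub; eval_override.
- case/orP: e => /eqP->.
    exists (V1 t), (Hub t.+1), (V1_hub t); split; first exact: V1_hub_good.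
    by rewrite /V1_hub; eval_override.
  exists (Hub t), (V1 t), (hub_V1 t); split; first exact: hub_V1_good.
  by rewrite /hub_V1; eval_override.
- case/orP: e => /eqP->.
    exists (V4 t), (Hub t.+1), (V4_hub t); split; first exact: V4_hub_good.
    by rewrite /V4_hub; eval_override.
  exists (Hub t), (V4 t), (hub_V4 t); split; first exact: hub_V4_good.
  by rewrite /hub_V4; eval_override.
- case/orP: e => /eqP->.
    exists (Hub t), (V4 t), (hub_V4 t); split; first exact: hub_V4_good.
    by rewrite /hub_V4; eval_override.
  exists (V4 t), (Hub t.+1), (V4_hub t); split; first exact: V4_hub_good.
  by rewrite /V4_hub; eval_override.
- exists (Hub s), (Mid s), (hub_Mid s); rewrite -(eqP e) in hy *.
  by split; [exact: hub_Mid_good | rewrite /hub_Mid; eval_override].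
- exists (Hub i.+1), (RimL b), (hub_RimL b); rewrite (eqP e).
  by split; [exact: hub_RimL_good | case: (hub_RimL_good hy)].
- exists (Hub 0), (RimR b), (hub_RimR b); rewrite (eqP e).
  by split; [exact: hub_RimR_good | case: (hub_RimR_good hy)].
- have hs : 0 < s.+1 <= i by lia.
  exists (Hub s.+1), (Mid s.+1), (hub_Mid s.+1); split; first exact: hub_Mid_good.
  by rewrite (eqP e) /hub_Mid; eval_override.
- exists (Hub s), (Hub s.+1), (hub_hub s); split; first exact: hub_hub_good.
  by rewrite -(eqP e) /hub_hub; eval_override.
- exists (Hub s), (Hub s.+1), (hub_hub s); split; first exact: hub_hub_good.
  by rewrite -(eqP e) /hub_hub; eval_override.
- case/orP: e => /eqP et.
    have ht : t.-1 <= i by lia.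
    exists (Hub t.-1), (Hub t.-1.+1), (hub_hub t.-1); split; first exact: hub_hub_good.
    by rewrite -et /hub_hub; eval_override.
  have ht : t <= i by lia.
  exists (Hub t), (Hub t.+1), (hub_hub t); split; first exact: hub_hub_good.
  by rewrite et /hub_hub; eval_override.
- have h2 : 0 < 2 < l by lia.
  exists (Hub i.+1), (RimL 2), (hub_RimL 2); split; first exact: hub_RimL_good.
  by case/andP: e => /eqP-> /eqP->; rewrite /hub_RimL /= /hub_RimL_even; eval_override.
- have h1 : 0 < 1 < l by lia.
  exists (Hub i.+1), (RimL 1), (hub_RimL 1); split; first exact: hub_RimL_good.
  case/andP: e => /eqP ea /eqP->; rewrite /hub_RimL /= /hub_RimL_odd.
  by rewrite -ea; eval_override.
- have [oa|ea] := boolP (odd a).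
    exists (Hub 0), (Hub 1), (hub_hub 0); split; first exact: hub_hub_good.
    by rewrite (eqP e) /hub_hub; eval_override.
  have h1 : 0 < 1 < l by lia.
  exists (Hub i.+1), (RimL 1), (hub_RimL 1); split; first exact: hub_RimL_good.
  by rewrite (eqP e) /hub_RimL /= /hub_RimL_odd; eval_override.
- have h2 : 0 < 2 < k by lia.
  exists (Hub 0), (RimR 2), (hub_RimR 2); split; first exact: hub_RimR_good.
  by case/andP: e => /eqP-> /eqP->; rewrite /hub_RimR /= /hub_RimR_even; eval_override.
- have h1 : 0 < 1 < k by lia.
  exists (Hub 0), (RimR 1), (hub_RimR 1); split; first exact: hub_RimR_good.
  case/andP: e => /eqP ea /eqP->; rewrite /hub_RimR /= /hub_RimR_odd.
  by rewrite -ea; eval_override.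
have [oa|ea] := boolP (odd a).
  exists (Hub 0), (Hub 1), (hub_hub 0); split; first exact: hub_hub_good.
  by rewrite (eqP e) /hub_hub; eval_override.
have h1 : 0 < 1 < k by lia.
exists (Hub 0), (RimR 1), (hub_RimR 1); split; first exact: hub_RimR_good.
by rewrite (eqP e) /hub_RimR /= /hub_RimR_odd; eval_override.
Qed.

Lemma edge_in_unique_thin x y : vadj x y -> exists a b m, unique_thin a b m /\ m x = y.
Proof.
case/and3P => vx vy /orP[|/(arc_in_unique_thin vy vx)[a [b [m [hm mx]]]]].
  exact: arc_in_unique_thin.
exists a, b, m; split=> //; case: hm => hm _ _ _ _.
by rewrite -mx (mateK hm).
Qed.

Lemma edge_ends (e : edge G) : exists x y, [/\ vadj x y, ends e = [set vin x; vin y]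
  & exists a b m, unique_thin a b m /\ m x = y].
Proof.
have [p [q [npq ee]]] := endsP e.
have [x vx ex] := vertexP p; have [y vy ey] := vertexP q.
have adjxy : vadj x y.
  by rewrite -adj_vin // -ex -ey; apply/existsP; exists e; rewrite ee.
exists x, y; split=> //; last exact: edge_in_unique_thin.
by rewrite ee ex ey.
Qed.

Lemma G_simple (e f : edge G) : ends e = ends f -> e = f.
Proof. exact: simple_ends_inj. Qed.

Lemma thin_matching_of_edge (e : edge G) : exists m, [/\ vmatching m, vthin m &
  exists2 x, valid x & ends e = [set vin x; to_map m (vin x)]].
Proof.
have [x [y [/and3P[vx _ _] ee [a [b [m [[hm tm _ _ _] mx]]]]]]] := edge_ends e.
by exists m; split=> //; exists x; rewrite // to_mapE // mx.
Qed.

Lemma edge_in_matching m x (e : edge G) (M : {set edge G}) : ends e = [set x; m x] ->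
  (forall x, exists2 e, e \in M & ends e = [set x; m x]) -> e \in M.
Proof. by move=> ee /(_ x)[f fM ef]; rewrite (G_simple (e := e) (f := f)) // ee ef. Qed.

Lemma hub_connect x : valid x -> connect (@adj G) (vin x) (vin (Hub 0)).
Proof.
have hubs t : t <= i.+1 -> connect (@adj G) (vin (Hub t)) (vin (Hub 0)).
  elim: t => [|t IH] ht; first exact: connect0.
  apply: connect_trans (IH (ltnW ht)); apply: connect1.
  by rewrite adj_vin /vadj //=; lia.
have via t y : t <= i.+1 -> vadj y (Hub t) ->
    connect (@adj G) (vin y) (vin (Hub 0)).
  move=> ht ay; apply: connect_trans (hubs t ht); apply: connect1.
  by rewrite adj_vin //; case/and3P: ay.
case: x => t vx; [exact: hubs | | | | | | |];
  [apply: (via t) | apply: (via t) | apply: (via t) | apply: (via t) | apply: (via t)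
  | apply: (via i.+1) | apply: (via 0)]; move: vx; rewrite /vadj /=; lia.
Qed.

Lemma G_connected : connected G.
Proof.
have sym : connect_sym (@adj G) by apply: sym_connect_sym; exact: adj_sym.
apply/forallP => p; apply/forallP => q.
have [x vx ->] := vertexP p; have [y vy ->] := vertexP q.
by apply: connect_trans (hub_connect vx) _; rewrite sym hub_connect.
Qed.

Lemma edge_of_vadj x y : vadj x y -> exists e : edge G, ends e = [set vin x; vin y].
Proof.
move=> axy; have /and3P[vx vy _] := axy.
by move: axy; rewrite -adj_vin // => /existsP[e /eqP]; exists e.
Qed.

Lemma G_matching_covered : matching_covered G.
Proof.
apply/and3P; split; first exact: G_connected.
  have [e _] : exists e : edge G, ends e = [set vin (Hub 0); vin (Hub 1)].
    by apply: edge_of_vadj; rewrite /vadj /=; lia.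
  by apply/card_gt0P; exists e.
apply/forallP => e; have [m [hm _ [x _ ee]]] := thin_matching_of_edge e.
have [M hM hMm] := perfect_map_matching (to_map_perfect hm).
by apply/existsP; exists M; rewrite hM (edge_in_matching ee hMm).
Qed.

(** A removable edge [e] is the edge that determines the matching found by
    [edge_ends]: otherwise the perfect matchings through that other edge would
    all contain [e]. *)
Lemma removable_solitary (e : edge G) : removable e -> solitary e.
Proof.
move=> rem; have [x [y [axy ee [a [b [m0 [[hm0 _ va m0a uab] m0x]]]]]]] := edge_ends e.
have /and3P[vx vy _] := axy.
have vb : valid b by rewrite -m0a (vmatching_valid hm0).
have [f ef] : exists f : edge G, ends f = [set vin a; vin b].
  by apply: edge_of_vadj; rewrite -m0a; case: (hm0 a va).
have determined M : perfect_matching M -> f \in M ->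
    forall z, exists2 g, g \in M & ends g = [set z; to_map m0 z].
  move=> hM fM; have [m hm hMm] := perfect_matching_mate hM.
  have mab : m (vin a) = vin b.
    have := perfect_matching_ends hM hMm fM (x := vin a).
    rewrite ef set21 => /(_ isT) /setP/(_ (vin b)); rewrite !inE eqxx orbT.
    have /perfect_map_pairing pm := to_map_perfect hm0.
    have := (pm (vin a)).1; rewrite to_mapE // m0a => /negbTE-> /=.
    by move/esym/eqP.
  have vm := of_map_vmatching hm.
  have eqm z : m z = to_map m0 z.
    have [w vw ->] := vertexP z; rewrite to_mapE //.
    rewrite -(uab (of_map m) m0 vm hm0) //; first by rewrite /of_map voutK.
    by rewrite /of_map mab vinK.
  by move=> z; rewrite -eqm; exact: hMm.
have [eqfe|nfe] := eqVneq f e; last first.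
  have [M hM /andP[fM /negP[]]] := removable_avoid rem nfe.
  apply: (edge_in_matching _ (determined M hM fM)); rewrite ee -m0x -to_mapE //.
have [M hM hMm] := perfect_map_matching (to_map_perfect hm0).
have eM : e \in M.
  by apply: (edge_in_matching _ hMm); rewrite ee -m0x -to_mapE.
apply/cards1P; exists M; apply/setP => M'; rewrite !inE.
apply/andP/eqP => [[hM' eM']|->//].
rewrite -eqfe in eM'; have hMm' := determined M' hM' eM'.
apply/setP => g; have [p [q [_ eg]]] := endsP g.
have pg : p \in ends g by rewrite eg set21.
apply/idP/idP => gM.
  exact: (edge_in_matching (perfect_matching_ends hM' hMm' gM pg) hMm).
exact: (edge_in_matching (perfect_matching_ends hM hMm gM pg) hMm').
Qed.

Lemma shore_below r : 0 < r <= i.+1 -> shore (below r).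
Proof.
move=> hr; apply/andP; split; apply/set0Pn.
  by exists (vin (Hub 0)); rewrite in_below //=; lia.
by exists (vin (Hub i.+1)); rewrite inE in_below //=; lia.
Qed.

Lemma separating_below r : 0 < r <= i.+1 -> separating (below r).
Proof.
move=> hr; apply: separating_of_thin; [exact: shore_below | exact: G_connected |].
move=> e; have [m [hm tm [x _ ee]]] := thin_matching_of_edge e.
have [M hM hMm] := perfect_map_matching (to_map_perfect hm).
exists M => //; split; first exact: (edge_in_matching ee hMm).
by rewrite (card_cut_mate _ hM hMm) crossing_thin //; exact: tm.
Qed.

Lemma not_thin m r : vmatching m -> 0 < r <= i.+1 ->
  r <= lev (m (V1 r.-1)) -> r <= lev (m (V4 r.-1)) ->
  #|crossing (to_map m) (below r)| != 1.
Proof.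
move=> hm hr h1 h4; apply/cards1P => -[y cr].
have v1 : valid (V1 r.-1) by rewrite /=; lia.
have v4 : valid (V4 r.-1) by rewrite /=; lia.
have inC x : valid x -> lev x < r <= lev (m x) -> vin x = y.
  move=> vx hx; apply/eqP; rewrite -in_set1 -cr inE to_mapE // !in_below //.
    by rewrite -leqNgt.
  exact: vmatching_valid.
have : vin (V1 r.-1) = vin (V4 r.-1) by rewrite !inC //= ?h1 ?h4 ?andbT; lia.
by move/(vin_inj v1 v4).
Qed.

Lemma not_tight_below : ~~ tight (below i.+1).
Proof.
apply/tightP => -[_ /(_ _ (to_map_perfect triple_top_vmatching))] /eqP.
apply/negP; apply: not_thin; [exact: triple_top_vmatching | by rewrite leqnn | |].
  by rewrite /triple_top; eval_override.
by rewrite /triple_top; eval_override.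
Qed.

Lemma G_not_bipartite : ~~ bipartite G.
Proof.
apply/negP => /existsP[X /eqP cutX].
have bi x y : vadj x y -> (vin x \in X) = (vin y \notin X).
  move=> /edge_of_vadj[e ee]; have : e \in cut X by rewrite cutX inE.
  rewrite inE ee => /andP[/set0Pn[p]] ; rewrite !inE => /andP[+ pX].
  move=> /orP[] /eqP ep /set0Pn[q]; rewrite !inE => /andP[/orP[] /eqP eq qX];
    by move: pX qX; rewrite ep eq; do 2 case: (_ \in X).
have h1 : vadj (Hub 0) (RimR 1) by rewrite /vadj /=; lia.
have h2 : vadj (Hub 0) (RimR 2) by rewrite /vadj /=; lia.
have h3 : vadj (RimR 1) (RimR 2) by rewrite /vadj /=; lia.
by have := bi _ _ h1; rewrite (bi _ _ h2) (bi _ _ h3); case: (_ \in X).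
Qed.

Implicit Types (S : {set vertex G}) (x y : vtx).

(** * Tight cuts are trivial *)

Definition thin_above t (m : vertex G -> vertex G) :=
  perfect_map m /\ forall r, t <= r <= i.+1 -> #|crossing m (below r)| = 1.

Definition crossed_once t S := forall m, thin_above t m -> #|crossing m S| = 1.

Lemma vthin_above m t : vmatching m -> vthin m -> 0 < t -> thin_above t (to_map m).
Proof.
move=> hm tm t0; split; first exact: to_map_perfect.
by move=> r hr; apply: crossing_thin; rewrite ?tm //; lia.
Qed.

Lemma other_edge S t m a b : crossed_once t S -> 0 < t -> vmatching m -> vthin m ->
  valid a -> valid b -> b != a -> b != m a ->
  (vin a \in S) != (vin (m a) \in S) -> (vin b \in S) = (vin (m b) \in S).
Proof.
move=> tS t0 hm tm va vb nba nbma aS.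
by apply: (one_crossing hm) aS nba nbma => //; apply: tS; exact: vthin_above.
Qed.

(** [wheel_sides] for the rim x, [V2], [V1], y, [Mid], [V4], [V3] at one level,
    where x and y stand for all vertices above and below.  Each of the
    first seven hypotheses comes from one perfect matching of the wheel. *)
Lemma wheel7 (zH zx z2 z1 zy zM z4 z3 : bool) :
  (zH != zx) ==> [&& z2 == z1, zM == zy & z3 == z4] ->
  (zH != z2) ==> [&& z1 == zy, zM == z4 & z3 == zx] ->
  (zH != z1) ==> [&& zM == zy, z4 == z3 & z2 == zx] ->
  (zH != zy) ==> [&& zM == z4, z3 == zx & z2 == z1] ->
  (zH != zM) ==> [&& z4 == z3, z2 == zx & z1 == zy] ->
  (zH != z4) ==> [&& z3 == zx, z2 == z1 & zM == zy] ->
  (zH != z3) ==> [&& z2 == zx, z1 == zy & zM == z4] ->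
  zx = false ->
  if zy then [&& ~~ zH, ~~ z2, ~~ z1, ~~ zM, ~~ z4 & ~~ z3] ||
             [&& zH, z2, z1, zM, z4 & z3]
  else zH + z2 + z1 + zM + z4 + z3 <= 1.
Proof.
by case: zH; case: zx => //; case: z2; case: z1; case: zy; case: zM; case: z4; case: z3.
Qed.

Section Middle.
Variables (S : {set vertex G}) (t : nat).
Hypotheses (ht : 0 < t <= i) (tS : crossed_once t S).
Variables zx zy : bool.
Hypothesis S_above : forall x, valid x -> t < lev x -> (vin x \in S) = zx.
Hypothesis S_below : forall x, valid x -> lev x < t -> (vin x \in S) = zy.

Let z x := vin x \in S.

Lemma middle_sides : zx = false ->
  if zy then [&& ~~ z (Hub t), ~~ z (V2 t), ~~ z (V1 t), ~~ z (Mid t), ~~ z (V4 t) & ~~ z (V3 t)]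
             || [&& z (Hub t), z (V2 t), z (V1 t), z (Mid t), z (V4 t) & z (V3 t)]
  else z (Hub t) + z (V2 t) + z (V1 t) + z (Mid t) + z (V4 t) + z (V3 t) <= 1.
Proof.
have t0 : 0 < t by case/andP: ht.
have hti : t <= i by case/andP: ht.
have ht1 : t.-1 <= i by clear -ht; lia.
have [vH vH0 vH1] : [/\ valid (Hub t), valid (Hub t.-1) & valid (Hub t.+1)].
  by clear -ht; split; rewrite /=; lia.
have [v1 v2 v3 v4 vM] :
    [/\ valid (V1 t), valid (V2 t), valid (V3 t), valid (V4 t) & valid (Mid t)].
  by clear -ht; split; rewrite /=; lia.
have [w1 w4] : valid (V1 t.-1) /\ valid (V4 t.-1).
  by clear -ht; split; rewrite /=; lia.
have ltt : t.-1 < t by clear -ht; lia.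
have eH1 : zx = z (Hub t.+1) by rewrite [z _]S_above //= ltnSn.
have eH0 : zy = z (Hub t.-1) by rewrite [z _]S_below.
have e1 : zy = z (V1 t.-1) by rewrite [z _]S_below.
have e4 : zy = z (V4 t.-1) by rewrite [z _]S_below.
have side m a c : vmatching m -> vthin m -> valid a -> m a = c -> z a != z c ->
    forall b d, valid b -> m b = d -> b != a -> b != c -> z b == z d.
  move=> hm tm va ma + b d vb mb nba nbc; rewrite -ma -mb => az.
  by apply/eqP/(other_edge tS t0 hm tm va vb nba _ az); rewrite ma.
have cross m c : vmatching m -> vthin m -> m (Hub t) = c -> z (Hub t) != z c ->
    forall b d, valid b -> m b = d -> b != Hub t -> b != c -> z b == z d.
  by move=> hm tm mc zc b d; apply: (side m (Hub t) c).
apply: wheel7; apply/implyP => ne.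
- have hm := base_vmatching hti; have tm := hub_hub_vthin hti.
  have e : hub_hub t (Hub t) = Hub t.+1 by clear -ht; eval_matching.
  rewrite eH1 in ne; have sd := cross _ _ hm tm e ne; apply/and3P; split.
  + by apply: sd => //; clear -ht; eval_matching.
  + by rewrite e4; apply: sd => //; clear -ht; eval_matching.
  + by apply: sd => //; clear -ht; eval_matching.
- have hm := hub_V2_vmatching ht; have tm := hub_V2_vthin ht.
  have e : hub_V2 t (Hub t) = V2 t by clear -ht; eval_matching.
  have sd := cross _ _ hm tm e ne; apply/and3P; split.
  + by rewrite e1; apply: sd => //; clear -ht; eval_matching.
  + by apply: sd => //; clear -ht; eval_matching.
  + by rewrite eH1; apply: sd => //; clear -ht; eval_matching.
- have hm := hub_V1_vmatching hti; have tm := hub_V1_vthin hti.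
  have e : hub_V1 t (Hub t) = V1 t by clear -ht; eval_matching.
  have sd := cross _ _ hm tm e ne; apply/and3P; split.
  + by rewrite e4; apply: sd => //; clear -ht; eval_matching.
  + by apply: sd => //; clear -ht; eval_matching.
  + by rewrite eH1; apply: sd => //; clear -ht; eval_matching.
- have hm := base_vmatching ht1; have tm := hub_hub_vthin ht1.
  have e : hub_hub t.-1 (Hub t) = Hub t.-1 by clear -ht; eval_matching.
  rewrite eH0 in ne; have sd := cross _ _ hm tm e ne; apply/and3P; split.
  + by apply: sd => //; clear -ht; eval_matching.
  + by rewrite eH1; apply: sd => //; clear -ht; eval_matching.
  + by apply: sd => //; clear -ht; eval_matching.
- have hm := hub_Mid_vmatching ht; have tm := hub_Mid_vthin ht.
  have e : hub_Mid t (Hub t) = Mid t by clear -ht; eval_matching.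
  have sd := cross _ _ hm tm e ne; apply/and3P; split.
  + by apply: sd => //; clear -ht; eval_matching.
  + by rewrite eH1; apply: sd => //; clear -ht; eval_matching.
  + by rewrite e1; apply: sd => //; clear -ht; eval_matching.
- have hm := hub_V4_vmatching hti; have tm := hub_V4_vthin hti.
  have e : hub_V4 t (Hub t) = V4 t by clear -ht; eval_matching.
  have sd := cross _ _ hm tm e ne; apply/and3P; split.
  + by rewrite eH1; apply: sd => //; clear -ht; eval_matching.
  + by apply: sd => //; clear -ht; eval_matching.
  + by rewrite e4; apply: sd => //; clear -ht; eval_matching.
have hm := hub_V3_vmatching ht; have tm := hub_V3_vthin ht.
have e : hub_V3 t (Hub t) = V3 t by clear -ht; eval_matching.
have sd := cross _ _ hm tm e ne; apply/and3P; split.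
+ by rewrite eH1; apply: sd => //; clear -ht; eval_matching.
+ by rewrite e1; apply: sd => //; clear -ht; eval_matching.
+ by apply: sd => //; clear -ht; eval_matching.
Qed.

End Middle.

Lemma crossed_once_pick t S : 0 < t -> crossed_once t S ->
  exists2 x, valid x & vin x \in S.
Proof.
move=> t0 tS; have hm := base_vmatching (leq0n i).
have := tS _ (vthin_above hm (hub_hub_vthin (leq0n i)) t0).
move/eqP; rewrite eqn_leq => /andP[_ /card_gt0P[p]]; rewrite inE => /andP[pS _].
by have [x vx ep] := vertexP p; exists x; rewrite // -ep.
Qed.

Lemma middle_full S t : 0 < t <= i -> below t \subset S -> S \subset below t.+1 ->
  crossed_once t S -> S = below t \/ S = below t.+1.
Proof.
move=> ht /subsetP sYS /subsetP sSY tS.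
have up x : valid x -> t < lev x -> (vin x \in S) = false.
  move=> vx lx; apply/negP => /sSY; rewrite in_below //; clear -lx; lia.
have dn x : valid x -> lev x < t -> (vin x \in S) = true.
  by move=> vx lx; apply: sYS; rewrite in_below.
have /= sides := middle_sides ht tS up dn (erefl _).
case/orP: sides => /and5P[zH z2 z1 zM /andP[z4 z3]]; [left|right]; apply/setP => p;
  have [x vx ->] := vertexP p; rewrite in_below //;
  (have [lt|gt|eqx] := ltngtP (lev x) t);
  rewrite ?(up _ vx gt) ?(dn _ vx lt) ?eqx ?ltnn ?ltnSn //; try (clear -lt; lia);
  try (clear -gt; lia).
  move: vx eqx; case: x => u vx /= eqx; try (clear -eqx vx ht; rewrite /= in vx; lia);
    by rewrite eqx; apply/negbTE.
move: vx eqx; case: x => u vx /= eqx; try (clear -eqx vx ht; rewrite /= in vx; lia);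
  by rewrite eqx.
Qed.

Lemma middle_single S t : 0 < t <= i -> S \subset below t.+1 :\: below t ->
  crossed_once t S -> #|S| = 1.
Proof.
move=> ht /subsetP sSD tS.
have levS x : valid x -> vin x \in S -> lev x = t.
  by move=> vx /sSD; rewrite inE !in_below //; clear; lia.
have up x : valid x -> t < lev x -> (vin x \in S) = false.
  by move=> vx lx; apply/negP => /(levS x vx) e; rewrite e ltnn in lx.
have dn x : valid x -> lev x < t -> (vin x \in S) = false.
  by move=> vx lx; apply/negP => /(levS x vx) e; rewrite e ltnn in lx.
have /= sides := middle_sides ht tS up dn (erefl _).
have [x vx xS] := crossed_once_pick (proj1 (andP ht)) tS.
apply/eqP/cards1P; exists (vin x); apply/setP => p; rewrite inE.
have [y vy ->] := vertexP p; apply/idP/eqP => [yS|->//]; congr vin.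
have := levS x vx xS; have := levS y vy yS.
move: sides vx vy xS yS; clear -ht.
by case: x => u; case: y => w /= sides vx vy xS yS ew eu;
  try (exfalso; clear -ew eu ht; lia); subst; try done;
  rewrite xS yS in sides; exfalso; clear -sides; lia.
Qed.

(** The bottom wheel: hub [Hub 0] and rim
    [Hub 1, V2 0, V1 0, RimR 1, ..., RimR k.-1, V4 0, V3 0], where [Hub 1] stands for
    all vertices above level 0. *)

Definition bottom_rim a :=
  match a with
  | 0 => Hub 1
  | 1 => V2 0
  | b.+2 => if b == k.+1 then V3 0 else rimR b
  end.

Definition bottom_matching j :=
  match j with
  | 0 => hub_hub 0
  | 1 => hub_V2_bottom
  | 2 => hub_V1 0
  | b.+2 => if b == k then hub_V4 0 else if b == k.+1 then hub_V3_bottom else hub_RimR b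
  end.

Lemma bottom_matching_thin j : j < k.+4 ->
  [/\ vmatching (bottom_matching j), vthin (bottom_matching j),
      bottom_matching j (Hub 0) = bottom_rim j & valid (bottom_rim j)].
Proof.
case: j => [|[|[|b]]] hj /=.
- by split; [exact: base_vmatching | exact: hub_hub_vthin | eval_matching | rewrite /=; lia].
- by split; [exact: hub_V2_bottom_vmatching | exact: hub_V2_bottom_vthin
    | unfold hub_V2_bottom; eval_override |].
- by split; [exact: hub_V1_vmatching | exact: hub_V1_vthin | eval_matching |].
rewrite /rimR /=; case: eqP => [ebk|/eqP nbk].
  rewrite ifF; last by lia.
  by split; [exact: hub_V4_vmatching | exact: hub_V4_vthin | eval_matching |].
case: eqP => [ebk|/eqP nbk1].
  by split; [exact: hub_V3_bottom_vmatching | exact: hub_V3_bottom_vthin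
    | unfold hub_V3_bottom; eval_override |].
have hb : 0 < b.+1 < k by lia.
by have [vm tm _ e _] := hub_RimR_good hb; split.
Qed.

Ltac eval_bottom :=
  let hj := fresh "hj" in let par := fresh "par" in
  case=> [|[|[|c]]] hj par; rewrite [bottom_matching _]/=;
  [ try (exfalso; lia); eval_matching
  | try (exfalso; lia); unfold hub_V2_bottom; eval_override
  | try (exfalso; lia); eval_matching
  | case: eqP => ?;
    [ try (exfalso; lia); eval_matching
    | case: eqP => ?;
      [ try (exfalso; lia); unfold hub_V3_bottom; eval_override
      | unfold hub_RimR; case: ifP => ?;
        [ try (exfalso; lia); unfold hub_RimR_odd; eval_override
        | try (exfalso; lia); unfold hub_RimR_even; eval_override ] ] ] ].

Lemma bottom_matching_rim j a : j < k.+4 -> a < k.+4 ->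
  (j < a) && odd (a - j) || (a < j) && ~~ odd (j - a) ->
  bottom_matching j (bottom_rim a) = bottom_rim (if a.+1 == k.+4 then 0 else a.+1).
Proof.
move=> hj ha par.
have nextE : 1 < a -> bottom_rim (if a.+1 == k.+4 then 0 else a.+1) =
    if a == k.+3 then Hub 1 else if a == k.+2 then V3 0 else rimR a.-1.
  by case: (a) => [|[|b]] //= _; rewrite !eqSS; case: eqP => //= _; rewrite eqSS.
case: a ha par nextE => [|[|b]] ha par nextE.
- by move: {nextE ha} j hj par; eval_bottom.
- by rewrite [in RHS]/=; move: {nextE ha} j hj par; eval_bottom.
rewrite nextE // {nextE} /= /rimR /=.
by split_ifs; try (exfalso; lia); move: j hj par; eval_bottom.
Qed.

Lemma bottom_rim_inj a b : a < k.+4 -> b < k.+4 ->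
  bottom_rim a = bottom_rim b -> a = b.
Proof.
case: a => [|[|a]]; case: b => [|[|b]] ha hb //=; rewrite /rimR;
  split_ifs => //; try lia; case; lia.
Qed.

Lemma bottom_rim_cover x : valid x -> lev x = 0 -> x != Hub 0 ->
  exists2 a, 0 < a < k.+4 & x = bottom_rim a.
Proof.
have at_rim b : b <= k -> exists2 a, 0 < a < k.+4 & rimR b = bottom_rim a.
  by move=> hb; exists b.+2; [lia | rewrite /= ifF //; lia].
case: x => t //= vx t0; rewrite ?vtx_eqE; rewrite ?t0 // => _.
- by have [|a ha ea] := at_rim 0; last by exists a; rewrite // -ea.
- by exists 1.
- by exists k.+3; rewrite //= eqxx.
- have [|a ha ea] := at_rim k; first by [].
  by exists a; rewrite // -ea /rimR; split_ifs => //; lia.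
- by lia.
have [|a ha ea] := at_rim t; first by lia.
by exists a; rewrite // -ea rimRE.
Qed.

Lemma bottom_trivial S : S \subset below 1 -> crossed_once 1 S ->
  #|S| = 1 \/ S = below 1.
Proof.
move=> /subsetP sS tS; pose z x := vin x \in S.
pose z' a := z (bottom_rim a) != z (Hub 0).
have vrim a : a < k.+4 -> valid (bottom_rim a) by case/bottom_matching_thin.
have rimH a : a < k.+4 -> bottom_rim a != Hub 0.
  by case: a => [|[|a]] //= _; rewrite /rimR; split_ifs.
have out x : valid x -> lev x != 0 -> z x = false.
  by move=> vx lx; apply/negP => /sS; rewrite in_below // ltnS leqn0 (negbTE lx).
have [x0 vx0 zx0] := crossed_once_pick (isT : 0 < 1) tS.
have lx0 : lev x0 = 0 by apply/eqP; apply: contraTT zx0 => /(out x0 vx0); rewrite /z => ->.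
have z0 : z (Hub 1) = false by apply: out => //=; lia.
have inS p x : valid x -> p = vin x -> (p \in S) = z x by move=> _ ->.
have [] := @wheel_sides k.+4 z'.
- by rewrite /= !negbK.
- move=> j a hj ha zj naj o1 o2.
  have [vm tm mH vj] := bottom_matching_thin hj.
  have par : (j < a) && odd (a - j) || (a < j) && ~~ odd (j - a).
    by move: naj o1 o2; case: (ltngtP a j) => //= _ _ o1 o2; rewrite ?orbF ?o1 ?o2.
  rewrite /z' -(bottom_matching_rim hj ha par); congr (_ != _).
  apply: (other_edge tS isT vm tm (a := Hub 0)); rewrite ?mH ?vrim ?rimH //.
    by apply: contra_neq naj => /(bottom_rim_inj ha hj).
  by rewrite eq_sym.
- move=> all; case zH : (z (Hub 0)).
    left; apply/eqP/cards1P; exists (vin (Hub 0)); apply/setP => p; rewrite inE.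
    have [x vx ->] := vertexP p; apply/idP/eqP => [xS|->//]; congr vin.
    apply/eqP; apply: contraT => nx; have lx : lev x = 0.
      by apply/eqP; apply: contraTT xS => /(out x vx); rewrite /z => ->.
    have [a ha ex] := bottom_rim_cover vx lx nx.
    have := all a; rewrite /z' zH -ex /z xS => /(_ _)/negP[] //; lia.
  by have := all 0 isT; rewrite /z' zH /= z0.
- move=> none; have zH : z (Hub 0) = false.
    by have := none 0 isT; rewrite /z' /= z0; case: (z _).
  have nx0 : x0 != Hub 0 by apply: contraTneq zx0 => ->; rewrite -/(z _) zH.
  have [a ha ex] := bottom_rim_cover vx0 lx0 nx0.
  by have := none a; rewrite /z' zH -ex /z zx0 => /(_ _)/negP[] //; lia.
case=> j hj one; case zH : (z (Hub 0)).
  have ej : j = 0.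
    by have := one 0 isT; rewrite /z' zH /= z0 => /esym/eqP.
  right; apply/setP => p; have [x vx ->] := vertexP p; rewrite in_below // ltnS leqn0.
  case: eqP => [lx|/eqP lx]; last exact: out.
  have [->//|nx] := eqVneq x (Hub 0).
  have [a ha ex] := bottom_rim_cover vx lx nx.
  have := one a; rewrite /z' zH ej -ex -/(z x); case: (z x) => //= h.
  by have := h (proj2 (andP ha)) => /esym/eqP; lia.
left; apply/eqP/cards1P; exists (vin (bottom_rim j)); apply/setP => p; rewrite inE.
have [x vx ->] := vertexP p; apply/idP/eqP => [xS|->].
  have nx : x != Hub 0 by apply: contraTneq xS => ->; rewrite -/(z _) zH.
  have lx : lev x = 0.
    by apply/eqP; apply: contraTT xS => /(out x vx); rewrite /z => ->.
  have [a /andP[_ ha] ex] := bottom_rim_cover vx lx nx.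
  by have := one a ha; rewrite /z' zH -ex /z xS => /esym/eqP <-; rewrite -ex.
by have := one j hj; rewrite /z' zH eqxx -/(z _); case: (z _).
Qed.

(** The top wheel: hub [Hub i.+1] and rim [V1 i, RimL 1, ..., RimL l.-1], where
    [V1 i], or [V4 i], stands for all vertices below level [i.+1]. *)

Definition top_matching j := if j == 0 then hub_hub i else hub_RimL j.

Lemma top_matching_thin j : j < l ->
  [/\ vmatching (top_matching j), vthin (top_matching j) &
      top_matching j (Hub i.+1) = if j == 0 then Hub i else RimL j].
Proof.
move=> hj; rewrite /top_matching; case: eqP => [_|/eqP j0].
  by split; [exact: base_vmatching | exact: hub_hub_vthin | eval_matching].
have hj' : 0 < j < l by lia.
by have [vm tm _ e _] := hub_RimL_good hj'.
Qed.

Lemma top_matching_rim j a : j < l -> a < l ->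
  (j < a) && odd (a - j) || (a < j) && ~~ odd (j - a) ->
  top_matching j (rimL a) = rimL a.+1.
Proof.
move=> hj ha par; rewrite /rimL /top_matching; case: eqP => [j0|/eqP j0].
  by split_ifs; try (exfalso; lia); eval_matching.
by rewrite /hub_RimL; case: ifP => oj; split_ifs; try (exfalso; lia);
  unfold hub_RimL_odd, hub_RimL_even; eval_override.
Qed.

Section Top.
Variables (S : {set vertex G}) (zy : bool).
Hypotheses (tS : crossed_once i.+1 S).
Hypothesis S_below : forall x, valid x -> lev x < i.+1 -> (vin x \in S) = zy.

Lemma top_sides (z' := fun a => (if a == 0 then zy else vin (RimL a) \in S)
    != (vin (Hub i.+1) \in S)) :
  [\/ forall a, a < l -> z' a, forall a, a < l -> ~~ z' a |
      exists2 j, j < l & forall a, a < l -> z' a = (a == j)].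
Proof.
have vH : valid (Hub i.+1) by exact: leqnn.
have eH : (vin (Hub i) \in S) = zy by apply: S_below; rewrite /= ?ltnSn ?leqnSn.
have e1 : (vin (V1 i) \in S) = zy by apply: S_below; rewrite /= ?ltnSn.
have e4 : (vin (V4 i) \in S) = zy by apply: S_below; rewrite /= ?ltnSn.
have zrim a : a <= l -> (vin (rimL a) \in S) =
    (if (if a == l then 0 else a) == 0 then zy else vin (RimL (if a == l then 0 else a)) \in S).
  rewrite /rimL => ha; case: (a =P 0) => [->|/eqP a0]; first by rewrite e1; case: (0 == l).
  by case: (a =P l) => //= _; rewrite (negbTE a0).
have vrim a : a < l -> valid (rimL a).
  by rewrite /rimL => ha; split_ifs => //=; lia.
apply: wheel_sides => // j a hj ha zj naj o1 o2.
have [vm tm mH] := top_matching_thin hj.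
have par : (j < a) && odd (a - j) || (a < j) && ~~ odd (j - a).
  by move: naj o1 o2; case: (ltngtP a j) => //= _ _ o1 o2; rewrite ?orbF ?o1 ?o2.
rewrite /z'; congr (_ != _).
have -> : (if a == 0 then zy else vin (RimL a) \in S) = (vin (rimL a) \in S).
  by rewrite zrim ?(ltnW ha) // (ltn_eqF ha).
rewrite -zrim // -(top_matching_rim hj ha par).
apply: (other_edge tS _ vm tm vH) => //; first exact: vrim.
- by rewrite /rimL; split_ifs.
- rewrite mH /rimL; split_ifs => //; rewrite vtx_eqE //=; move: naj; lia.
rewrite mH eq_sym; move: zj; rewrite /z'.
by case: ifP => // _; rewrite eH.
Qed.

End Top.

(** The vertex set minus one vertex closes the chain of levels: a tight set or
    its complement avoids [spare], so that the last step has the form of the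
    others. *)
Definition spare : vertex G := vin (RimL 2).

Lemma valid_spare : valid (RimL 2). Proof. by rewrite /=; lia. Qed.

Lemma below_spare : below i.+1 \subset ~: [set spare].
Proof.
apply/subsetP => p; have [x vx ->] := vertexP p; rewrite in_below // !inE.
by move=> lx; apply/eqP => /(vin_inj vx valid_spare) ex; rewrite ex ltnn in lx.
Qed.

Lemma top_vertex x : valid x -> ~~ (lev x < i.+1) ->
  x = Hub i.+1 \/ exists2 j, 0 < j < l & x = RimL j.
Proof.
case: x => t vx /= lx; rewrite /= in vx; try (exfalso; lia).
  by left; congr Hub; lia.
by right; exists t.
Qed.

Lemma top_full S : below i.+1 \subset S -> S \subset ~: [set spare] ->
  crossed_once i.+1 S -> S = below i.+1 \/ S = ~: [set spare].
Proof.
move=> /subsetP sYS /subsetP sSY tS.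
have dn x : valid x -> lev x < i.+1 -> (vin x \in S) = true.
  by move=> vx lx; apply: sYS; rewrite in_below.
have nspare : (spare \in S) = false.
  by apply/negP => /sSY; rewrite !inE eqxx.
have l0 : 0 < l by lia.
have l2 : 2 < l by lia.
have spareE x : valid x -> (vin x == spare) = (x == RimL 2).
  by move=> vx; apply/eqP/eqP => [/(vin_inj vx valid_spare)|->].
have /= [all|none|[j hj one]] := top_sides tS dn.
- case zH : (vin (Hub i.+1) \in S) (all 0 l0) (all 2 l2) => //=.
  by rewrite -/spare nspare.
- case zH : (vin (Hub i.+1) \in S) (none 0 l0) (none 2 l2) => //=.
  by rewrite -/spare nspare.
case zH : (vin (Hub i.+1) \in S) one => one.
  right; have ej : 2 = j.
    by apply/eqP; rewrite -one //= -/spare nspare.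
  apply/setP => p; have [x vx ->] := vertexP p; rewrite !inE spareE //.
  have [lx|lx] := boolP (lev x < i.+1).
    by rewrite dn //; apply/esym; apply: contraTneq lx => ->; rewrite /= ltnn.
  have [->|[a ha ->]] := top_vertex vx lx; first by rewrite zH.
  have := one a (proj2 (andP ha)); rewrite -ej -[RimL a == RimL 2]/(a == 2).
  rewrite (gtn_eqF (proj1 (andP ha))).
  by case: (_ \in S); case: (a == 2).
left; have ej : 0 = j by apply/eqP; rewrite -one.
apply/setP => p; have [x vx ->] := vertexP p; rewrite in_below //.
have [lx|lx] := boolP (lev x < i.+1); first by rewrite dn.
have [->|[a ha ->]] := top_vertex vx lx; first by rewrite zH.
have := one a (proj2 (andP ha)); rewrite -ej.
rewrite (gtn_eqF (proj1 (andP ha))).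
by case: (_ \in S).
Qed.

Lemma top_single S : S \subset ~: [set spare] :\: below i.+1 ->
  crossed_once i.+1 S -> #|S| = 1.
Proof.
move=> /subsetP sS tS.
have dn x : valid x -> lev x < i.+1 -> (vin x \in S) = false.
  by move=> vx lx; apply/negP => /sS; rewrite inE in_below // lx.
have nspare : (spare \in S) = false.
  by apply/negP => /sS; rewrite !inE eqxx andbF.
have l0 : 0 < l by lia.
have l2 : 2 < l by lia.
have [x0 vx0 zx0] := crossed_once_pick (isT : 0 < i.+1) tS.
have notlow x : valid x -> vin x \in S -> ~~ (lev x < i.+1).
  by move=> vx xS; apply/negP => /(dn x vx); rewrite xS.
have /= [all|none|[j hj one]] := top_sides tS dn.
- have zH : vin (Hub i.+1) \in S by move: (all 0 l0) => /=; case: (_ \in S).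
  apply/eqP/cards1P; exists (vin (Hub i.+1)); apply/setP => p; rewrite inE.
  have [x vx ->] := vertexP p; apply/idP/eqP => [xS|->//]; congr vin.
  have [//|[a ha ex]] := top_vertex vx (notlow x vx xS).
  have := all a (proj2 (andP ha)); rewrite zH -ex xS.
  by rewrite (gtn_eqF (proj1 (andP ha))).
- have zH : (vin (Hub i.+1) \in S) = false.
    by move: (none 0 l0) => /=; case: (_ \in S).
  have [ex|[a ha ex]] := top_vertex vx0 (notlow x0 vx0 zx0).
    by rewrite -ex zx0 in zH.
  have := none a (proj2 (andP ha)); rewrite zH -ex zx0.
  by rewrite (gtn_eqF (proj1 (andP ha))).
have zH : (vin (Hub i.+1) \in S) = false.
  apply/negP => zH; have := one 0 l0; have := one 2 l2.
  rewrite /= zH -/spare nspare /= => /esym/eqP <- //.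
apply/eqP/cards1P; exists (vin x0); apply/setP => p; rewrite inE.
have [x vx ->] := vertexP p; apply/idP/eqP => [xS|->//]; congr vin.
have isj y : valid y -> vin y \in S -> y = RimL j.
  move=> vy yS; have [ey|[a ha ey]] := top_vertex vy (notlow y vy yS).
    by rewrite ey zH in yS.
  have := one a (proj2 (andP ha)); rewrite zH -ey yS.
  rewrite (gtn_eqF (proj1 (andP ha))).
  by move=> /esym/eqP <-.
by rewrite (isj x vx xS) (isj x0 vx0 zx0).
Qed.

Lemma vin_uniq3 x y z : valid x -> valid y -> valid z -> uniq [:: x; y; z] ->
  uniq [:: vin x; vin y; vin z].
Proof.
move=> vx vy vz; rewrite /= !inE !negb_or => /and3P[/andP[nxy nxz] nyz _].
have inj u v : valid u -> valid v -> u != v -> vin u != vin v.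
  by move=> vu vv; apply: contra_neq; exact: vin_inj.
by rewrite (inj _ _ vx vy nxy) (inj _ _ vx vz nxz) (inj _ _ vy vz nyz).
Qed.

(** The sets below level [t] form the chain along which tight sets are bounded:
    contracting everything below level [t] and everything above it leaves a
    graph with a spanning odd wheel around [Hub t]. *)
Lemma crossed_once_below t S : 0 < t <= i.+1 -> S \subset below t ->
  crossed_once t S -> #|S| = 1 \/ S = below t.
Proof.
elim: t S => // t IH S ht; have [->|t0] := posnP t; first exact: bottom_trivial.
have hti : t <= i by case/andP: ht.
have ht' : 0 < t <= i by rewrite t0.
have [ht1 htr] : t.-1 <= i /\ 0 < t <= i.+1 by clear -ht'; lia.
have [v1 v4 vH] : [/\ valid (V1 t.-1), valid (V4 t.-1) & valid (Hub t.-1)].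
  by clear -ht'; rewrite /=; split; lia.
have [w1 wM wH] : [/\ valid (V1 t), valid (Mid t) & valid (Hub t)].
  by clear -ht'; rewrite /=; split; lia.
have e1 : hub_Mid t (V1 t.-1) = V1 t by clear -ht'; eval_matching.
have e4 : hub_hub t (V4 t.-1) = Mid t by clear -ht'; eval_matching.
have eH : hub_hub t.-1 (Hub t.-1) = Hub t by clear -ht'; eval_matching.
have up1 : t <= lev (triple t (V1 t.-1)).
  by clear -ht'; unfold triple; eval_override.
have up4 : t <= lev (triple t (V4 t.-1)).
  by clear -ht'; unfold triple; eval_override.
have back m : thin_above t m -> thin_above t.+1 m /\ #|crossing m (below t)| = 1.
  case=> pm cm; split; last by apply: cm; rewrite leqnn; case/andP: htr.
  by split=> // r /andP[tr ri]; apply: cm; rewrite ri ltnW.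
have join m : vmatching m -> vthin m ->
    thin_above t.+1 (to_map m) /\ #|crossing (to_map m) (below t)| = 1.
  by move=> vm tm; apply: back; exact: vthin_above.
have vlow x : lev x < t -> valid x -> vin x \in below t by move=> ? ?; rewrite in_below.
have vmid x : lev x = t -> valid x -> vin x \in below t.+1 :\: below t.
  by move=> e vx; rewrite inE !in_below // e ltnn ltnSn.
have lt1 : t.-1 < t by rewrite prednK.
apply: (chain_step (Y := below t)).
- by move=> m [/perfect_map_pairing].
- by apply/subsetP => p; rewrite !inE => /ltnW; rewrite ltnS.
- exists (to_map (triple t)).
    split; first exact/to_map_perfect/triple_vmatching.
    move=> r /andP[tr ri]; have r0 : 0 < r <= i.+1 by rewrite ri (ltn_trans t0 tr).
    apply: crossing_thin => //; first exact: triple_vmatching.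
    by apply: triple_vthin; rewrite // tr.
  by apply: not_thin => //; exact: triple_vmatching.
- by move=> S' sS' tS'; apply: IH => // m /back; exact: tS'.
- by move=> S' s1 s2 tS'; apply: middle_full => // m /back; exact: tS'.
- by move=> S' s1 tS'; apply: middle_single s1 _ => // m /back; exact: tS'.
exists (vin (V1 t.-1)), (vin (V4 t.-1)), (vin (Hub t.-1)),
  (vin (V1 t)), (vin (Mid t)), (vin (Hub t)); split.
- exact: vin_uniq3.
- exact: vin_uniq3.
- by rewrite !vlow.
- by rewrite !vmid // in_below //= ltnn.
split.
- exists (to_map (hub_Mid t)); last by rewrite to_mapE // e1.
  by apply: join; [exact: hub_Mid_vmatching | exact: hub_Mid_vthin].
- exists (to_map (hub_hub t)); last by rewrite to_mapE // e4.
  by apply: join; [exact: base_vmatching | exact: hub_hub_vthin].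
exists (to_map (hub_hub t.-1)); last by rewrite to_mapE // eH.
by apply: join; [exact: base_vmatching | exact: hub_hub_vthin].
Qed.

Lemma tight_spare S : S \subset ~: [set spare] ->
  (forall m, perfect_map m -> #|crossing m S| = 1) -> #|S| = 1 \/ S = ~: [set spare].
Proof.
have hi : 0 < i.+1 <= i.+1 by rewrite leqnn.
have l1 : 0 < 1 < l by lia.
have l2 : 0 < 2 < l by lia.
have join m : vmatching m -> vthin m ->
    perfect_map (to_map m) /\ #|crossing (to_map m) (below i.+1)| = 1.
  by move=> vm tm; split; [exact: to_map_perfect | apply: crossing_thin => //; exact: tm].
have back m : thin_above i.+1 m -> perfect_map m /\ #|crossing m (below i.+1)| = 1.
  by case=> pm cm; split=> //; apply: cm; rewrite leqnn.
have vlow x : lev x < i.+1 -> valid x -> vin x \in below i.+1.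
  by move=> ? ?; rewrite in_below.
have [v1 v4 vH] : [/\ valid (V1 i), valid (V4 i) & valid (Hub i)].
  by rewrite /=; split; lia.
have [w1 wM wH] : [/\ valid (RimL 1), valid (RimL l.-1) & valid (Hub i.+1)].
  by rewrite /=; split; lia.
have vtop j : 0 < j < l -> j != 2 -> vin (RimL j) \in ~: [set spare] :\: below i.+1.
  move=> hj nj; rewrite !inE vinK //= ltnn /=; apply: contra_neq nj.
  by move=> e; have [] := vin_inj (x := RimL j) hj valid_spare e.
move=> sS tS; apply: (chain_step (Ms := @perfect_map G) (Y := below i.+1)) sS tS.
- by move=> m /perfect_map_pairing.
- exact: below_spare.
- exists (to_map triple_top); first exact/to_map_perfect/triple_top_vmatching.
  apply: not_thin => //; first exact: triple_top_vmatching.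
    by unfold triple_top; eval_override.
  by unfold triple_top; eval_override.
- by move=> S' sS' tS'; apply: crossed_once_below => // m /back; exact: tS'.
- by move=> S' s1 s2 tS'; apply: top_full => // m /back; exact: tS'.
- by move=> S' s1 tS'; apply: top_single s1 _ => m /back; exact: tS'.
exists (vin (V1 i)), (vin (V4 i)), (vin (Hub i)),
  (vin (RimL 1)), (vin (RimL l.-1)), (vin (Hub i.+1)); split.
- exact: vin_uniq3.
- by apply: vin_uniq3 => //; rewrite /= !inE !vtx_eqE /=; lia.
- by rewrite !vlow //= ltnSn.
- by rewrite !vtop ?in_below //= ?ltnn //; lia.
split.
- exists (to_map (hub_RimL 2)).
    by have [vm tm _ _ _] := hub_RimL_good l2; exact: join.
  by rewrite to_mapE //; congr vin; rewrite /hub_RimL /=; unfold hub_RimL_even; eval_override.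
- exists (to_map (hub_RimL 1)).
    by have [vm tm _ _ _] := hub_RimL_good l1; exact: join.
  by rewrite to_mapE //; congr vin; rewrite /hub_RimL /=; unfold hub_RimL_odd; eval_override.
exists (to_map (hub_hub i)).
  by apply: join; [exact: base_vmatching | exact: hub_hub_vthin].
by rewrite to_mapE //; congr vin; eval_matching.
Qed.

Lemma G_brick : brick G.
Proof.
apply/and3P; split; [exact: G_not_bipartite | exact: G_matching_covered |].
apply/forallP => X; apply/implyP => /tightP[_ tX]; rewrite /trivial_cut.
have [spX|spX] := boolP (spare \in X).
  have sub : ~: X \subset ~: [set spare] by rewrite setCS sub1set.
  case: (tight_spare sub) => [m hm|->|e]; last 2 first.
  - by rewrite orbT.
  - by rewrite -[X]setCK e setCK cards1.
  by rewrite crossingC ?tX //; exact: perfect_map_pairing.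
have sub : X \subset ~: [set spare] by rewrite subsetC sub1set inE.
by case: (tight_spare sub tX) => [->|->]; rewrite // setCK cards1 orbT.
Qed.

Lemma G_nonsolid_brick : nonsolid_brick G.
Proof.
rewrite /nonsolid_brick G_brick /=; apply/forallPn; exists (below i.+1).
by rewrite separating_below ?not_tight_below // leqnn.
Qed.

(** * No triangle can come from a splicing with K_4 *)

Definition two_separated (T : seq vtx) : Prop :=
  exists (C : pred vtx) (w : vtx),
  [/\ [/\ valid w, w \notin T & ~~ C w],
      exists2 c, valid c & C c,
      forall c, C c -> c \notin T,
      forall c d, C c -> vadj c d -> [|| C d, d \in T | d == w] &
      exists d1 d2, [/\ valid d1, valid d2, d1 != d2,
        [&& ~~ C d1, d1 \notin T & d1 != w] & [&& ~~ C d2, d2 \notin T & d2 != w]]].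

Lemma two_separated_perm T T' : T =i T' -> two_separated T -> two_separated T'.
Proof.
move=> eT [C [w [[vw wT Cw] c0 CT CN [d1 [d2 [vd1 vd2 nd h1 h2]]]]]].
exists C, w; split; rewrite -?eT //.
- by move=> c; rewrite -eT; exact: CT.
- by move=> c d; rewrite -eT; exact: CN.
by exists d1, d2; rewrite -!eT.
Qed.

(** Most triangles cut off a single vertex [q], and leave at least two vertices
    on the other side since the graph has at least seven. *)
Lemma two_separated_single T q w : size T = 3 -> valid q -> valid w -> q \notin T ->
  w \notin T -> w != q -> (forall d, vadj q d -> (d \in T) || (d == w)) ->
  two_separated T.
Proof.
move=> sT vq vw qT wT nwq nbr; exists (pred1 q), w; split.
- by rewrite /= vw wT.
- by exists q => /=.
- by move=> c /eqP->.
- by move=> c d /eqP-> /nbr ->; rewrite orbT.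
pose F := q :: w :: T.
pose L := [:: RimR 1; RimR 2; RimR 3; RimR 4; RimL 1; RimL 2; RimL 3].
have uL : uniq L by [].
have vL : all valid L by rewrite /=; lia.
have sF : size (filter (mem F) L) <= size F.
  apply: uniq_leq_size; first exact: filter_uniq.
  by move=> x; rewrite mem_filter => /andP[].
have := count_predC (mem F) L; rewrite -!size_filter.
have : size F = 5 by rewrite /= sT.
move: sF; set A := filter (mem F) L; set B := filter _ L => sA sF sAB.
have uB : uniq B by exact: filter_uniq.
have inB x : x \in B -> valid x /\ [&& x != q, x \notin T & x != w].
  rewrite mem_filter => /andP[+ /(allP vL)]; rewrite /= !inE !negb_or.
  by case/and3P => -> -> ->.
case: B sAB uB inB => [|d1 [|d2 B]] sAB uB inB.
- by move: sAB; rewrite /= addn0 => e; rewrite e sF in sA.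
- by move: sAB; rewrite /= addn1 => -[e]; rewrite e sF in sA.
have [v1 n1] := inB d1 (mem_head _ _).
have [|v2 n2] := inB d2; first by rewrite !inE eqxx orbT.
exists d1, d2; split=> //; move: uB; rewrite /= inE negb_or.
by case/andP => /andP[].
Qed.

Ltac check_single :=
  match goal with |- forall d, _ -> _ =>
    let d := fresh "d" in
    case=> d; rewrite /vadj !inE !vtx_eqE /=; lia end.
Ltac single q w := apply: (@two_separated_single _ q w);
  [ by [] | by rewrite /=; lia | by rewrite /=; lia | by rewrite !inE !vtx_eqE /=; lia
  | by rewrite !inE !vtx_eqE /=; lia | by rewrite ?vtx_eqE /=; lia | check_single ].

Ltac check_sep d1 d2 :=
  split;
  [ by rewrite !inE !vtx_eqE /=; split; lia
  | try (by exists (RimR 1); rewrite /=; lia); try (by exists (RimR 3); rewrite /=; lia);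
    try (by exists (RimL 1); rewrite /=; lia); by exists (RimL 3); rewrite /=; lia
  | by case=> c; rewrite !inE !vtx_eqE /=; lia
  | by case=> c [] d; rewrite /vadj !inE !vtx_eqE /=; lia
  | by exists d1, d2; rewrite !inE !vtx_eqE /=; split; lia ].

Lemma separate_hub_hub t : t <= i -> 
  [/\ two_separated [:: Hub t; Hub t.+1; V1 t], two_separated [:: Hub t; Hub t.+1; V2 t],
      two_separated [:: Hub t; Hub t.+1; V3 t] & two_separated [:: Hub t; Hub t.+1; V4 t]].
Proof.
move=> ht; split.
- by single (V2 t) (V4 t).
- by single (V3 t) (V4 t).
- by single (V2 t) (V1 t).
by single (V3 t) (V1 t).
Qed.

Lemma separate_V1_V1 t : t < i -> two_separated [:: Hub t.+1; V1 t; V1 t.+1].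
Proof. by move=> ht; single (V2 t) (Hub t). Qed.

Lemma separate_V1_RimL : two_separated [:: Hub i.+1; V1 i; RimL 1].
Proof. by single (V2 i) (Hub i). Qed.

Lemma separate_V1_RimR : two_separated [:: Hub 0; V1 0; RimR 1].
Proof. by single (V2 0) (Hub 1). Qed.

Lemma separate_V4_Mid t : t <= i -> two_separated [:: Hub t; V4 t; Mid t].
Proof. by move=> ht; single (V3 t) (Hub t.+1). Qed.

Lemma separate_V4_Mid_next t : t < i -> two_separated [:: Hub t.+1; V4 t; Mid t.+1].
Proof. by move=> ht; single (V3 t) (Hub t). Qed.

Lemma separate_V4_RimL a : two_separated [:: Hub i.+1; V4 i; RimL a].
Proof. by single (V3 i) (Hub i). Qed.

Lemma separate_V4_RimR a : two_separated [:: Hub 0; V4 0; RimR a].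
Proof. by single (V3 0) (Hub 1). Qed.

Lemma separate_RimR_RimR a : 0 < a -> a.+1 < k -> two_separated [:: Hub 0; RimR a; RimR a.+1].
Proof.
move=> a0 ak; case: (posnP a.-1) => a1.
  exists (fun x => if x is RimR j then a.+1 < j else false), (V4 0).
  by check_sep (V2 0) (V3 0).
exists (fun x => if x is RimR j then j < a else false), (V1 0).
by check_sep (V2 0) (V3 0).
Qed.

Lemma separate_RimL_RimL a : 0 < a -> a.+1 < l -> two_separated [:: Hub i.+1; RimL a; RimL a.+1].
Proof.
move=> a0 ak; case: (posnP a.-1) => a1.
  exists (fun x => if x is RimL j then a.+1 < j else false), (V4 i).
  by check_sep (V2 i) (V3 i).
exists (fun x => if x is RimL j then j < a else false), (V1 i).
by check_sep (V2 i) (V3 i).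
Qed.

Lemma separate_hub_V1_V2 t : t <= i -> two_separated [:: Hub t; V1 t; V2 t].
Proof.
move=> ht; exists (fun x => if x is RimR _ then true else lev x < t), (if t == 0 then V4 0 else Mid t).
case: posnP => t0.
  by rewrite t0; check_sep (V3 0) (Hub 1).
by check_sep (V3 t) (V4 t).
Qed.

Lemma separate_V1_V2_hub t : t <= i -> two_separated [:: Hub t.+1; V1 t; V2 t].
Proof.
move=> ht; case: (eqVneq t i) => [->|ti].
  exists (fun x => if x is RimL _ then true else false), (V4 i).
  by check_sep (V3 i) (Hub i).
exists (fun x => [&& t < lev x, x != Hub t.+1 & x != Mid t.+1]), (Mid t.+1).
by check_sep (V3 t) (V4 t).
Qed.

Lemma separate_hub_V3_V4 t : t <= i -> two_separated [:: Hub t; V3 t; V4 t].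
Proof.
move=> ht.
exists (fun x => if x is RimR _ then true else (lev x < t) || (x == Mid t)), (V1 t).
by check_sep (V2 t) (Hub t.+1).
Qed.

Lemma separate_V3_V4_hub t : t <= i -> two_separated [:: Hub t.+1; V3 t; V4 t].
Proof.
move=> ht; exists (fun x => (t < lev x) && (x != Hub t.+1)), (V1 t).
by check_sep (V2 t) (Hub t).
Qed.

(** Sorting the vertices of a triangle by kind leaves one order of each to be
    examined. *)
Definition kind (x : vtx) : nat :=
  match x with
  | Hub _ => 0 | V1 _ => 1 | V2 _ => 2 | V3 _ => 3 | V4 _ => 4 | Mid _ => 5
  | RimL _ => 6 | RimR _ => 7
  end.

Lemma two_separated_swap12 x y z : two_separated [:: x; y; z] -> two_separated [:: y; x; z].
Proof. by apply: two_separated_perm => v; rewrite !inE orbCA. Qed.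

Lemma two_separated_swap23 x y z : two_separated [:: x; y; z] -> two_separated [:: x; z; y].
Proof. by apply: two_separated_perm => v; rewrite !inE; congr (_ || _); rewrite orbC. Qed.

Lemma sorted_triangle_separated x y z : kind x <= kind y <= kind z ->
  vadj x y -> vadj x z -> vadj y z -> two_separated [:: x; y; z].
Proof.
case/andP=> kxy kyz /and3P[vx vy axy] /and3P[_ vz axz] /and3P[_ _ ayz].
move: kxy kyz vx vy vz axy axz ayz.
case: x => s; case: y => t //; case: z => u // _ _ vx vy vz axy axz ayz;
  rewrite /= in vx vy vz axy axz ayz; try (exfalso; lia).
1-4: have [s1 s2 s3 s4] := separate_hub_hub vz;
  (have [[-> ->]|[-> ->]] : (s = u /\ t = u.+1) \/ (s = u.+1 /\ t = u) by lia);
  by [] || exact: two_separated_swap12.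
- have [[-> [-> lt]]|[-> [-> lt]]] : s = t.+1 /\ u = t.+1 /\ t < i \/
    s = u.+1 /\ t = u.+1 /\ u < i by lia.
    exact: separate_V1_V1.
  exact/two_separated_swap23/separate_V1_V1.
- have -> : u = t by lia.
  have [->|->] : s = t \/ s = t.+1 by lia.
    exact: separate_hub_V1_V2.
  exact: separate_V1_V2_hub.
- have [-> -> ->] : [/\ s = i.+1, t = i & u = 1] by split; lia.
  exact: separate_V1_RimL.
- have [-> -> ->] : [/\ s = 0, t = 0 & u = 1] by split; lia.
  exact: separate_V1_RimR.
- have -> : u = t by lia.
  have [->|->] : s = t \/ s = t.+1 by lia.
    exact: separate_hub_V3_V4.
  exact: separate_V3_V4_hub.
- have [[-> ->]|[-> [-> lt]]] : s = t /\ u = t \/ s = t.+1 /\ u = t.+1 /\ t < i by lia.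
    exact: separate_V4_Mid.
  exact: separate_V4_Mid_next.
- have [-> ->] : s = i.+1 /\ t = i by split; lia.
  exact: separate_V4_RimL.
- have [-> ->] : s = 0 /\ t = 0 by split; lia.
  exact: separate_V4_RimR.
- have -> : s = i.+1 by lia.
  have [e|e] : u = t.+1 \/ t = u.+1 by lia.
    by rewrite e; apply: separate_RimL_RimL; lia.
  by rewrite e; apply/two_separated_swap23/separate_RimL_RimL; lia.
have -> : s = 0 by lia.
have [e|e] : u = t.+1 \/ t = u.+1 by lia.
  by rewrite e; apply: separate_RimR_RimR; lia.
by rewrite e; apply/two_separated_swap23/separate_RimR_RimR; lia.
Qed.

Lemma triangle_separated x y z : vadj x y -> vadj x z -> vadj y z ->
  two_separated [:: x; y; z].
Proof.
have sorted u v w : kind u <= kind v -> vadj u v -> vadj u w -> vadj v w ->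
    two_separated [:: u; v; w].
  move=> kuv uv uw vw; have [kvw|/ltnW kwv] := leqP (kind v) (kind w).
    by apply: sorted_triangle_separated; rewrite ?kuv.
  apply: two_separated_swap23; have [kuw|/ltnW kwu] := leqP (kind u) (kind w).
    by apply: sorted_triangle_separated; rewrite ?kuw // vadjC.
  by apply: two_separated_swap12; apply: sorted_triangle_separated; rewrite ?kwu // vadjC.
move=> xy xz yz; have [kxy|/ltnW kyx] := leqP (kind x) (kind y); first exact: sorted.
by apply: two_separated_swap12; apply: sorted; rewrite // vadjC.
Qed.

(** The vertex [u] of [H] that the triangle replaces would form a 2-separation
    with the vertex [w] of [triangle_separated]. *)
Lemma not_splicing_brick_K4 (H K : mgraph) : brick H ->
  iso (underlying_simple K) (complete_graph 4) -> ~ is_splicing G H K.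
Proof.
move=> brickH isoK /(splicing_triangle isoK).
case=> a [b [c [u [psi [ab ac bc [psi_inj psi_out psi_sur] psi_edge]]]]].
have vadj_vout p q : @adj G p q -> vadj (vout p) (vout q).
  by move=> pq; rewrite -adj_vin ?vout_valid // !voutK.
have [C [w [[vw wT Cw] [c0 vc0 Cc0] CT CN [d1 [d2 [vd1 vd2 nd h1 h2]]]]]] :=
  triangle_separated (vadj_vout _ _ ab) (vadj_vout _ _ ac) (vadj_vout _ _ bc).
have voutT p : (vout p \in [:: vout a; vout b; vout c]) = (p \in [:: a; b; c]).
  by rewrite !inE !(can_eq voutK).
have lift x : valid x -> x \notin [:: vout a; vout b; vout c] ->
    exists2 h, h != u & psi h = vin x.
  by move=> vx xT; apply: psi_sur; rewrite -voutT vinK.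
have [y yu ey] := lift w vw wT.
pose CH := [set h | (h != u) && C (vout (psi h))].
have inCH h x : valid x -> h != u -> psi h = vin x -> (h \in CH) = C x.
  by move=> vx hu eh; rewrite inE hu eh vinK.
have outD x h : valid x -> [&& ~~ C x, x \notin [:: vout a; vout b; vout c] & x != w] ->
    h != u -> psi h = vin x -> h \in ~: (u |: (y |: CH)).
  move=> vx /and3P[Cx xT xw] hu eh; rewrite in_setC 2!in_setU1 (inCH h x) //.
  rewrite (negbTE hu) (negbTE Cx) orbF /=; apply: contra_neq xw => hy.
  by apply: (vin_inj vx vw); rewrite -eh hy.
have [g1 g1u e1] := lift d1 vd1 (proj1 (andP (proj2 (andP h1)))).
have [g2 g2u e2] := lift d2 vd2 (proj1 (andP (proj2 (andP h2)))).
have ng : g1 != g2 by apply: contra_neq nd => e; apply: (vin_inj vd1 vd2); rewrite -e1 e.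
have bigD : 2 <= #|~: (u |: (y |: CH))|.
  apply: (@leq_trans #|[set g1; g2]|); first by rewrite cards2 ng.
  apply: subset_leq_card; rewrite subUset !sub1set.
  by rewrite (outD d1) // (outD d2).
apply: (@brick_no_two_separation H CH u y brickH).
- by rewrite eq_sym.
- by rewrite inE eqxx.
- by rewrite (inCH y w).
- have [h hu eh] := lift c0 vc0 (CT _ Cc0).
  by apply/set0Pn; exists h; rewrite (inCH h c0).
- move=> e /set0Pn[h /setIP[he hC]]; have hu : h != u by move: hC; rewrite inE => /andP[].
  have [ue|nue] := boolP (u \in ends e).
    rewrite (ends_mem2 _ ue he) 1?eq_sym // subUset !sub1set !in_setU1 eqxx hC.
    by rewrite !orbT.
  have [e' ee'] := psi_edge e nue; apply/subsetP => g ge.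
  have gu : g != u by apply: contraNneq nue => <-.
  rewrite !in_setU1 (negbTE gu) /=; have [->|ngh] := eqVneq g h; first by rewrite hC orbT.
  have npsi : psi h != psi g by apply: contra_neq ngh => eg; apply: psi_inj.
  have : @adj G (psi h) (psi g).
    apply/existsP; exists e'; apply/eqP.
    by apply: ends_mem2 => //; rewrite ee'; apply: imset_f.
  move/vadj_vout => adj_hg; move: hC; rewrite inE => /andP[_ hC].
  case/or3P: (CN _ _ hC adj_hg) => [Cg|gT|/eqP gw].
  + by rewrite inE gu Cg orbT.
  + by have := psi_out g gu; rewrite -voutT gT.
  by rewrite (psi_inj g y) ?eqxx // ey -gw voutK.
- by apply: leq_trans bigD.
by right.
Qed.

End Family.

Theorem theorem3p1 (l k : nat) (hl : 5 <= l) (hk : 5 <= k)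
    (odd_l : odd l) (odd_k : odd k) (i : nat) :
  [/\ nonsolid_brick (G_ l k i),
      forall e : edge (G_ l k i), removable e -> solitary e &
      ~ exists H K : mgraph,
          [/\ brick H, iso (underlying_simple K) (complete_graph 4) &
              is_splicing (G_ l k i) H K]].
Proof.
split.
- exact: G_nonsolid_brick.
- exact: (removable_solitary hl hk odd_l odd_k).
by case=> H [K [brickH isoK]]; exact: not_splicing_brick_K4.
Qed.
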